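(* Let $((A,A^* ),\mu,\gamma)$ be a Lie bialgebroid, $(\omega_1,\omega_2,\omega_3)$ a triplet of $2$-forms and $(\pi_1,\pi_2,\pi_3)$ a triplet of bivectors on $A$, and let $$\mathcal{S}_i=\begin{pmatrix}0&-\pi_i^{\sharp}\\ \omega_i^{\flat}&0\end{pmatrix}:A\oplus A^*\to A\oplus A^*,\qquad i=1,2,3 .$$ The following assertions are equivalent: (i) $(\omega_1,\omega_2,\omega_3)$ is a hypersymplectic structure with torsion on the Lie algebroid $(A,\mu)$ and $(\pi_1,\pi_2,\pi_3)$ is a hypersymplectic structure with torsion on the Lie algebroid $(A^*,\gamma)$, with $\pi_i$ the inverse of $\omega_i$, $i=1,2,3$; (ii) $(\mathcal{S}_1,\mathcal{S}_2,\mathcal{S}_3)$ is a hypersymplectic structure on the pre-Courant algebroid $(A\oplus A^*,\mu+\gamma+\psi+\phi)$, for some $\psi\in\Gamma(\wedge^3A)$ and $\phi\in\Gamma(\wedge^3A^* )$.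
   Context: $A\to M$ is a real vector bundle. For $\omega\in\Gamma(\wedge^2A^* )$ and $\pi\in\Gamma(\wedge^2A)$, $\omega^\flat:A\to A^*$, $\langle\omega^\flat X,Y\rangle=\omega(X,Y)$, and $\pi^\sharp:A^*\to A$, $\langle\beta,\pi^\sharp\alpha\rangle=\pi(\alpha,\beta)$; $\pi$ is the inverse of $\omega$ if $\pi^\sharp\circ\omega^\flat=\mathrm{id}_A$. Indices are in $\mathbb{Z}_3=\{1,2,3\}$. Hypersymplectic with torsion: a triplet $(\omega_1,\omega_2,\omega_3)$ of non-degenerate $2$-forms on a Lie algebroid $(A,\mu)$ with inverses $\pi_1,\pi_2,\pi_3\in\Gamma(\wedge^2A)$ is a hypersymplectic structure with torsion on $(A,\mu)$ if the transition morphisms $N_i:=\pi_{i-1}^\sharp\circ\omega_{i+1}^\flat:A\to A$ satisfy $N_i^2=-\mathrm{id}_A$, $i=1,2,3$, and $N_1\mathrm{d}\omega_1=N_2\mathrm{d}\omega_2=N_3\mathrm{d}\omega_3$, where $N_i\mathrm{d}\omega_i(X,Y,Z)=\mathrm{d}\omega_i(N_iX,N_iY,N_iZ)$ and $\mathrm{d}$ is the Lie algebroid differential. The same definition is applied to $(A^*,\gamma)$, where, by $A=(A^* )^*$, bivectors $\pi_i$ on $A$ are viewed as $2$-forms on $A^*$ (and their inverses $\omega_i$ as bivectors on $A^*$; the transition morphisms are then $\omega_{i-1}^\flat\circ\pi_{i+1}^\sharp:A^*\to A^*$). Big bracket: $\mathcal{F}=C^\infty(T^*[2]A[1])$ with its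 canonical Poisson bracket $\{\cdot,\cdot\}$ (the big bracket), given in local coordinates $x_i,\xi_a$ on $A[1]$ and conjugate $p^i,\theta^a$ by $\{p^i,x_i\}=\{\theta^a,\xi_a\}=1$, other brackets zero. Bidegrees: $x_i:(0,0)$, $\xi_a:(0,1)$, $p^i:(1,1)$, $\theta^a:(1,0)$; $\mathcal{F}^{k,l}$ is the space of functions of bidegree $(k,l)$, $\mathcal{F}^{k,0}=\Gamma(\wedge^kA)$, $\mathcal{F}^{0,l}=\Gamma(\wedge^lA^* )$. A Lie algebroid structure on $A$ (resp. $A^*$) is an element $\mu\in\mathcal{F}^{1,2}$ with $\{\mu,\mu\}=0$ (resp. $\gamma\in\mathcal{F}^{2,1}$ with $\{\gamma,\gamma\}=0$), with bracket and anchor given by $\{\{X,\mu\},Y\}$ and $\{\{X,\mu\},f\}$ (resp. $\{\{\alpha,\gamma\},\beta\}$ and $\{\{\alpha,\gamma\},f\}$); $((A,A^* ),\mu,\gamma)$ is a Lie bialgebroid if moreover $\{\mu,\gamma\}=0$. $A\oplus A^*$ carries $\langle X+\alpha,Y+\beta\rangle=\alpha(Y)+\beta(X)$. Any $\Theta$ of total degree $3$ in $\mathcal{F}$ defines a pre-Courant structure on $A\oplus A^*$, with anchor $\rho(e)\cdot f=\{\{e,\Theta\},f\}$ and Dorfman bracket $[e,e']=\{\{e,\Theta\},e'\}$ (pre-Courant means $\rho(e)\cdot\langle e',e''\rangle=\langle[e,e'],e''\rangle+\langle e',[e,e'']\rangle=\langle e,[e',e'']+[e'',e']\rangle$). For a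 pre-Courant structure $\Theta=(\rho,[\cdot,\cdot])$ on $E$ and a bundle endomorphism $\mathcal{I}$ of $E$, $\Theta_{\mathcal{I}}=(\rho\circ\mathcal{I},[\cdot,\cdot]_{\mathcal{I}})$ with $[e,e']_{\mathcal{I}}=[\mathcal{I}e,e']+[e,\mathcal{I}e']-\mathcal{I}[e,e']$, and $\Theta_{\mathcal{I},\mathcal{J}}=(\Theta_{\mathcal{I}})_{\mathcal{J}}$. A hypersymplectic structure on $(E,\Theta)$ is a triplet $(\mathcal{S}_1,\mathcal{S}_2,\mathcal{S}_3)$ of endomorphisms of $E$, skew-symmetric with respect to $\langle\cdot,\cdot\rangle$, such that $\mathcal{S}_i^2=-\mathrm{id}_E$, $\mathcal{S}_i\mathcal{S}_j=-\mathcal{S}_j\mathcal{S}_i$ for $i\neq j$, and $\Theta_{\mathcal{S}_i,\mathcal{S}_i}=-\Theta$, for $i,j\in\{1,2,3\}$. *)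

(* Defs.v *)
From HB Require Import structures.
From mathcomp Require Import all_boot all_order all_algebra.
From mathcomp Require Import all_classical all_reals all_analysis.

Set Implicit Arguments.
Unset Strict Implicit.
Unset Printing Implicit Defensive.

Import Order.TTheory GRing.Theory Num.Theory.
Import numFieldNormedType.Exports.

Local Open Scope classical_set_scope.
Local Open Scope ring_scope.

Fixpoint Cdiff (R : realType) (n k : nat) (U : set 'rV[R]_n)
    (f : 'rV[R]_n -> R) : Prop :=
  match k with
  | 0 => forall x, U x -> {for x, continuous f}
  | k'.+1 => (forall x, U x -> differentiable f x) /\
      forall j : 'I_n, Cdiff k' U (fun x => 'D_(delta_mx 0 j) f x)
  end.

(* meant for U open *)
Definition Cinf (R : realType) (n : nat) (U : set 'rV[R]_n)
  (f : 'rV[R]_n -> R) : Prop := forall k, Cdiff k U f.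

Lemma near_eq_differentiable (R : realType) (V W : normedModType R)
    (f g : V -> W) (x : V) :
  {near x, f =1 g} -> differentiable f x -> differentiable g x.
Proof.
move=> fg df; have [dfc fE] := (diff_locallyP x f).1 df.
have gE : g \o shift x = cst (g x) + 'd f x +o_ (0 : V) id.
  have fg0 : \forall h \near (0 : V), f (h + x) = g (h + x).
    by move: fg; rewrite (near_shift 0 x) subr0.
  have fx := nbhs_singleton fg.
  apply/eqaddoP => e e0; move/eqaddoP/(_ e e0) : fE => fE.
  near=> h; have : f (h + x) = g (h + x) by near: h.
  have : `|(f \o shift x - (cst (f x) + 'd f x)) h| <= e * `|id h|.
    by near: h.
  by rewrite !fctE /= fx => + <-.
apply/diff_locallyP; have dgE := diff_unique dfc gE.
by rewrite dgE.
Unshelve. all: by end_near. Qed.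

Lemma Cdiff_ext (R : realType) (n k : nat) (U : set 'rV[R]_n)
    (f g : 'rV[R]_n -> R) :
  open U -> (forall x, U x -> f x = g x) -> Cdiff k U f -> Cdiff k U g.
Proof.
move=> oU; elim: k f g => [|k IH] f g fg /=; have nfg x (Ux : U x) :
    {near x, f =1 g} by apply: filterS fg _; exact: open_nbhs_nbhs.
  move=> fc x Ux; rewrite /prop_for /continuous_at -(fg _ Ux).
  by apply: cvg_trans (fc x Ux); exact: near_eq_cvg (nfg x Ux).
move=> [fd fD]; split=> [x Ux|j].
  exact: near_eq_differentiable (nfg x Ux) (fd x Ux).
by apply: (IH _ _ _ (fD j)) => x Ux; exact: near_eq_derive (nfg x Ux).
Qed.

Record manifold (R : realType) (n : nat) := Manifold {
  mpoint :> topologicalType ;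
  mpoint_hausdorff : hausdorff_space mpoint ;
  mpoint_second_countable : @second_countable mpoint ;
  cidx : Type ;
  cdom : cidx -> set mpoint ;
  chart : cidx -> mpoint -> 'rV[R]_n ;
  unchart : cidx -> 'rV[R]_n -> mpoint ;
  cdom_open : forall i, open (cdom i) ;
  cdom_cover : forall x, exists i, cdom i x ;
  chart_open : forall i, open (chart i @` cdom i) ;
  chartK : forall i x, cdom i x -> unchart i (chart i x) = x ;
  chart_cont : forall i x, cdom i x -> {for x, continuous (chart i)} ;
  unchart_cont : forall i y, (chart i @` cdom i) y ->
    {for y, continuous (unchart i)} ;
  chart_smooth : forall i j (k : 'I_n),
    Cinf (chart i @` (cdom i `&` cdom j))
         (fun y => chart j (unchart i y) 0 k)
}.

Section OnManifold.
Variables (R : realType) (n : nat) (M : manifold R n).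

(* smoothness on an open set U of M *)
Definition smooth_on (U : set M) (f : M -> R) : Prop :=
  forall i : cidx M,
    Cinf (chart i @` (cdom i `&` U)) (fun y => f (unchart i y)).

Definition smooth_fun (f : M -> R) : Prop := smooth_on setT f.

Lemma chart_image_open (i : cidx M) (U : set M) :
  open U -> open (chart i @` (cdom i `&` U)).
Proof.
move=> oU; rewrite openE /= => y [x [ix Ux] xy]; rewrite -xy /interior.
have : nbhs (chart i x) (chart i @` cdom i).
  by apply: open_nbhs_nbhs; split; [exact: chart_open|exists x].
have : nbhs (chart i x) (unchart i @^-1` U).
  apply: unchart_cont; first by exists x.
  by rewrite chartK//; exact: open_nbhs_nbhs.
apply: filterS2 => z /= Uz [t it tz]; exists t => //; split=> //.
by move: Uz; rewrite -tz chartK.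
Qed.

Lemma smooth_on_ext (U : set M) (f g : M -> R) :
  open U -> (forall x, U x -> f x = g x) -> smooth_on U f -> smooth_on U g.
Proof.
move=> oU fg sf i k; apply: Cdiff_ext (sf i k); first exact: chart_image_open.
by move=> _ [x [ix Ux] <-]; rewrite chartK// fg.
Qed.

Definition pd (i : cidx M) (k : 'I_n) (f : M -> R) (x : M) : R :=
  'D_(delta_mx 0 k) (fun y => f (unchart i y)) (chart i x).

(* A vector bundle of rank r over M, given by its fibres and a trivializing
   cover by local frames whose transition matrices are smooth. *)
Record vbundle (r : nat) := VBundle {
  fib :> M -> vectType R ;
  tidx : Type ;
  tdom : tidx -> set M ;
  frame : tidx -> forall x, r.-tuple (fib x) ;
  tdom_open : forall c, open (tdom c) ;
  tdom_cover : forall x, exists c, tdom c x ;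
  frame_basis : forall c x, tdom c x -> basis_of fullv (frame c x) ;
  frame_smooth : forall c c' (a b : 'I_r),
    smooth_on (tdom c `&` tdom c')
      (fun x => coord (frame c x) a (tnth (frame c' x) b))
}.

Section OnBundle.
Variables (r : nat).

Definition section (V : vbundle r) : Type := forall x : M, V x.

Definition smooth_section (V : vbundle r) (s : section V) : Prop :=
  forall (c : tidx V) (a : 'I_r),
    smooth_on (tdom c) (fun x => coord (frame c x) a (s x)).

Definition dual_fib (V : vbundle r) (x : M) : vectType R := 'Hom(V x, R^o).

Definition dual_frame (V : vbundle r) (c : tidx V) (x : M) :
    r.-tuple (dual_fib V x) :=
  [tuple linfun (coord (frame c x) a : V x -> R^o) | a < r].

Lemma dual_frameE (V : vbundle r) (c : tidx V) (x : M) a v :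
  tnth (dual_frame c x) a v = coord (frame c x) a v.
Proof. by rewrite tnth_mktuple lfunE. Qed.

Lemma dual_frame_sum (V : vbundle r) (c : tidx V) (x : M) (al : dual_fib V x) :
  tdom c x ->
  al = \sum_(a < r) al (tnth (frame c x) a) *: tnth (dual_frame c x) a.
Proof.
move=> cx; apply/lfunP => v; rewrite sum_lfunE.
rewrite {1}(coord_basis (frame_basis cx) (memvf v)) linear_sum.
apply: eq_bigr => a _; rewrite linearZ scale_lfunE dual_frameE.
by rewrite (tnth_nth 0); exact: mulrC.
Qed.

Lemma dual_frame_basis (V : vbundle r) (c : tidx V) (x : M) :
  tdom c x -> basis_of fullv (dual_frame c x).
Proof.
move=> cx; have fr := basis_free (frame_basis cx).
rewrite /basis_of; apply/andP; split.
  apply/eqP/vspaceP => al; rewrite memvf (dual_frame_sum al cx).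
  by apply: memv_suml => a _; apply/memvZ/memv_span/mem_tnth.
apply/freeP => k /lfunP k0 a; move: (k0 (tnth (frame c x) a)).
rewrite sum_lfunE zero_lfunE (bigD1 a) //= big1 => [|b ba].
  rewrite scale_lfunE -(tnth_nth 0 (dual_frame c x)) dual_frameE (tnth_nth 0) coord_free//.
  by rewrite eqxx addr0 => <-; symmetry; exact: mulr1.
rewrite scale_lfunE -(tnth_nth 0 (dual_frame c x)) dual_frameE (tnth_nth 0) coord_free//.
by rewrite eq_sym (negbTE ba) scaler0.
Qed.

Lemma dual_coord (V : vbundle r) (c : tidx V) (x : M) a (al : dual_fib V x) :
  tdom c x -> coord (dual_frame c x) a al = al (tnth (frame c x) a).
Proof.
move=> cx; rewrite {1}(dual_frame_sum al cx).
under eq_bigr => b _ do rewrite (tnth_nth 0 (dual_frame c x)).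
by rewrite coord_sum_free// (basis_free (dual_frame_basis cx)).
Qed.

Lemma dual_frame_smooth (V : vbundle r) (c c' : tidx V) (a b : 'I_r) :
  smooth_on (tdom c `&` tdom c')
    (fun x => coord (dual_frame c x) a (tnth (dual_frame c' x) b)).
Proof.
apply: (@smooth_on_ext _
  (fun x => coord (frame c' x) b (tnth (frame c x) a))).
- by apply: openI; exact: tdom_open.
- by move=> x [cx _]; rewrite dual_coord// dual_frameE.
- by rewrite setIC; exact: frame_smooth.
Qed.

Definition dual (V : vbundle r) : vbundle r :=
  @VBundle r (dual_fib V) (tidx V) (@tdom r V) (@dual_frame V)
    (@tdom_open r V) (@tdom_cover r V) (@dual_frame_basis V)
    (@dual_frame_smooth V).

(* a 2-form on V, i.e. a section of the second exterior power of the dual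
   of V; a bivector on V is a 2-form on dual V *)
Record form2 (V : vbundle r) := Form2 {
  form :> forall x : M, V x -> V x -> R ;
  form_linear : forall x (a : R) (u v w : V x),
    form (a *: u + v) w = a * form u w + form v w ;
  form_skew : forall x (u v : V x), form u v = - form v u ;
  form_smooth : forall (c : tidx V) (a b : 'I_r),
    smooth_on (tdom c)
      (fun x => form (tnth (frame c x) a) (tnth (frame c x) b))
}.

(* omega^flat : V -> V^*,  <flat X, Y> = omega(X, Y) *)
Definition flat (V : vbundle r) (om : form2 V) (x : M) (X : V x) : dual V x :=
  linfun (om x X : V x -> R^o).

(* pi^sharp : V^* -> V, sharp al being the X with <be, X> = pi(al, be) *)
Definition sharp (V : vbundle r) (pi : form2 (dual V)) (x : M)
    (al : dual V x) : V x :=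
  xget 0 [set X : V x | forall be : dual_fib V x, be X = pi x al be].

(* S is a type of sections; an anchor lets sections act on functions. *)
Record anchored (S : Type) := Anchored {
  anchor : S -> (M -> R) -> (M -> R) ;
  bracket : S -> S -> S
}.

Definition diff2 (V : vbundle r) (L : anchored (section V)) (om : form2 V)
    (X Y Z : section V) (x : M) : R :=
  let ev (U W : section V) : M -> R := fun y => om y (U y) (W y) in
  anchor L X (ev Y Z) x - anchor L Y (ev X Z) x + anchor L Z (ev X Y) x
  - ev (bracket L X Y) Z x + ev (bracket L X Z) Y x - ev (bracket L Y Z) X x.

(* The triplet om on V with the triplet of inverses given by their maps
   shp : W -> V, where W plays the role of V^* and flt : V -> W that of the
   maps of om. Indices live in Z/3, the index 3 being 0. *)
Definition hypersymplectic_torsion (V W : vbundle r)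
    (L : anchored (section V)) (om : 'Z_3 -> form2 V)
    (flt : 'Z_3 -> forall x : M, V x -> W x)
    (shp : 'Z_3 -> forall x : M, W x -> V x) : Prop :=
  let N i x (X : V x) : V x := shp (i - 1) x (flt (i + 1) x X) in
  [/\ forall i x (X : V x), (forall Y, om i x X Y = 0) -> X = 0,
      forall i x (X : V x), shp i x (flt i x X) = X,
      forall i x (X : V x), N i x (N i x X) = - X &
      forall i j (X Y Z : section V),
        smooth_section X -> smooth_section Y -> smooth_section Z ->
        forall x,
          diff2 L (om i) (fun y => N i y (X y)) (fun y => N i y (Y y))
                         (fun y => N i y (Z y)) x =
          diff2 L (om j) (fun y => N j y (X y)) (fun y => N j y (Y y))
                         (fun y => N j y (Z y)) x].

Definition gen : Type := ('I_n + ('I_r + 'I_r))%type.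
Definition gp (k : 'I_n) : gen := inl k.
Definition gxi (a : 'I_r) : gen := inr (inl a).
Definition gth (a : 'I_r) : gen := inr (inr a).

Definition bideg (g : gen) : nat * nat :=
  match g with
  | inl _ => (1, 1)
  | inr (inl _) => (0, 1)
  | inr (inr _) => (1, 0)
  end%N.

Definition odd_gen (g : gen) : bool := odd ((bideg g).1 + (bideg g).2).

Definition odd_word (w : seq gen) : bool := odd (count odd_gen w).

(* A graded polynomial u in the generators is encoded by its Taylor
   coefficients: u [:: g1; ...; gm] is the value at the origin of
   d_gm ... d_g1 u, the d_g being left derivatives. Hence prepending
   (resp. appending) a letter g is taking the left (resp. right) derivative
   along g, and the product is given by the graded Leibniz rule. *)
Definition gpoly : Type := seq gen -> R.

Definition dleft (g : gen) (u : gpoly) : gpoly := fun w => u (g :: w).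
Definition dright (g : gen) (u : gpoly) : gpoly := fun w => u (rcons w g).

Definition ginvol (b : bool) (u : gpoly) : gpoly :=
  fun w => (-1) ^+ (b && odd_word w) * u w.

Fixpoint gmul (u v : gpoly) (w : seq gen) : R :=
  match w with
  | [::] => u [::] * v [::]
  | g :: w' => gmul (dleft g u) v w'
               + gmul (ginvol (odd_gen g) u) (dleft g v) w'
  end.

(* Substitution of y h for each generator h in u, for y even and without
   constant term, computed by the chain rule; k bounds the length of w. *)
Fixpoint gsubst_rec (k : nat) (y : gen -> gpoly) (u : gpoly) : gpoly :=
  fun w =>
  match w, k with
  | [::], _ => u [::]
  | _ :: _, 0 => 0
  | g :: w', k'.+1 =>
      \sum_(h : gen) gmul (dleft g (y h)) (gsubst_rec k' y (dleft h u)) w'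
  end.

Definition gsubst (y : gen -> gpoly) (u : gpoly) : gpoly :=
  fun w => gsubst_rec (size w) y u w.

Section BigBracket.
Variable A : vbundle r.

(* Local coordinates on T^*[2]A[1]: a chart of M and a local frame e_a of A.
   xi_a is dual to e_a, and theta^a is e_a. *)
Definition trivz : Type := (cidx M * tidx A)%type.
Definition tzdom (t : trivz) : set M := cdom t.1 `&` tdom t.2.

(* The coordinates p', xi', theta' attached to t' in terms of those attached
   to t, at the point x: with e'_a = \sum_b g_ba e_b,
     xi'_a    = \sum_b (g^-1)_ab xi_b,
     theta'^a = \sum_b g_ba theta^b,
     p'^k     = \sum_j (dx_j/dx'_k) p^j
                + \sum_(a,c) (dg_ca/dx'_k) xi'_a theta^c,
   which is the only choice of p' such that x', p', xi', theta' are again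
   canonical coordinates. *)
Definition gchange (t t' : trivz) (x : M) (h : gen) : gpoly :=
  let g (b a : 'I_r) (y : M) :=
    coord (frame t.2 y) b (tnth (frame t'.2 y) a) in
  let ginv (a b : 'I_r) :=
    coord (frame t'.2 x) a (tnth (frame t.2 x) b) in
  let C (k : 'I_n) (b c : 'I_r) :=
    \sum_(a < r) pd t'.1 k (g c a) x * ginv a b in
  fun w =>
  match h, w with
  | inl k, [:: inl j] => pd t'.1 k (fun y => chart t.1 y 0 j) x
  | inl k, [:: inr (inl b); inr (inr c)] => C k b c
  | inl k, [:: inr (inr c); inr (inl b)] => - C k b c
  | inr (inl a), [:: inr (inl b)] => ginv a b
  | inr (inr a), [:: inr (inr b)] => g b a x
  | _, _ => 0
  end.

(* one local expression for each system of coordinates; only its values over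
   tzdom t matter *)
Definition gfamily : Type := trivz -> M -> gpoly.

(* u is an element of F^{k,l}; the last clause glues the local expressions *)
Definition gfunction (k l : nat) (u : gfamily) : Prop :=
  [/\ forall t w, smooth_on (tzdom t) (fun x => u t x w),
      forall t x s g h s', tzdom t x ->
        u t x (s ++ g :: h :: s') =
        (-1) ^+ (odd_gen g && odd_gen h) * u t x (s ++ h :: g :: s'),
      forall t x w, tzdom t x -> u t x w <> 0 ->
        sumn [seq (bideg g).1 | g <- w] = k /\
        sumn [seq (bideg g).2 | g <- w] = l &
      forall t t' x w, tzdom t x -> tzdom t' x ->
        u t x w = gsubst (gchange t t' x) (u t' x) w].

Definition gadd (u v : gfamily) : gfamily := fun t x w => u t x w + v t x w.

Definition gnull (u : gfamily) : Prop :=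
  forall t x w, tzdom t x -> u t x w = 0.

(* {u, v}, normalized by {p^k, x_k} = {theta^a, xi_a} = 1 *)
Definition big_bracket (u v : gfamily) : gfamily := fun t x w =>
  let dx k (f : gfamily) : gpoly := fun s => pd t.1 k (fun y => f t y s) x in
  \sum_(k < n) (gmul (dright (gp k) (u t x)) (dx k v) w
                - gmul (dx k u) (dleft (gp k) (v t x)) w)
  + \sum_(a < r) (gmul (dright (gth a) (u t x)) (dleft (gxi a) (v t x)) w
                  + gmul (dright (gxi a) (u t x)) (dleft (gth a) (v t x)) w).

Definition Efib (x : M) : vectType R := (A x * dual A x)%type.
Definition Esection : Type := forall x : M, Efib x.

Definition smooth_Esection (e : Esection) : Prop :=
  smooth_section (fun x => (e x).1 : A x) /\
  smooth_section (fun x => (e x).2 : dual A x).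

Definition Epair (x : M) (e e' : Efib x) : R :=
  (e.2 : dual_fib A x) e'.1 + (e'.2 : dual_fib A x) e.1.

Definition gfun (f : M -> R) : gfamily := fun _ x w =>
  if w is [::] then f x else 0.

Definition gsec (e : Esection) : gfamily := fun t x w =>
  match w with
  | [:: inr (inl a)] => ((e x).2 : dual_fib A x) (tnth (frame t.2 x) a)
  | [:: inr (inr a)] => coord (frame t.2 x) a (e x).1
  | _ => 0
  end.

Definition triv_at (x : M) : trivz :=
  (sval (cid (cdom_cover x)), sval (cid (tdom_cover A x))).

(* The function (resp. the section of A + A^* ) with local expression u,
   for u of bidegree (0,0) (resp. of total degree 1). *)
Definition to_fun (u : gfamily) : M -> R := fun x => u (triv_at x) x [::].

Definition to_sec (u : gfamily) : Esection := fun x =>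
  let t := triv_at x in
  (\sum_(a < r) u t x [:: gth a] *: tnth (frame t.2 x) a,
   \sum_(a < r) u t x [:: gxi a] *: tnth (frame (t.2 : tidx (dual A)) x) a).

(* Dorfman bracket {{e, Th}, e'} and anchor {{e, Th}, f} *)
Definition courant (Th : gfamily) : anchored Esection :=
  Anchored
    (fun e f => to_fun (big_bracket (big_bracket (gsec e) Th) (gfun f)))
    (fun e e' => to_sec (big_bracket (big_bracket (gsec e) Th) (gsec e'))).

Definition inA (X : section A) : Esection := fun x => (X x, 0).
Definition inA' (al : section (dual A)) : Esection := fun x => (0, al x).

Definition liealgd (mu : gfamily) : anchored (section A) :=
  Anchored (fun X => anchor (courant mu) (inA X))
           (fun X Y x => (bracket (courant mu) (inA X) (inA Y) x).1).

Definition liealgd' (ga : gfamily) : anchored (section (dual A)) :=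
  Anchored (fun al => anchor (courant ga) (inA' al))
           (fun al be x => (bracket (courant ga) (inA' al) (inA' be) x).2).

Definition lie_bialgebroid (mu ga : gfamily) : Prop :=
  [/\ gfunction 1 2 mu /\ gnull (big_bracket mu mu),
      gfunction 2 1 ga /\ gnull (big_bracket ga ga) &
      gnull (big_bracket mu ga)].

Definition Eendo (I : forall x, Efib x -> Efib x) : Prop :=
  (forall x (a : R) (e e' : Efib x), I x (a *: e + e') = a *: I x e + I x e')
  /\ (forall e : Esection, smooth_Esection e ->
        smooth_Esection (fun x => I x (e x))).

Definition deform (P : anchored Esection) (I : forall x, Efib x -> Efib x) :
    anchored Esection :=
  let ap (e : Esection) : Esection := fun x => I x (e x) in
  Anchored
    (fun e => anchor P (ap e))
    (fun e e' x => bracket P (ap e) e' x + bracket P e (ap e') x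
                   - ap (bracket P e e') x).

(* P = - Q, as structures on smooth sections *)
Definition opposite (P Q : anchored Esection) : Prop :=
  (forall e f, smooth_Esection e -> smooth_fun f ->
    forall x, anchor P e f x = - anchor Q e f x) /\
  (forall e e', smooth_Esection e -> smooth_Esection e' ->
    forall x, bracket P e e' x = - bracket Q e e' x).

Definition hypersymplectic (P : anchored Esection)
    (S : 'Z_3 -> forall x, Efib x -> Efib x) : Prop :=
  [/\ forall i, Eendo (S i) /\
        (forall x (e e' : Efib x), Epair (S i x e) e' = - Epair e (S i x e')),
      forall i x (e : Efib x), S i x (S i x e) = - e,
      forall i j, i != j ->
        forall x (e : Efib x), S i x (S j x e) = - S j x (S i x e) &
      forall i, opposite (deform (deform P (S i)) (S i)) P].

Definition Smat (om : 'Z_3 -> form2 A) (pi : 'Z_3 -> form2 (dual A))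
    (i : 'Z_3) (x : M) (e : Efib x) : Efib x :=
  (- sharp (pi i) (e.2 : dual A x), flat (om i) e.1).

End BigBracket.
End OnBundle.
End OnManifold.

(* Main.v *)
Require Import Defs.
From HB Require Import structures.
From mathcomp Require Import all_boot all_order all_algebra.
From mathcomp Require Import all_classical all_reals all_analysis.
From mathcomp Require Import ring lra.

Set Implicit Arguments.
Unset Strict Implicit.
Unset Printing Implicit Defensive.

Import Order.TTheory GRing.Theory Num.Theory.
Import numFieldNormedType.Exports.

Local Open Scope classical_set_scope.
Local Open Scope ring_scope.

(* Write [,] for the Dorfman bracket of the total structure and let S be one of
   the three endomorphisms. Since S^2 = -1, the condition on the double deformation
   amounts to the vanishing of the Nijenhuis torsion
     T(e,e') = [Se,Se'] - S[Se,e'] - S[e,Se'] - [e,e'].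
   As T(Se,e') = T(e,Se') = -S T(e,e'), it suffices to test T on three arguments
   all in A or all in A^*. For X, Y, Z in A,
     <T(SX,SY),SZ> = d omega(X,Y,Z) - <[SX,SY]_psi,SZ>,
   where only mu contributes to d omega, and dually with ga, pi and phi on A^*. With
   X = N_i X' one has S_i N_i = - S_i S_{i-1} S_{i+1}, which does not depend on i, so
   a common psi exists iff the N_i d omega_i coincide. Conversely T = 0 for
   i = 0 serves as the definition of psi: it is tensorial because the d omega term is
   skew-symmetric, it glues because the Dorfman bracket is independent of the local
   coordinates, and bump functions provide enough global sections to test T. *)

(** * Smooth functions on open sets of R^n *)

(** [courant] evaluates its bracket at each point in the trivialization [triv_at], which is picked
    by choice and varies without any continuity. So the bracket is replaced by the scalar [dorf]:
    fixed coordinates, sections in two slots, a vector at one point in the third. The algebra of S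
    then rests on two identities of [dorf], the pre-Courant axioms; two trivializations are compared
    only to make psi and phi glue. Why T separates the data: on arguments lying purely in A or in
    its dual, [dorf] sees just the component of the total structure whose second degree is the
    number of arguments in A, and S exchanges the two sides. For X, Y, Z in A, each of the first
    three terms of T on SX, SY, SZ becomes, by S^2 = -1, a bracket with S in exactly one slot: it
    has two arguments in A and sees mu. The last term has none and sees psi. T itself appears
    because the double deformation is 2 ([Se,Se'] - S[Se,e'] - S[e,Se']) - 3 [e,e'], which equals
    -[e,e'] exactly when T = 0. *)

Section EuclideanCalculus.
Variable R : realType.

Lemma row_sum_coord (n : nat) (T : Type) (phi : T -> 'rV[R]_n) :
  phi = \sum_(j < n) (fun y => phi y 0 j *: (delta_mx 0 j : 'rV[R]_n)).
Proof. by apply/funext => y; rewrite {1}[phi y]row_sum_delta fct_sumE. Qed.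

Lemma differentiable_row (V : normedModType R) (n : nat) (phi : V -> 'rV[R]_n)
    (x : V) :
  (forall j, differentiable (fun y => phi y 0 j) x) -> differentiable phi x.
Proof.
move=> d; rewrite (row_sum_coord phi); apply: differentiable_sum => j.
exact: differentiableZl.
Qed.

Lemma derive_comp_row (n m : nat) (f : 'rV[R]_m -> R) (phi : 'rV[R]_n -> 'rV[R]_m)
    (x v : 'rV[R]_n) :
  differentiable phi x -> differentiable f (phi x) ->
  'D_v (f \o phi) x =
    \sum_(j < m) 'D_(delta_mx 0 j) f (phi x) * 'D_v (fun y => phi y 0 j) x.
Proof.
move=> dp df.
have dj j : differentiable (fun y => phi y 0 j) x.
  exact: (differentiable_comp dp (differentiable_coord _ 0 j)).
rewrite deriveE; last exact: differentiable_comp.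
rewrite diff_comp//= -(deriveE _ dp).
have -> : 'D_v phi x = \sum_(j < m) 'D_v (fun y => phi y 0 j) x *: delta_mx 0 j.
  rewrite [LHS]row_sum_delta; apply: eq_bigr => j _; congr (_ *: _).
  rewrite derive_mx ?mxE//; exact: diff_derivable.
by rewrite linear_sum; apply: eq_bigr => j _; rewrite linearZ /= -deriveE// mulrC.
Qed.

Section Closure.
Variables (n : nat) (U : set 'rV[R]_n).
Hypothesis oU : open U.
Implicit Types f g : 'rV[R]_n -> R.

Lemma Cinf_differentiable f x : Cinf U f -> U x -> differentiable f x.
Proof. by move=> /(_ 1%N)[+ _]; exact. Qed.

Lemma Cinf_derive f j : Cinf U f -> Cinf U (fun x => 'D_(delta_mx 0 j) f x).
Proof. by move=> cf k; have [_] := cf k.+1; exact. Qed.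

Lemma Cinf_ext f g : (forall x, U x -> f x = g x) -> Cinf U f -> Cinf U g.
Proof. by move=> fg cf k; exact: Cdiff_ext (cf k). Qed.

Lemma Cinf_cst (a : R) : Cinf U (fun=> a).
Proof.
move=> k; elim: k a => [|k IH] a /=; first by move=> x _; exact: cst_continuous.
split=> [x _|j]; first exact: differentiable_cst.
by apply: Cdiff_ext (IH 0) => // x _; rewrite derive_cst.
Qed.

(** The product rule for [CdiffM] leaves undifferentiated factors, which must be brought down to the
    lower order. *)
Lemma CdiffS k f : Cdiff k.+1 U f -> Cdiff k U f.
Proof.
elim: k f => [|k IH] f [df cf].
  by move=> x Ux; apply: differentiable_continuous; exact: df.
by split=> // j; apply: IH; exact: cf.
Qed.

Lemma CdiffD k f g : Cdiff k U f -> Cdiff k U g -> Cdiff k U (fun x => f x + g x).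
Proof.
elim: k f g => [|k IH] f g /=.
  by move=> ca cb x Ux; apply: continuousD; [exact: ca|exact: cb].
move=> [da ca] [db cb]; split=> [x Ux|i].
  by apply: differentiableD; [exact: da|exact: db].
apply: (Cdiff_ext oU _ (IH _ _ (ca i) (cb i))) => x Ux.
by rewrite deriveD//; apply: diff_derivable; [exact: da|exact: db].
Qed.

Lemma CdiffM k f g : Cdiff k U f -> Cdiff k U g -> Cdiff k U (fun x => f x * g x).
Proof.
elim: k f g => [|k IH] f g.
  by move=> ca cb x Ux; apply: continuousM; [exact: ca|exact: cb].
move=> fk gk; have [[da ca] [db cb]] := (fk, gk); split=> [x Ux|i].
  by apply: differentiableM; [exact: da|exact: db].
apply: (Cdiff_ext oU _ (CdiffD (IH _ _ (CdiffS fk) (cb i))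
  (IH _ _ (CdiffS gk) (ca i)))) => x Ux.
by rewrite deriveM//; apply: diff_derivable; [exact: da|exact: db].
Qed.

Lemma Cdiff_sum k (I : Type) (s : seq I) (P : pred I) (F : I -> 'rV[R]_n -> R) :
  (forall i, P i -> Cdiff k U (F i)) ->
  Cdiff k U (fun x => \sum_(i <- s | P i) F i x).
Proof.
move=> cF; rewrite -fct_sumE; elim/big_rec: _ => [|i f Pi cf].
  exact: Cinf_cst.
by apply: CdiffD => //; exact: cF.
Qed.

Lemma CinfD f g : Cinf U f -> Cinf U g -> Cinf U (fun x => f x + g x).
Proof. by move=> cf cg k; exact: CdiffD. Qed.

Lemma CinfM f g : Cinf U f -> Cinf U g -> Cinf U (fun x => f x * g x).
Proof. by move=> cf cg k; exact: CdiffM. Qed.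

Lemma Cinf_sum (I : Type) (s : seq I) (P : pred I) (F : I -> 'rV[R]_n -> R) :
  (forall i, P i -> Cinf U (F i)) ->
  Cinf U (fun x => \sum_(i <- s | P i) F i x).
Proof. by move=> cF k; apply: Cdiff_sum => i Pi; exact: cF. Qed.

Lemma Cinf_sub (V : set 'rV[R]_n) f : V `<=` U -> Cinf U f -> Cinf V f.
Proof.
move=> VU cf k; elim: k f {cf}(cf k) => [|k IH] f /=.
  by move=> cf x /VU; exact: cf.
by move=> [df cf]; split=> [x /VU|j]; [exact: df|exact: IH].
Qed.

(** [Cdiff] is a pointwise condition on the iterated derivatives of one fixed total function, so
    each point can be tested through any set that contains it. *)
Lemma Cinf_local f :
  (forall x, U x -> exists V, V x /\ Cinf V f) -> Cinf U f.
Proof.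
move=> lf k; have {lf} : forall x, U x -> exists V, V x /\ Cdiff k V f.
  by move=> x /lf[V [Vx cf]]; exists V.
elim: k f => [|k IH] f /= lf.
  by move=> x /lf[V [Vx]]; exact.
split=> [x /lf[V [Vx [df _]]]|j]; first exact: df.
by apply: IH => x /lf[V [Vx [_ cf]]]; exists V; split.
Qed.

End Closure.

Lemma Cinf_coord (n : nat) (U : set 'rV[R]_n) j :
  open U -> Cinf U (fun x => x 0 j).
Proof.
move=> oU [|k] /=.
  by move=> x _; exact: differentiable_continuous (differentiable_coord _ _ _).
split=> [x Ux|i]; first exact: differentiable_coord.
apply: (Cdiff_ext oU _ (Cinf_cst oU ((delta_mx 0 i : 'rV[R]_n) 0 j) k)) => x Ux.
have dx : differentiable (id : 'rV[R]_n -> 'rV[R]_n) x by [].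
have := derive_mx (@diff_derivable _ _ _ _ _ (delta_mx 0 i : 'rV[R]_n) dx).
by rewrite derive_id => /matrixP/(_ 0 j); rewrite [RHS]mxE => ->.
Qed.

(** Induction on the order with [f] varying: by the chain rule a partial derivative of [f \o phi] is
    a sum of products of a partial derivative of [f] composed with [phi], to which the induction
    hypothesis applies, and a derivative of a coordinate of [phi]. *)
Lemma Cinf_comp (n m : nat) (U : set 'rV[R]_n) (V : set 'rV[R]_m)
    (f : 'rV[R]_m -> R) (phi : 'rV[R]_n -> 'rV[R]_m) :
  open U -> Cinf V f -> (forall j, Cinf U (fun x => phi x 0 j)) ->
  (forall x, U x -> V (phi x)) -> Cinf U (f \o phi).
Proof.
move=> oU + cp UV; have dphi x : U x -> differentiable phi x.
  by move=> Ux; apply: differentiable_row => j; exact: Cinf_differentiable (cp j) Ux.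
move=> cf k; elim: k f cf => [|k IH] f cf.
  move=> x Ux; apply: differentiable_continuous; apply: differentiable_comp.
    exact: dphi.
  by apply: Cinf_differentiable cf _; exact: UV.
split=> [x Ux|i].
  apply: differentiable_comp; first exact: dphi.
  by apply: Cinf_differentiable cf _; exact: UV.
have ck : Cdiff k U (fun x => \sum_(j < m) 'D_(delta_mx 0 j) f (phi x) *
    'D_(delta_mx 0 i) (fun y => phi y 0 j) x).
  apply: Cdiff_sum => // j _; apply: CdiffM => //.
    exact: IH _ (Cinf_derive j cf).
  exact: Cinf_derive (cp j) k.
apply: (Cdiff_ext oU _ ck) => x Ux.
rewrite derive_comp_row//; first exact: dphi.
by apply: Cinf_differentiable cf _; exact: UV.
Qed.

End EuclideanCalculus.

(** * Bump functions *)

Section Bump.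
Variable R : realType.

(** For [k = 0] this is the classical flat function e^(-1/t). The powers of 1/t are added so that
    the family is closed under differentiation up to linear combinations. *)
Definition flat_exp (k : nat) (t : R) : R :=
  if 0 < t then t^-1 ^+ k * expR (- t^-1) else 0.

(** From e^x >= 1 + x^(k+2) / (k+2)! at x = 1/t. A quadratic bound is what makes the derivative at 0
    vanish. *)
Lemma flat_exp_le (k : nat) (t : R) : `|flat_exp k t| <= k.+2`!%:R * t ^+ 2.
Proof.
rewrite /flat_exp; case: ifPn => t0; last first.
  by rewrite normr0 mulr_ge0 ?sqr_ge0.
rewrite ger0_norm; last by rewrite mulr_ge0 ?expR_ge0// exprn_ge0// invr_ge0 ltW.
have := expR_ge1Dxn k.+1 (ltW (etrans (invr_gt0 t) t0)).
set F : R := (k.+2)`!%:R; have F0 : 0 < F by rewrite ltr0n fact_gt0.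
have tk : 0 < t ^+ k by exact: exprn_gt0.
rewrite expRN => le; rewrite ler_pdivrMr ?expR_gt0//.
have -> : t^-1 ^+ k = F * t ^+ 2 * (t^-1 ^+ k.+2 / F).
  by rewrite !exprS; field; rewrite !gt_eqF.
rewrite ler_pM2l; last by rewrite mulr_gt0// exprn_gt0.
by apply: le_trans le; rewrite lerDr.
Qed.

Lemma is_derive_flat_exp (k : nat) (t : R) :
  is_derive t 1 (flat_exp k)
    (- k%:R * flat_exp k.+1 t + flat_exp k.+2 t).
Proof.
case: (ltgtP t 0) => t0.
- have -> : - k%:R * flat_exp k.+1 t + flat_exp k.+2 t = 0.
    by rewrite /flat_exp ltNge (ltW t0) /= mulr0 addr0.
  apply: (@near_eq_is_derive _ _ _ (cst 0)).
  near=> s; have s0 : s < 0 by near: s; exact: lt_nbhsl.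
  by rewrite /flat_exp ltNge (ltW s0).
- apply: (@near_eq_is_derive _ _ _ ((@GRing.inv R) ^+ k * (expR \o (- (@GRing.inv R))))).
    near=> s; have s0 : 0 < s by near: s; exact: lt_nbhsr.
    by rewrite /flat_exp s0 /GRing.mul /= exprfctE.
  have dV : is_derive t 1 (@GRing.inv R) (- t ^- 2 *: 1).
    by apply: (@is_deriveV _ id) => //; rewrite gt_eqF.
  have dX := is_deriveX k dV.
  have dN := is_deriveN dV.
  have dE := @is_derive1_comp R expR (- (@GRing.inv R)) t _ _ (is_derive_expR (- t^-1)) dN.
  have dM := is_deriveM dX dE.
  apply: (is_derive_eq dM).
  rewrite /flat_exp t0 !fctE /=. 
  case: k {dX dM} => [|k]; rewrite /GRing.scale /=.
    rewrite !exprS !expr0; field; rewrite gt_eqF//.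
  rewrite !exprS !expr0; field; rewrite gt_eqF//.
- rewrite t0.
  have f0 j : flat_exp j 0 = 0 by rewrite /flat_exp ltxx.
  (* By [flat_exp_le] the difference quotient at 0 is at most (k+2)! |h|. *)
  have c : h^-1 *: ((flat_exp k \o shift 0) (h *: 1) - flat_exp k 0) @[h --> 0^'] --> (0 : R).
    apply: (@cvg_trans _ (flat_exp k h / h @[h --> 0^'])).
      apply: near_eq_cvg; near=> h; rewrite /= f0 subr0 addr0.
      by rewrite /GRing.scale /= mulr1 mulrC.
    apply/cvgr0Pnorm_le => e e0; near=> h.
    have h0 : h != 0 by near: h; exact: nbhs_dnbhs_neq.
    rewrite normrM normfV ler_pdivrMr ?normr_gt0//.
    apply: le_trans (flat_exp_le _ _) _.
    rewrite -real_normK ?num_real// expr2 mulrA ler_pM2r ?normr_gt0//.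
    rewrite mulrC -ler_pdivlMr ?ltr0n ?fact_gt0//.
    by near: h; apply: dnbhs0_le; rewrite divr_gt0// ltr0n fact_gt0.
  rewrite !f0 mulr0 addr0.
  apply: DeriveDef; first by apply/cvg_ex; exists 0.
  exact/cvg_lim.
Unshelve. all: by end_near. Qed.

Lemma Cinf_flat_exp (U : set 'rV[R]_1) (k : nat) :
  open U -> Cinf U (fun y => flat_exp k (y 0 0)).
Proof.
move=> oU.
have dfe j (y : 'rV[R]_1) : differentiable (fun z : 'rV[R]_1 => flat_exp j (z 0 0)) y.
  apply: (differentiable_comp (differentiable_coord y 0 0)).
  by apply/derivable1_diffP; case: (is_derive_flat_exp j (y 0 0)).
have Dfe j (i : 'I_1) (y : 'rV[R]_1) :
    'D_(delta_mx 0 i) (fun z : 'rV[R]_1 => flat_exp j (z 0 0)) y =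
    - j%:R * flat_exp j.+1 (y 0 0) + flat_exp j.+2 (y 0 0).
  have df : differentiable (flat_exp j) (y 0 0).
    by apply/derivable1_diffP; case: (is_derive_flat_exp j (y 0 0)).
  rewrite deriveE// (diff_comp (differentiable_coord y 0 0) df) /=.
  rewrite -(deriveE _ (differentiable_coord y 0 0)).
  have -> : 'D_('e_i) (fun N : 'M[R]_(1, 1) => N 0 0) y = 1.
    have dx : differentiable (id : 'rV[R]_1 -> 'rV[R]_1) y by [].
    have := derive_mx (@diff_derivable _ _ _ _ _ (delta_mx 0 i : 'rV[R]_1) dx).
    by rewrite derive_id => /matrixP/(_ 0 0); rewrite [RHS]mxE => <-; rewrite mxE (ord1 i).
  by rewrite -deriveE//; case: (is_derive_flat_exp j (y 0 0)).
move=> m; elim: m k => [|m IH] k /=.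
  by move=> y _; exact: differentiable_continuous.
split=> // i.
have c : Cdiff m U (fun y => - k%:R * flat_exp k.+1 (y 0 0) + flat_exp k.+2 (y 0 0)).
  apply: CdiffD => //; apply: CdiffM => //; exact: Cinf_cst.
by apply: (Cdiff_ext oU _ c) => y _; rewrite Dfe.
Qed.

(** The sum of squares is used because it is polynomial, while the norm of row vectors is the max
    norm. Accordingly [d] is the square of a radius. *)
Definition ball_bump (n : nat) (c : 'rV[R]_n) (d : R) (y : 'rV[R]_n) : R :=
  flat_exp 0 (d - \sum_(j < n) (y 0 j - c 0 j) ^+ 2).

Lemma Cinf_ball_bump (n : nat) (c : 'rV[R]_n) (d : R) (U : set 'rV[R]_n) :
  open U -> Cinf U (ball_bump c d).
Proof.
move=> oU; pose phi (y : 'rV[R]_n) : 'rV[R]_1 :=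
  \row__ (d - \sum_(j < n) (y 0 j - c 0 j) ^+ 2).
have -> : ball_bump c d = (fun y => flat_exp 0 (y 0 0)) \o phi.
  by apply/funext => y; rewrite /= mxE.
apply: (@Cinf_comp R n 1 U setT (fun y => flat_exp 0 (y 0 0)) phi) => //.
  by apply: Cinf_flat_exp; exact: openT.
move=> j; have -> : (fun y => phi y 0 j) =
    (fun y => d + \sum_(j < n) -1 * ((y 0 j - c 0 j) * (y 0 j - c 0 j))).
  apply/funext => y; rewrite mxE; congr (_ + _).
  by rewrite -sumrN; apply: eq_bigr => i _; rewrite mulN1r expr2.
apply: CinfD => //; first exact: Cinf_cst.
apply: Cinf_sum => // i _; apply: CinfM => //; first exact: Cinf_cst.
by apply: CinfM => //; apply: CinfD => //; by [apply: Cinf_coord|apply: Cinf_cst].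
Qed.

Lemma ball_bump_center (n : nat) (c : 'rV[R]_n) (d : R) : 0 < d -> 0 < ball_bump c d c.
Proof.
move=> d0; rewrite /ball_bump big1 ?subr0 => [|i _]; last by rewrite subrr expr0n.
by rewrite /flat_exp d0 expr0 mul1r expR_gt0.
Qed.

Lemma ball_bump_eq0 (n : nat) (c : 'rV[R]_n) (d : R) y :
  0 < d -> d <= `|y - c| -> ball_bump c (d ^+ 2) y = 0.
Proof.
move=> d0 dy; rewrite /ball_bump /flat_exp subr_gt0 ifF//; apply/negbTE; rewrite -leNgt.
have n0 : mx_norm (y - c) != 0.
  by rewrite gt_eqF// (lt_le_trans d0).
(* A coordinate at which the max norm is attained; its square alone already exceeds [d ^+ 2]. *)
have [ [j i] /= ei] := mx_norm_neq0 n0; rewrite (ord1 j) !mxE in ei.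
have : d <= `|y 0 i - c 0 i| by rewrite -ei.
rewrite -ler_sqr ?nnegrE ?(ltW d0)// real_normK ?num_real// => /le_trans; apply.
by rewrite (bigD1 i)//= lerDl sumr_ge0// => k _; exact: sqr_ge0.
Qed.

End Bump.

(** * Smooth functions on a manifold *)

Section ManifoldCalculus.
Variables (R : realType) (n : nat) (M : manifold R n).
Implicit Types (U V : set M) (f g : M -> R) (i j : cidx M).

Lemma smooth_on_sub U V f : V `<=` U -> smooth_on U f -> smooth_on V f.
Proof.
move=> VU sf i; apply: Cinf_sub (sf i) => _ [x [ix Vx] <-].
by exists x => //; split=> //; exact: VU.
Qed.

Lemma smooth_on_cst U (a : R) : open U -> smooth_on U (fun=> a).
Proof. by move=> oU i; apply: Cinf_cst; exact: chart_image_open. Qed.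

Lemma smooth_onD U f g : open U -> smooth_on U f -> smooth_on U g ->
  smooth_on U (fun x => f x + g x).
Proof. by move=> oU sf sg i; apply: CinfD => //; exact: chart_image_open. Qed.

Lemma smooth_onM U f g : open U -> smooth_on U f -> smooth_on U g ->
  smooth_on U (fun x => f x * g x).
Proof. by move=> oU sf sg i; apply: CinfM => //; exact: chart_image_open. Qed.

Lemma smooth_on_sum U (I : Type) (s : seq I) (P : pred I) (F : I -> M -> R) :
  open U -> (forall k, P k -> smooth_on U (F k)) ->
  smooth_on U (fun x => \sum_(k <- s | P k) F k x).
Proof.
by move=> oU sF i; apply: Cinf_sum => [|k Pk]; [exact: chart_image_open|exact: sF].
Qed.

Lemma smooth_onN U f : open U -> smooth_on U f -> smooth_on U (fun x => - f x).
Proof.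
move=> oU sf; apply: (@smooth_on_ext _ _ _ _ (fun x => -1 * f x)) => //.
  by move=> x _; rewrite mulN1r.
by apply: smooth_onM => //; exact: smooth_on_cst.
Qed.

Lemma smooth_on_local U f :
  (forall x, U x -> exists V, V x /\ smooth_on V f) -> smooth_on U f.
Proof.
move=> lf i; apply: Cinf_local => _ [x [ix Ux] <-].
have [V [Vx sf]] := lf x Ux; exists (chart i @` (cdom i `&` V)).
by split; [exists x|exact: sf].
Qed.

(** In any other chart the local expression is the given one composed with a smooth transition
    map. *)
Lemma smooth_on_chart j U f : open U -> U `<=` cdom j ->
  Cinf (chart j @` U) (fun y => f (unchart j y)) -> smooth_on U f.
Proof.
move=> oU Uj sf i.
have oi : open (chart i @` (cdom i `&` U)) by exact: chart_image_open.
have cc : Cinf (chart i @` (cdom i `&` U))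
    ((fun y => f (unchart j y)) \o (fun y => chart j (unchart i y))).
  apply: Cinf_comp sf _ _ => // [k|_ [x [ix Ux] <-]]; last first.
    by rewrite chartK//; exists x.
  apply: Cinf_sub (@chart_smooth R n M i j k) => _ [x [ix Ux] <-].
  by exists x => //; split=> //; exact: Uj.
apply: (Cinf_ext oi _ cc) => _ [x [ix Ux] <-] /=.
by rewrite chartK// chartK//; exact: Uj.
Qed.

Lemma smooth_on_coord j k : smooth_on (cdom j) (fun x => chart j x 0 k).
Proof. by move=> i; exact: chart_smooth. Qed.

Definition diff_at i f x := differentiable (fun y => f (unchart i y)) (chart i x).

Lemma smooth_on_diff_at U i f x :
  open U -> U x -> cdom i x -> smooth_on U f -> diff_at i f x.
Proof.
move=> oU Ux ix sf; apply: Cinf_differentiable (sf i) _.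
by exists x.
Qed.

Lemma smooth_on_pd U j k f :
  open U -> U `<=` cdom j -> smooth_on U f -> smooth_on U (pd j k f).
Proof.
move=> oU Uj sf; apply: smooth_on_chart (Uj) _ => //.
have oj : open (chart j @` U).
  by rewrite -(setIidr Uj); exact: chart_image_open.
have sj := sf j; rewrite (setIidr Uj) in sj.
apply: (Cinf_ext oj _ (Cinf_derive k sj)) => _ [x Ux <-].
by rewrite /pd chartK//; exact: Uj.
Qed.

Lemma near_unchart i x U (P : M -> Prop) : open U -> U x -> cdom i x ->
  (forall y, cdom i y -> U y -> P y) -> \forall z \near chart i x, P (unchart i z).
Proof.
move=> oU Ux ix UP.
have : nbhs (chart i x) (chart i @` (cdom i `&` U)).
  by apply: open_nbhs_nbhs; split; [exact: chart_image_open|exists x].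
by apply: filterS => _ [y [iy Uy] <-]; rewrite chartK//; exact: UP.
Qed.

Lemma eq_pd i k U f g x : open U -> U x -> cdom i x ->
  (forall y, U y -> f y = g y) -> pd i k f x = pd i k g x.
Proof.
move=> oU Ux ix fg; apply: near_eq_derive.
by apply: (@near_unchart i x U (fun y => f y = g y)) => // y _; exact: fg.
Qed.

Lemma pd_cst i k (a : R) x : pd i k (fun=> a) x = 0.
Proof. exact: derive_cst. Qed.

Lemma pdD i k f g x : diff_at i f x -> diff_at i g x ->
  pd i k (fun y => f y + g y) x = pd i k f x + pd i k g x.
Proof. by move=> df dg; rewrite /pd deriveD//; exact: diff_derivable. Qed.

Lemma diff_atM i f g x : diff_at i f x -> diff_at i g x ->
  diff_at i (fun y => f y * g y) x.
Proof. exact: differentiableM. Qed.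

Lemma pdM i k f g x : cdom i x -> diff_at i f x -> diff_at i g x ->
  pd i k (fun y => f y * g y) x = pd i k f x * g x + f x * pd i k g x.
Proof.
move=> ix df dg; rewrite /pd deriveM; try exact: diff_derivable.
by rewrite !chartK// addrC; congr (_ + _); exact: mulrC.
Qed.

Lemma pdN i k f x : diff_at i f x -> pd i k (fun y => - f y) x = - pd i k f x.
Proof. by move=> df; rewrite /pd deriveN//; exact: diff_derivable. Qed.

Lemma diff_at_sum i (I : finType) (F : I -> M -> R) x :
  (forall l, diff_at i (F l) x) -> diff_at i (fun y => \sum_l F l y) x.
Proof.
move=> dF; rewrite /diff_at.
have -> : (fun y => \sum_l F l (unchart i y)) = \sum_l (fun y => F l (unchart i y)).
  by rewrite fct_sumE.
elim/big_rec: _ => [|l f _ df]; first exact: differentiable_cst.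
exact: (differentiableD (dF l) df).
Qed.

Lemma pd_sum i k (I : finType) (F : I -> M -> R) x :
  (forall l, diff_at i (F l) x) ->
  pd i k (fun y => \sum_l F l y) x = \sum_l pd i k (F l) x.
Proof.
move=> dF; rewrite /pd.
have -> : (fun y => \sum_l F l (unchart i y)) = \sum_l (fun y => F l (unchart i y)).
  by rewrite fct_sumE.
have : differentiable (\sum_l (fun y => F l (unchart i y))) (chart i x) /\
   'D_'e_k (\sum_l (fun y => F l (unchart i y))) (chart i x) =
   \sum_l 'D_'e_k (fun y => F l (unchart i y)) (chart i x).
  elim/big_rec2: _ => [|l f s _ [df <-]].
    by split; [exact: differentiable_cst|exact: derive_cst].
  split; first exact: (differentiableD (dF l) df).
  by rewrite deriveD//; apply: diff_derivable => //; exact: dF.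
by case.
Qed.

Lemma pd_change i j k f x : cdom i x -> cdom j x -> diff_at j f x ->
  pd i k f x = \sum_(l < n) pd i k (fun y => chart j y 0 l) x * pd j l f x.
Proof.
move=> ix jx df.
pose phi y := chart j (unchart i y).
have dphi : differentiable phi (chart i x).
  apply: differentiable_row => l.
  apply: (@smooth_on_diff_at (cdom j) i (fun y => chart j y 0 l)) => //.
    exact: cdom_open.
  exact: smooth_on_coord.
have phx : phi (chart i x) = chart j x by rewrite /phi chartK.
transitivity ('D_(delta_mx 0 k) ((fun y => f (unchart j y)) \o phi) (chart i x)).
  apply: near_eq_derive.
  apply: (@near_unchart i x (cdom j) (fun y => f y = f (unchart j (chart j y)))) => //.
    exact: cdom_open.
  by move=> y iy jy; rewrite chartK.
rewrite derive_comp_row// phx//.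
by apply: eq_bigr => l _; rewrite mulrC.
Qed.

(** The bump lives on a closed ball inside a chart. Its image K in M is compact, hence closed since
    M is Hausdorff, so the chart domain and the complement of K form an open cover on which the
    extension by zero is visibly smooth. K is returned so that local sections can be cut off in the
    same way. *)
Lemma smooth_bump (O : set M) (x : M) : open O -> O x ->
  exists b : M -> R, [/\ smooth_fun b, b x = 1 &
    exists K, [/\ closed K, K `<=` O & forall y, ~ K y -> b y = 0]].
Proof.
move=> oO Ox; have [i ix] := cdom_cover x.
have : nbhs (chart i x) (chart i @` (cdom i `&` O)).
  by apply: open_nbhs_nbhs; split; [exact: chart_image_open|exists x].
move=> /nbhs_closedballP[d dO]; pose B := closed_ball (chart i x) d%:num.
have cB : compact B.
  apply: bounded_closed_compact; last exact: closed_ball_closed.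
  rewrite /B closed_ballE//; exists (`|chart i x| + d%:num); split => //.
  move=> e le y /= By; rewrite -(subrK (chart i x) y).
  apply: le_trans (ler_normD _ _) _; rewrite addrC.
  by apply: le_trans (ltW le); rewrite lerD2l distrC.
pose K := unchart i @` B.
have cK : compact K.
  apply: continuous_compact => //; apply: continuous_in_subspaceT => y.
  rewrite inE => By; apply: unchart_cont.
  by have [z [iz _] <-] := dO _ By; exists z.
have KO : K `<=` cdom i `&` O.
  by move=> _ [y By <-]; have [z [iz Oz] <-] := dO _ By; rewrite chartK.
pose a := ball_bump (chart i x) (d%:num ^+ 2) (chart i x).
have a0 : 0 < a by exact: ball_bump_center.
pose b z := if `[< cdom i z >]
  then ball_bump (chart i x) (d%:num ^+ 2) (chart i z) * a^-1 else 0.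
have bK y : ~ K y -> b y = 0.
  move=> nKy; rewrite /b; case: asboolP => // iy.
  rewrite ball_bump_eq0 ?mul0r// leNgt; apply/negP => lt; apply: nKy.
  exists (chart i y); last exact: chartK.
  by rewrite /B closed_ballE// /closed_ball_ /= distrC ltW.
exists b; split.
- apply: smooth_on_local => z _; case: (pselect (K z)) => [Kz|nKz].
    exists (cdom i); split; first by have [] := KO _ Kz.
    apply: (@smooth_on_chart i); [exact: cdom_open|by []|].
    have ci : open (chart i @` cdom i) by exact: chart_open.
    have cb : Cinf (chart i @` cdom i)
        (fun y => ball_bump (chart i x) (d%:num ^+ 2) y * a^-1).
      by apply: CinfM => //; [exact: Cinf_ball_bump|exact: Cinf_cst].
    apply: (Cinf_ext ci _ cb) => _ [y iy <-]; rewrite /b chartK//.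
    by case: asboolP.
  have oK : open (~` K).
    by apply: closed_openC; apply: compact_closed => //; exact: mpoint_hausdorff.
  exists (~` K); split=> //.
  apply: (@smooth_on_ext _ _ _ _ (fun=> 0)) => //; last exact: smooth_on_cst.
  by move=> y /bK.
- by rewrite /b; case: asboolP => // _; rewrite divff// gt_eqF.
- exists K; split=> //; first by apply: compact_closed => //; exact: mpoint_hausdorff.
  by move=> y /KO[].
Qed.

End ManifoldCalculus.

Lemma smooth_section_through (R : realType) (n r : nat) (M : manifold R n)
    (V : vbundle M r) (x : M) (v : V x) :
  exists s : section V, smooth_section s /\ s x = v.
Proof.
have [c cx] := tdom_cover V x.
have [b [sb bx [K [cK Kc bK]]]] := smooth_bump (tdom_open c) cx.
(* Outside [tdom c] the frame takes arbitrary values, but there [b] vanishes. *)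
pose s : section V := fun y =>
  b y *: \sum_(a < r) coord (frame c x) a v *: tnth (frame c y) a.
exists s; split; last first.
  rewrite /s bx scale1r [RHS](coord_basis (frame_basis cx) (memvf v)).
  by apply: eq_bigr => a _; rewrite (tnth_nth 0).
move=> c' a; apply: smooth_on_local => y c'y.
case: (pselect (tdom c y)) => [cy|ncy].
  exists (tdom c' `&` tdom c); split => //.
  have oU : open (tdom c' `&` tdom c) by apply: openI; exact: tdom_open.
  apply: (@smooth_on_ext _ _ _ _ (fun z => b z *
    \sum_(a' < r) coord (frame c x) a' v * coord (frame c' z) a (tnth (frame c z) a'))) => //.
    move=> z [c'z cz]; rewrite /s linearZ linear_sum /=; congr (_ * _).
    by apply: eq_bigr => a' _; rewrite linearZ.
  apply: smooth_onM => //; first exact: smooth_on_sub sb.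
  apply: smooth_on_sum => // a' _; apply: smooth_onM => //.
    exact: smooth_on_cst.
  exact: frame_smooth.
have oK : open (~` K) by exact: closed_openC.
exists (~` K); split; first by move=> /Kc.
apply: (@smooth_on_ext _ _ _ _ (fun=> 0)) => //; last exact: smooth_on_cst.
by move=> z /bK bz; rewrite /s bz scale0r linear0.
Qed.

(** * The Dorfman bracket in local coordinates *)

Section GradedPolynomials.
Variables (R : realType) (n r : nat).
Local Notation idx := ('I_r + 'I_r)%type.
Implicit Types (u v : gpoly R n r) (w : seq (gen n r)).

(** On the odd letters, [inl a] for xi_a and [inr a] for theta^a, this is passage to the conjugate
    letter. *)
Definition star (I : idx) : idx :=
  match I with inl a => inr a | inr a => inl a end.

Lemma starK : involutive star. Proof. by case. Qed.

Lemma sum_star (F : idx -> R) : \sum_I F (star I) = \sum_I F I.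
Proof.
rewrite [RHS](reindex_onto star star) => [|I _]; last exact: starK.
by apply: eq_bigl => I; rewrite starK eqxx.
Qed.

Lemma gmul0l u v w : (forall s, u s = 0) -> gmul u v w = 0.
Proof.
elim: w u v => [|g w IH] u v u0 /=; first by rewrite u0 mul0r.
rewrite IH => [|s]; last exact: u0.
by rewrite IH ?addr0// => s; rewrite /ginvol u0 mulr0.
Qed.

Lemma gmul0r u v w : (forall s, v s = 0) -> gmul u v w = 0.
Proof.
elim: w u v => [|g w IH] u v v0 /=; first by rewrite v0 mulr0.
by rewrite IH ?IH ?addr0// => s; exact: v0.
Qed.

Lemma gmul_cst u v w : (forall g s, u (g :: s) = 0) ->
  gmul u v w = u [::] * v w.
Proof.
elim: w u v => [//|g w IH] u v u0 /=.
rewrite gmul0l => [|s]; last exact: u0.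
rewrite IH => [|h s]; last by rewrite /ginvol u0 mulr0.
by rewrite /ginvol /= andbF expr0 mul1r add0r.
Qed.

Lemma gmul1 u v g : gmul u v [:: g] = u [:: g] * v [::] + u [::] * v [:: g].
Proof. by rewrite /= /ginvol /dleft /= andbF expr0 mul1r. Qed.

Lemma gmul2 u v g h : gmul u v [:: g; h] =
  u [:: g; h] * v [::] + u [:: g] * v [:: h]
  + ((-1) ^+ (odd_gen g && odd_gen h) * u [:: h] * v [:: g] + u [::] * v [:: g; h]).
Proof.
rewrite /= /ginvol /dleft /= !andbF !expr0 !mul1r /odd_word /= addn0.
by rewrite oddb.
Qed.

End GradedPolynomials.

Section Coordinates.
Variables (R : realType) (n r : nat) (M : manifold R n) (A : vbundle M r).
Local Notation idx := ('I_r + 'I_r)%type.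
Implicit Types (c : tidx A) (t : trivz A) (x : M) (e : Esection A).

(** Indexed so that [crd] at [I] is the coefficient of the letter [inr I] in [gsec]: the component
    in the dual bundle sits at [inl], the one in A at [inr]. *)
Definition crd c x (v : Efib A x) (I : idx) : R :=
  match I with
  | inl a => (v.2 : dual_fib A x) (tnth (frame c x) a)
  | inr a => coord (frame c x) a v.1
  end.

Definition dcrd t e x (k : 'I_n) (I : idx) : R :=
  pd t.1 k (fun y => crd t.2 (e y) I) x.

Lemma crdD c x (u v : Efib A x) I : crd c (u + v) I = crd c u I + crd c v I.
Proof. by case: I => a /=; rewrite ?lfunE ?linearD. Qed.

Lemma crdN c x (u : Efib A x) I : crd c (- u) I = - crd c u I.
Proof. by case: I => a /=; rewrite ?opp_lfunE ?linearN. Qed.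

Lemma crd_inj c x (u v : Efib A x) : tdom c x ->
  (forall I, crd c u I = crd c v I) -> u = v.
Proof.
move=> cx uv; case: u v uv => [u1 u2] [v1 v2] uv; congr (_, _).
  rewrite (coord_basis (frame_basis cx) (memvf u1)).
  rewrite (coord_basis (frame_basis cx) (memvf v1)).
  by apply: eq_bigr => a _; have /= -> := uv (inr a).
rewrite (dual_frame_sum u2 cx) (dual_frame_sum v2 cx).
by apply: eq_bigr => a _; have /= -> := uv (inl a).
Qed.

Definition pairing (u v : idx -> R) : R := \sum_I u I * v (star I).

Lemma pairingC u v : pairing u v = pairing v u.
Proof.
by rewrite /pairing -sum_star; apply: eq_bigr => I _; rewrite starK mulrC.
Qed.

Lemma Epair_crd c x (u v : Efib A x) : tdom c x ->
  Epair u v = pairing (crd c u) (crd c v).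
Proof.
move=> cx; rewrite /Epair /pairing big_sumType /=; congr (_ + _).
  rewrite {1}(coord_basis (frame_basis cx) (memvf v.1)) linear_sum.
  by apply: eq_bigr => a _; rewrite linearZ (tnth_nth 0) mulrC.
rewrite {1}(coord_basis (frame_basis cx) (memvf u.1)) linear_sum.
by apply: eq_bigr => a _; rewrite linearZ (tnth_nth 0).
Qed.

Section Bracket.
Variables (Th : gfamily A).

(** The anchor of [u], as a vector field in the chart of [t]. Bracketing with a section contracts a
    letter with the component at the conjugate index, hence [star]. *)
Definition rho t x (u : idx -> R) (k : 'I_n) : R :=
  \sum_J Th t x [:: inr J; inl k] * u (star J).

Definition tri t x (u v w : idx -> R) : R :=
  \sum_J \sum_K \sum_L
    Th t x [:: inr J; inr K; inr L] * u (star J) * v (star K) * w (star L).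

(* the Dorfman bracket of [e] and [e'] paired with [v], in the coordinates [t] *)
Definition dorf t x e e' (v : Efib A x) : R :=
  \sum_k (rho t x (crd t.2 (e x)) k * pairing (dcrd t e' x k) (crd t.2 v)
        - rho t x (crd t.2 (e' x)) k * pairing (dcrd t e x k) (crd t.2 v)
        + rho t x (crd t.2 v) k * pairing (dcrd t e x k) (crd t.2 (e' x)))
  - tri t x (crd t.2 (e x)) (crd t.2 (e' x)) (crd t.2 v).

Lemma gsec_letter e t x I : gsec e t x [:: inr I] = crd t.2 (e x) I.
Proof. by case: I. Qed.

Lemma gsec_eq0 e t x w : size w != 1%N -> gsec e t x w = 0.
Proof. by case: w => [|[k|[a|a]] [|h w]]. Qed.

Lemma pd_gsec_nil e t x k : pd t.1 k (fun y => gsec e t y [::]) x = 0.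
Proof. exact: pd_cst. Qed.

(** [gsec e] is linear in the odd letters and free of momenta: its right derivatives along odd
    letters are scalars, those along momenta vanish. *)
Lemma big_bracket_gsec e t x w : big_bracket (gsec e) Th t x w =
  - \sum_k gmul (fun s => pd t.1 k (fun y => gsec e t y s) x)
               (fun s => Th t x (inl k :: s)) w
  + \sum_J crd t.2 (e x) (star J) * Th t x (inr J :: w).
Proof.
rewrite /big_bracket; congr (_ + _).
  rewrite -sumrN; apply: eq_bigr => k _; rewrite gmul0l ?sub0r// => s.
  rewrite /dright; case: s => [|g [|h s]] //.
    by case: g => [?|[]].
  by rewrite gsec_eq0//= size_rcons.
rewrite big_sumType /= -big_split; apply: eq_bigr => a _ /=.
congr (_ + _); rewrite gmul_cst //= => g s; rewrite /dright gsec_eq0//=;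
  by rewrite size_rcons.
Qed.

Lemma big_bracket_gsec_p e t x k :
  big_bracket (gsec e) Th t x [:: inl k] = rho t x (crd t.2 (e x)) k.
Proof.
rewrite big_bracket_gsec big1 ?oppr0 ?add0r => [|l _]; last first.
  by rewrite gmul1 /= !pd_cst !mul0r addr0.
by apply: eq_bigr => J _; rewrite mulrC.
Qed.

Lemma big_bracket_gsec2 e t x H K :
  big_bracket (gsec e) Th t x [:: inr H; inr K] =
  - \sum_k (dcrd t e x k H * Th t x [:: inl k; inr K]
            - dcrd t e x k K * Th t x [:: inl k; inr H])
  + \sum_J crd t.2 (e x) (star J) * Th t x [:: inr J; inr H; inr K].
Proof.
rewrite big_bracket_gsec; congr (- _ + _); apply: eq_bigr => k _.
rewrite gmul2; cbv beta; rewrite pd_gsec_nil mul0r addr0.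
have -> : (fun y => gsec e t y [:: inr H; inr K]) = (fun=> 0).
  by apply/funext => y; rewrite gsec_eq0.
have od (I : idx) : odd_gen (inr I : gen n r) by case: I.
rewrite pd_cst mul0r add0r !od /= expr1 mulN1r mulNr.
by rewrite /dcrd; congr (_ * _ - _ * _); congr (pd _ _ _ _); apply/funext => y;
  rewrite gsec_letter.
Qed.

Lemma anchor_courant e f x : anchor (courant Th) e f x =
  \sum_k rho (triv_at A x) x (crd (triv_at A x).2 (e x)) k * pd (triv_at A x).1 k f x.
Proof.
rewrite /= /to_fun; set t := triv_at A x; rewrite /big_bracket.
rewrite [X in _ + X]big1 ?addr0 => [|a _]; last first.
  by rewrite [X in X + _]mulr0 [X in _ + X]mulr0 addr0.
apply: eq_bigr => k _; rewrite -big_bracket_gsec_p.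
by rewrite [X in _ - X]mulr0 subr0.
Qed.

Lemma bracket_courant_letter e e' t x H :
  big_bracket (big_bracket (gsec e) Th) (gsec e') t x [:: inr H] =
  \sum_k rho t x (crd t.2 (e x)) k * dcrd t e' x k H
  + \sum_K crd t.2 (e' x) (star K) * big_bracket (gsec e) Th t x [:: inr H; inr K].
Proof.
set B := big_bracket (gsec e) Th; rewrite {1}/big_bracket; congr (_ + _).
  apply: eq_bigr => k _; rewrite [X in _ - X]gmul0r ?subr0; last first.
    by move=> s; rewrite /dleft; case: s.
  rewrite gmul1; cbv beta; rewrite pd_gsec_nil mulr0 add0r -big_bracket_gsec_p.
  by rewrite /dcrd; congr (_ * pd _ _ _ _); apply/funext => y; rewrite gsec_letter.
rewrite [RHS]big_sumType -[RHS]big_split; apply: eq_bigr => a _.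
rewrite [RHS]addrC !gmul1 /dleft !(@gsec_eq0 e' t x [:: _; _])// !mulr0 !addr0.
by congr (_ + _); rewrite [LHS]mulrC.
Qed.

(** The symmetry clause of [gfunction] in isolation: it passes to a sum of structures of different
    bidegrees, which has no bidegree of its own. *)
Definition gskew : Prop := forall t x s g h s', tzdom t x ->
  Th t x (s ++ g :: h :: s') =
  (-1) ^+ (odd_gen g && odd_gen h) * Th t x (s ++ h :: g :: s').

Lemma odd_gen_inr (I : idx) : odd_gen (inr I : gen n r). Proof. by case: I. Qed.

Hypothesis skewTh : gskew.

Lemma gskew_p t x k I : tzdom t x ->
  Th t x [:: inl k; inr I] = Th t x [:: inr I; inl k].
Proof.
by move=> tx; have := skewTh [::] (inl k) (inr I) [::] tx; rewrite mul1r.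
Qed.

Lemma gskew12 t x I J K : tzdom t x ->
  Th t x [:: inr I; inr J; inr K] = - Th t x [:: inr J; inr I; inr K].
Proof.
move=> tx; have := skewTh [::] (inr I) (inr J) [:: inr K] tx.
by rewrite !odd_gen_inr expr1 mulN1r.
Qed.

Lemma gskew23 t x I J K : tzdom t x ->
  Th t x [:: inr I; inr J; inr K] = - Th t x [:: inr I; inr K; inr J].
Proof.
move=> tx; have := skewTh [:: inr I] (inr J) (inr K) [::] tx.
by rewrite !odd_gen_inr expr1 mulN1r.
Qed.

Lemma triv_at_dom x : tzdom (triv_at A x) x.
Proof. by split; rewrite /triv_at /=; case: cid. Qed.

Lemma crd_to_sec (u : gfamily A) x I :
  crd (triv_at A x).2 (to_sec u x) I = u (triv_at A x) x [:: inr I].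
Proof.
have [_ tx] := triv_at_dom x; set t := triv_at A x in tx *.
have fr := basis_free (frame_basis tx).
case: I => a; rewrite /crd /to_sec -/t.
  rewrite sum_lfunE (bigD1 a)//= big1 ?addr0 => [|b ba].
    rewrite scale_lfunE dual_frameE (tnth_nth 0) coord_free// eqxx.
    exact: mulr1.
  rewrite scale_lfunE dual_frameE (tnth_nth 0) coord_free//.
  by rewrite eq_sym (negbTE ba) scaler0.
under eq_bigr => b _ do rewrite (tnth_nth 0).
by rewrite coord_sum_free.
Qed.

(** Pairing with a vector turns the derived bracket into a scalar; the pairing is nondegenerate, so
    no information is lost. *)
Lemma Epair_bracket e e' x (v : Efib A x) :
  Epair (bracket (courant Th) e e' x) v = dorf (triv_at A x) e e' v.
Proof.
have tx := triv_at_dom x; rewrite (Epair_crd _ _ tx.2) /= /pairing.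
under eq_bigr => H _ do rewrite crd_to_sec bracket_courant_letter mulrDl.
set t := triv_at A x in tx *; rewrite big_split /= /dorf.
set u := crd t.2 (e x); set u' := crd t.2 (e' x); set w := crd t.2 v.
have P1 : \sum_H (\sum_k rho t x u k * dcrd t e' x k H) * w (star H) =
    \sum_k rho t x u k * pairing (dcrd t e' x k) w.
  under eq_bigr => H _ do rewrite mulr_suml.
  rewrite exchange_big; apply: eq_bigr => k _; rewrite mulr_sumr.
  by apply: eq_bigr => H _; rewrite mulrA.
have P2 : \sum_H (\sum_K u' (star K) *
      big_bracket (gsec e) Th t x [:: inr H; inr K]) * w (star H) =
    \sum_H \sum_K (- \sum_k (dcrd t e x k H * w (star H) *
                              (Th t x [:: inr K; inl k] * u' (star K)))
      + \sum_k (Th t x [:: inr H; inl k] * w (star H) *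
                              (dcrd t e x k K * u' (star K)))
      - \sum_J Th t x [:: inr J; inr K; inr H] * u (star J) * u' (star K) * w (star H)).
  apply: eq_bigr => H _; rewrite mulr_suml; apply: eq_bigr => K _.
  rewrite big_bracket_gsec2 -/u -!sumrN -!big_split mulrDr mulrDl /=.
  rewrite !mulr_sumr !mulr_suml; congr (_ + _); apply: eq_bigr => k _.
    by rewrite !gskew_p//; ring.
  by rewrite gskew23//; ring.
rewrite P1 P2.
(* In each derivative term the indices H and K occur in different factors, so the double sum splits
   into an anchor coefficient times a pairing. *)
have sepH (F G : 'I_n -> idx -> R) : \sum_H \sum_K \sum_k F k H * G k K =
    \sum_k (\sum_K G k K) * (\sum_H F k H).
  under eq_bigr => H _ do rewrite exchange_big /=.
  rewrite exchange_big /=; apply: eq_bigr => k _; rewrite mulrC mulr_suml.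
  by apply: eq_bigr => H _; rewrite mulr_sumr.
under [X in _ + X]eq_bigr => H _ do rewrite big_split /= big_split /= !sumrN.
rewrite [X in _ + X]big_split /= [X in _ + (X + _)]big_split /= !sumrN !sepH.
rewrite addrA; congr (_ - _).
  rewrite -sumrN -!big_split; apply: eq_bigr => k _ /=.
  by rewrite -addrA; congr (_ + (_ + _)); rewrite mulrC.
rewrite exchange_big /=; under eq_bigr => K _ do rewrite exchange_big /=.
by rewrite exchange_big.
Qed.

End Bracket.
End Coordinates.

(** * Identities of the Dorfman bracket *)

Section DorfmanIdentities.
Variables (R : realType) (n r : nat) (M : manifold R n) (A : vbundle M r).
Local Notation idx := ('I_r + 'I_r)%type.
Implicit Types (c : tidx A) (t : trivz A) (x : M) (e : Esection A).

Lemma pairingDl (u u' v : idx -> R) :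
  pairing (fun I => u I + u' I) v = pairing u v + pairing u' v.
Proof. by rewrite /pairing -big_split; apply: eq_bigr => I _; rewrite mulrDl. Qed.

Lemma pairingZl (a : R) (u v : idx -> R) :
  pairing (fun I => a * u I) v = a * pairing u v.
Proof. by rewrite /pairing mulr_sumr; apply: eq_bigr => I _; rewrite mulrA. Qed.

Lemma pairingDr (u v v' : idx -> R) :
  pairing u (fun I => v I + v' I) = pairing u v + pairing u v'.
Proof. by rewrite ![pairing u _]pairingC pairingDl. Qed.

Lemma pairingZr (a : R) (u v : idx -> R) :
  pairing u (fun I => a * v I) = a * pairing u v.
Proof. by rewrite ![pairing u _]pairingC pairingZl. Qed.

Variable Th : gfamily A.

Lemma rhoD t x (u v : idx -> R) k :
  rho Th t x (fun I => u I + v I) k = rho Th t x u k + rho Th t x v k.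
Proof. by rewrite /rho -big_split; apply: eq_bigr => I _; rewrite mulrDr. Qed.

Lemma rhoZ t x (a : R) (u : idx -> R) k :
  rho Th t x (fun I => a * u I) k = a * rho Th t x u k.
Proof. by rewrite /rho mulr_sumr; apply: eq_bigr => I _; rewrite mulrCA. Qed.

Lemma tri_lin1 t x (a : R) (u u' v w : idx -> R) :
  tri Th t x (fun I => a * u I + u' I) v w = a * tri Th t x u v w + tri Th t x u' v w.
Proof.
rewrite /tri mulr_sumr -big_split; apply: eq_bigr => J _ /=.
rewrite mulr_sumr -big_split; apply: eq_bigr => K _ /=.
by rewrite mulr_sumr -big_split; apply: eq_bigr => L _ /=; ring.
Qed.

Lemma tri_lin2 t x (a : R) (u v v' w : idx -> R) :
  tri Th t x u (fun I => a * v I + v' I) w = a * tri Th t x u v w + tri Th t x u v' w.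
Proof.
rewrite /tri mulr_sumr -big_split; apply: eq_bigr => J _ /=.
rewrite mulr_sumr -big_split; apply: eq_bigr => K _ /=.
by rewrite mulr_sumr -big_split; apply: eq_bigr => L _ /=; ring.
Qed.

Lemma tri_lin3 t x (a : R) (u v w w' : idx -> R) :
  tri Th t x u v (fun I => a * w I + w' I) = a * tri Th t x u v w + tri Th t x u v w'.
Proof.
rewrite /tri mulr_sumr -big_split; apply: eq_bigr => J _ /=.
rewrite mulr_sumr -big_split; apply: eq_bigr => K _ /=.
by rewrite mulr_sumr -big_split; apply: eq_bigr => L _ /=; ring.
Qed.

Lemma crd_lin c x (a : R) (u v : Efib A x) :
  crd c (a *: u + v) = (fun I => a * crd c u I + crd c v I).
Proof.
apply/funext => I; rewrite crdD; congr (_ + _).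
by case: I => b /=; rewrite ?scale_lfunE ?linearZ.
Qed.

Lemma dorf_lin t x e e' (a : R) (u v : Efib A x) :
  dorf Th t e e' (a *: u + v) = a * dorf Th t e e' u + dorf Th t e e' v.
Proof.
rewrite /dorf crd_lin tri_lin3 mulrBr opprD addrACA; congr (_ + _).
rewrite mulr_sumr -big_split; apply: eq_bigr => k _ /=.
by rewrite !pairingDr !pairingZr rhoD rhoZ; ring.
Qed.

Lemma dorf0 t x e e' : dorf Th t e e' (0 : Efib A x) = 0.
Proof.
have := dorf_lin t e e' 1 (0 : Efib A x) 0.
by rewrite scaler0 addr0 mul1r => /eqP; rewrite -subr_eq0 opprD addNKr oppr_eq0 => /eqP.
Qed.

Lemma dorf_sumr t x e e' (I : finType) (a : I -> R) (v : I -> Efib A x) :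
  dorf Th t e e' (\sum_i a i *: v i) = \sum_i a i * dorf Th t e e' (v i).
Proof.
elim/big_rec2: _ => [|i s w _ <-]; first exact: dorf0.
exact: dorf_lin.
Qed.

Lemma dorfNr t x e e' (v : Efib A x) : dorf Th t e e' (- v) = - dorf Th t e e' v.
Proof. by have := dorf_lin t e e' (-1) v 0; rewrite scaleN1r addr0 dorf0 addr0 mulN1r. Qed.

Definition diffs t e x := forall I, diff_at t.1 (fun y => crd t.2 (e y) I) x.

Lemma dcrdD t e e' x k : diffs t e x -> diffs t e' x ->
  dcrd t (fun y => e y + e' y) x k = fun I => dcrd t e x k I + dcrd t e' x k I.
Proof.
move=> de de'; apply/funext => I; rewrite /dcrd -pdD//.
by congr (pd _ _ _ _); apply/funext => y; rewrite crdD.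
Qed.

Lemma dcrdN t e x k : diffs t e x ->
  dcrd t (fun y => - e y) x k = fun I => - dcrd t e x k I.
Proof.
move=> de; apply/funext => I; rewrite /dcrd -pdN//.
by congr (pd _ _ _ _); apply/funext => y; rewrite crdN.
Qed.

Lemma dorfDl t x e1 e2 e' (v : Efib A x) : diffs t e1 x -> diffs t e2 x ->
  dorf Th t (fun y => e1 y + e2 y) e' v = dorf Th t e1 e' v + dorf Th t e2 e' v.
Proof.
move=> d1 d2; rewrite /dorf addrACA -opprD; congr (_ - _).
  rewrite -big_split; apply: eq_bigr => k _; rewrite dcrdD//=.
  rewrite (_ : crd t.2 (e1 x + e2 x) = fun I => crd t.2 (e1 x) I + crd t.2 (e2 x) I).
    by rewrite !pairingDl rhoD; ring.
  by apply/funext => I; rewrite crdD.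
rewrite -[tri _ _ _ (crd t.2 (e1 x)) _ _]mul1r -tri_lin1; congr (tri _ _ _ _ _ _).
by apply/funext => I; rewrite crdD mul1r.
Qed.

Lemma dorfDr t x e e1 e2 (v : Efib A x) : diffs t e1 x -> diffs t e2 x ->
  dorf Th t e (fun y => e1 y + e2 y) v = dorf Th t e e1 v + dorf Th t e e2 v.
Proof.
move=> d1 d2; rewrite /dorf addrACA -opprD; congr (_ - _).
  rewrite -big_split; apply: eq_bigr => k _; rewrite dcrdD//=.
  rewrite (_ : crd t.2 (e1 x + e2 x) = fun I => crd t.2 (e1 x) I + crd t.2 (e2 x) I).
    by rewrite !pairingDl pairingDr rhoD; ring.
  by apply/funext => I; rewrite crdD.
rewrite -[tri _ _ _ _ (crd t.2 (e1 x)) _]mul1r -tri_lin2; congr (tri _ _ _ _ _ _).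
by apply/funext => I; rewrite crdD mul1r.
Qed.

Lemma triNl t x (u v w : idx -> R) :
  tri Th t x (fun I => - u I) v w = - tri Th t x u v w.
Proof.
rewrite /tri -sumrN; apply: eq_bigr => J _; rewrite -sumrN; apply: eq_bigr => K _.
by rewrite -sumrN; apply: eq_bigr => L _; ring.
Qed.

Lemma triNm t x (u v w : idx -> R) :
  tri Th t x u (fun I => - v I) w = - tri Th t x u v w.
Proof.
rewrite /tri -sumrN; apply: eq_bigr => J _; rewrite -sumrN; apply: eq_bigr => K _.
by rewrite -sumrN; apply: eq_bigr => L _; ring.
Qed.

Lemma rhoN t x (u : idx -> R) k : rho Th t x (fun I => - u I) k = - rho Th t x u k.
Proof. by rewrite /rho -sumrN; apply: eq_bigr => I _; ring. Qed.

Lemma pairingNl (u v : idx -> R) : pairing (fun I => - u I) v = - pairing u v.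
Proof. by rewrite /pairing -sumrN; apply: eq_bigr => I _; ring. Qed.

Lemma pairingNr (u v : idx -> R) : pairing u (fun I => - v I) = - pairing u v.
Proof. by rewrite /pairing -sumrN; apply: eq_bigr => I _; ring. Qed.

Lemma crdNE c x (u : Efib A x) : crd c (- u) = fun I => - crd c u I.
Proof. by apply/funext => I; rewrite crdN. Qed.

Lemma dorfNl t x e e' (v : Efib A x) : diffs t e x ->
  dorf Th t (fun y => - e y) e' v = - dorf Th t e e' v.
Proof.
move=> de; rewrite /dorf opprB addrC crdNE triNl opprK; congr (_ + _).
by rewrite -sumrN; apply: eq_bigr => k _; rewrite dcrdN// rhoN !pairingNl; ring.
Qed.

Lemma dorfNm t x e e' (v : Efib A x) : diffs t e' x ->
  dorf Th t e (fun y => - e' y) v = - dorf Th t e e' v.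
Proof.
move=> de; rewrite /dorf opprB addrC crdNE triNm opprK; congr (_ + _).
by rewrite -sumrN; apply: eq_bigr => k _; rewrite dcrdN// rhoN !pairingNl pairingNr; ring.
Qed.

Definition lie_der t x (v : Efib A x) (f : M -> R) : R :=
  \sum_k rho Th t x (crd t.2 v) k * pd t.1 k f x.

Lemma pd_Epair t e e' x k : tzdom t x -> diffs t e x -> diffs t e' x ->
  pd t.1 k (fun y => Epair (e y) (e' y)) x =
  pairing (dcrd t e x k) (crd t.2 (e' x)) + pairing (dcrd t e' x k) (crd t.2 (e x)).
Proof.
move=> [tx1 tx2] de de'.
rewrite (@eq_pd _ _ _ t.1 k (tdom t.2) _
  (fun y => \sum_I crd t.2 (e y) I * crd t.2 (e' y) (star I))) //; first last.
- by move=> y ty; rewrite (Epair_crd _ _ ty).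
- exact: tdom_open.
rewrite pd_sum => [|I]; last exact: diff_atM.
rewrite [X in _ = _ + X]pairingC /pairing -big_split; apply: eq_bigr => I _ /=.
by rewrite pdM.
Qed.

Hypothesis skewTh : gskew Th.

Lemma tri_skew12 t x (u v w : idx -> R) : tzdom t x ->
  tri Th t x u v w = - tri Th t x v u w.
Proof.
move=> tx; rewrite /tri exchange_big -sumrN; apply: eq_bigr => J _.
rewrite -sumrN; apply: eq_bigr => K _; rewrite -sumrN; apply: eq_bigr => L _.
by rewrite (gskew12 skewTh)//; ring.
Qed.

Lemma tri_skew23 t x (u v w : idx -> R) : tzdom t x ->
  tri Th t x u v w = - tri Th t x u w v.
Proof.
move=> tx; rewrite /tri -sumrN; apply: eq_bigr => J _.
rewrite exchange_big -sumrN; apply: eq_bigr => K _; rewrite -sumrN; apply: eq_bigr => L _.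
by rewrite (gskew23 skewTh)//; ring.
Qed.

(** This and the next lemma are the two pre-Courant axioms. The cubic part drops out by
    skew-symmetry, and the surviving derivative terms are the Leibniz rule for the pairing. *)
Lemma dorf_sym12 t x e e' (v : Efib A x) : tzdom t x -> diffs t e x -> diffs t e' x ->
  dorf Th t e e' v + dorf Th t e' e v =
  lie_der t v (fun y => Epair (e y) (e' y)).
Proof.
move=> tx de de'; rewrite /dorf (tri_skew12 (crd t.2 (e' x)))// opprK addrACA addNr addr0.
rewrite -big_split; apply: eq_bigr => k _ /=; rewrite pd_Epair//; ring.
Qed.

Lemma dorf_sym23 t x e e' e'' : tzdom t x -> diffs t e' x -> diffs t e'' x ->
  dorf Th t e e' (e'' x) + dorf Th t e e'' (e' x) =
  lie_der t (e x) (fun y => Epair (e' y) (e'' y)).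
Proof.
move=> tx de de'.
rewrite /dorf (tri_skew23 _ (crd t.2 (e'' x)))// opprK addrACA addNr addr0.
rewrite -big_split; apply: eq_bigr => k _ /=; rewrite pd_Epair//; ring.
Qed.

End DorfmanIdentities.

(** * Change of local coordinates *)

Section Substitution.
Variables (R : realType) (n r : nat) (y : gen n r -> gpoly R n r).
Implicit Types (u : gpoly R n r) (w : seq (gen n r)).

Lemma gsubst_rec0 k u w : (forall s, u s = 0) -> gsubst_rec k y u w = 0.
Proof.
elim: k u w => [|k IH] u [|g w] u0 //=.
rewrite big1// => h _; apply: gmul0r => s; apply: IH => s'; exact: u0.
Qed.

Lemma gsubst_recS k u g w : gsubst_rec k.+1 y u (g :: w) =
  \sum_h gmul (dleft g (y h)) (gsubst_rec k y (dleft h u)) w.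
Proof. by []. Qed.

(** The chain rules of order one and, below, two, freed from the fuel of [gsubst_rec]. *)
Definition gsubst1 u g : R := \sum_h y h [:: g] * u [:: h].

Definition gsubst2 u g1 g2 : R :=
  \sum_h (y h [:: g1; g2] * u [:: h] + y h [:: g1] * gsubst1 (dleft h u) g2).

Lemma gsubst_rec1E k u g : gsubst_rec k.+1 y u [:: g] = gsubst1 u g.
Proof. by apply: eq_bigr => h _; case: k. Qed.

Lemma gsubst_rec2E k u g1 g2 : gsubst_rec k.+2 y u [:: g1; g2] = gsubst2 u g1 g2.
Proof.
rewrite gsubst_recS; apply: eq_bigr => h _.
by rewrite gmul1 -(gsubst_rec1E k).
Qed.

Lemma gsubst3E u g1 g2 g3 : gsubst y u [:: g1; g2; g3] =
  \sum_h (y h [:: g1; g2; g3] * u [:: h]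
          + y h [:: g1; g2] * gsubst1 (dleft h u) g3
          + ((-1) ^+ (odd_gen g2 && odd_gen g3) * y h [:: g1; g3]
               * gsubst1 (dleft h u) g2
             + y h [:: g1] * gsubst2 (dleft h u) g2 g3)).
Proof.
rewrite [LHS]gsubst_recS; apply: eq_bigr => h _.
by rewrite gmul2 -(gsubst_rec1E 1) -(gsubst_rec1E 1) -(gsubst_rec2E 0).
Qed.

Lemma sum_gen (F : gen n r -> R) :
  \sum_h F h = \sum_k F (inl k) + \sum_I F (inr I).
Proof. exact: big_sumType. Qed.

End Substitution.

Section ChangeOfCoordinates.
Variables (R : realType) (n r : nat) (M : manifold R n) (A : vbundle M r).
Local Notation idx := ('I_r + 'I_r)%type.
Implicit Types (c : tidx A) (t : trivz A) (x : M) (e : Esection A).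

(** The local frame of the sum bundle that is dual to [crd]; thus [inl a] carries an element of the
    dual coframe. *)
Definition eps c (I : idx) : Esection A := fun x =>
  match I with
  | inl a => (0, tnth (dual_frame c x) a)
  | inr a => (tnth (frame c x) a, 0)
  end.

Lemma crd_eps c x I J : tdom c x -> crd c (eps c I x) J = (I == J)%:R.
Proof.
move=> cx; have fr := basis_free (frame_basis cx).
case: I => a; case: J => b /=.
- by rewrite dual_frameE (tnth_nth 0) coord_free// eq_sym.
- by rewrite linear0.
- by rewrite zero_lfunE.
- by rewrite (tnth_nth 0) coord_free.
Qed.

Lemma crd_decomp c x (v : Efib A x) : tdom c x ->
  v = \sum_I crd c v I *: eps c I x.
Proof.
move=> cx; apply: (crd_inj cx) => J.
have -> : crd c (\sum_I crd c v I *: eps c I x) J =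
    \sum_I crd c v I * crd c (eps c I x) J.
  elim/big_rec2: _ => [|I s w _ <-]; last by rewrite crd_lin.
  by case: J => b /=; rewrite ?zero_lfunE ?linear0.
rewrite (bigD1 J)//= big1 ?addr0 => [|I IJ]; first by rewrite crd_eps// eqxx mulr1.
by rewrite crd_eps// (negbTE IJ) mulr0.
Qed.

Lemma crd_change c c' x (v : Efib A x) J : tdom c' x ->
  crd c v J = \sum_I crd c' v I * crd c (eps c' I x) J.
Proof.
move=> cx; rewrite {1}(crd_decomp v cx).
elim/big_rec2: _ => [|I s w _ <-]; last by rewrite crd_lin.
by case: J => b /=; rewrite ?zero_lfunE ?linear0.
Qed.

(** The change of frame preserves the pairing, so contracting with the transition matrix inverts it
    up to [star], without any inverse matrix. *)
Lemma pairing_eps c c' x (v : Efib A x) I : tdom c x -> tdom c' x ->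
  pairing (crd c (eps c' I x)) (crd c v) = crd c' v (star I).
Proof.
move=> cx c'x; rewrite -Epair_crd// (Epair_crd _ _ c'x) /pairing.
rewrite (bigD1 I)//= big1 ?addr0 => [|J JI]; first by rewrite crd_eps// eqxx mul1r.
by rewrite crd_eps// eq_sym (negbTE JI) mul0r.
Qed.

(** Relative to [U] so that frame sections, smooth only over their domain, and global sections enter
    the same statements. *)
Definition smooth_sec (U : set M) e :=
  forall c I, smooth_on (tdom c `&` U) (fun x => crd c (e x) I).

Lemma smooth_eps c I : smooth_sec (tdom c) (eps c I).
Proof.
move=> c' J; have oU : open (tdom c' `&` tdom c) by apply: openI; exact: tdom_open.
case: I => a; case: J => b /=.
- rewrite setIC; apply: smooth_on_ext (@frame_smooth _ _ _ _ A c c' a b).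
    by rewrite setIC.
  by move=> x _; rewrite dual_frameE.
- by apply: smooth_on_ext (smooth_on_cst 0 oU) => // x _; rewrite linear0.
- by apply: smooth_on_ext (smooth_on_cst 0 oU) => // x _; rewrite zero_lfunE.
- exact: frame_smooth.
Qed.

Lemma smooth_sec_diffs U t e x : open U -> U x -> tzdom t x -> smooth_sec U e ->
  diffs t e x.
Proof.
move=> oU Ux [t1 t2] se I; apply: smooth_on_diff_at (se t.2 I) => //.
by apply: openI => //; exact: tdom_open.
Qed.

Section TwoCharts.
Variables (t t' : trivz A) (x : M).
Hypotheses (tx : tzdom t x) (tx' : tzdom t' x).
Let tm (I J : idx) (z : M) := crd t.2 (eps t'.2 I z) J.
Local Notation Y := (gchange t t' x).

Lemma tm_diff i I J : cdom i x -> diff_at i (tm I J) x.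
Proof.
move=> ix; apply: (@smooth_on_diff_at _ _ _ (tdom t.2 `&` tdom t'.2)) => //.
- by apply: openI; exact: tdom_open.
- by split; [exact: tx.2|exact: tx'.2].
- exact: smooth_eps.
Qed.

Lemma gchange_odd I g : Y (inr I) [:: g] = if g is inr J then tm I J x else 0.
Proof.
case: I => a; case: g => [k|[b|b]] //=; rewrite /tm /=.
- by rewrite dual_frameE.
- by rewrite linear0.
- by rewrite zero_lfunE.
Qed.

Lemma gchange_odd_long I g h w : Y (inr I) [:: g, h & w] = 0.
Proof. by case: I => a; case: g => [k|[b|b]]. Qed.

Lemma gchange_p_odd k I : Y (inl k) [:: inr I] = 0.
Proof. by case: I. Qed.

(** [gchange] puts the sign of the word theta xi by hand. One formula covers all words because
    differentiating g g^(-1) = 1 moves the derivative from one factor to the other with the opposite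
    sign. *)
Lemma gchange_p2 k I J : Y (inl k) [:: inr I; inr J] =
  \sum_K tm K I x * pd t'.1 k (tm (star K) J) x.
Proof.
have [[t1 t2] [t1' t2']] := (tx, tx').
rewrite big_sumType /=.
have tm0 K L z : (if K is inl _ then true else false) !=
    (if L is inl _ then true else false) -> tm K L z = 0.
  by case: K; case: L => //= a b _; rewrite /tm /= ?linear0 ?zero_lfunE.
have pd0 i K L : (if K is inl _ then true else false) !=
    (if L is inl _ then true else false) -> pd i k (tm K L) x = 0.
  by move=> KL; rewrite (_ : tm K L = fun=> 0) ?pd_cst//; apply/funext => z; exact: tm0.
case: I => a; case: J => b; rewrite ?[Y _ _]/=.
- by rewrite !big1 ?addr0// => d _; [rewrite tm0// mul0r|rewrite pd0// mulr0].
- rewrite [X in _ = _ + X]big1 ?addr0 => [|d _]; last by rewrite tm0// mul0r.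
  by apply: eq_bigr => d _; rewrite mulrC /tm /= dual_frameE.
- rewrite [X in _ = X + _]big1 ?add0r => [|d _]; last by rewrite tm0// mul0r.
  apply/eqP; rewrite eq_sym -addr_eq0 -big_split /=; apply/eqP.
  transitivity (pd t'.1 k (fun z => \sum_d tm (inr d) (inr a) z * tm (inl d) (inl b) z) x).
    rewrite pd_sum => [|d]; last by apply: diff_atM; exact: tm_diff.
    apply: eq_bigr => d _; rewrite pdM//; [|exact: tm_diff|exact: tm_diff].
    by rewrite addrC; congr (_ * _ + _ * _); rewrite /tm /= dual_frameE.
  rewrite (@eq_pd _ _ _ t'.1 k (tdom t.2 `&` tdom t'.2) _ (fun=> (a == b)%:R)) ?pd_cst//.
    by apply: openI; exact: tdom_open.
  move=> z [z1 z2].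
  have := crd_change t.2 (eps t.2 (inr b) z) (inr a) z2.
  rewrite crd_eps// big_sumType /= big1 ?add0r => [|d _]; last first.
    by rewrite linear0 mulr0.
  have -> : (inr b == inr a :> idx) = (a == b) by rewrite eq_sym.
  by move=> ->; apply: eq_bigr => d _; rewrite /tm /= dual_frameE mulrC.
- by rewrite !big1 ?addr0// => d _; [rewrite pd0// mulr0|rewrite tm0// mul0r].
Qed.

Definition gcorr (k : 'I_n) (I J : idx) : R :=
  \sum_K tm K I x * pd t'.1 k (tm (star K) J) x.

Lemma gcorr_contract k e (v : Efib A x) :
  \sum_I \sum_J gcorr k I J * crd t.2 (e x) (star I) * crd t.2 v (star J) =
  \sum_K crd t'.2 (e x) K * pairing (fun J => pd t'.1 k (tm K J) x) (crd t.2 v).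
Proof.
rewrite -[RHS]sum_star.
under [RHS]eq_bigr => K _ do
  rewrite -(pairing_eps _ _ tx.2 tx'.2) /pairing mulr_suml.
rewrite [RHS]exchange_big; apply: eq_bigr => I _ /=.
under [RHS]eq_bigr => K _ do rewrite mulr_sumr.
rewrite [RHS]exchange_big; apply: eq_bigr => J _ /=.
rewrite /gcorr !mulr_suml; apply: eq_bigr => K _.
by rewrite -/(tm K I x); ring.
Qed.

Variable Th : gfamily A.
Hypothesis glue : forall w, Th t x w = gsubst Y (Th t' x) w.
Hypothesis Th1 : forall g, Th t' x [:: g] = 0.
Hypothesis skewTh : gskew Th.
Local Notation u := (Th t' x).

Lemma gsubst1_odd v I : gsubst1 Y v (inr I) = \sum_L tm L I x * v [:: inr L].
Proof.
rewrite /gsubst1 sum_gen big1 ?add0r => [|k _]; last by rewrite gchange_p_odd mul0r.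
by apply: eq_bigr => L _; rewrite gchange_odd.
Qed.

Lemma glue_Ip J j : Th t x [:: inr J; inl j] =
  \sum_I tm I J x * \sum_k pd t'.1 k (fun z => chart t.1 z 0 j) x * u [:: inr I; inl k].
Proof.
rewrite glue /gsubst [size _]/= gsubst_rec2E /gsubst2 sum_gen.
rewrite big1 ?add0r => [|k _]; last by rewrite Th1 gchange_p_odd mulr0 mul0r addr0.
apply: eq_bigr => I _; rewrite Th1 mulr0 add0r gchange_odd; congr (_ * _).
rewrite /gsubst1 sum_gen [X in _ + X]big1 ?addr0 => [|K _]; first by [].
by rewrite gchange_odd mul0r.
Qed.

(** A momentum in a word of [Th] expands quadratically in the odd letters. It can absorb any two of
    the three letters, which gives the three [gcorr] terms, the sign coming from an odd
    transposition. *)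
Lemma glue_IJK I J K : Th t x [:: inr I; inr J; inr K] =
  \sum_k gcorr k I J * \sum_L tm L K x * u [:: inr L; inl k]
  - \sum_k gcorr k I K * \sum_L tm L J x * u [:: inr L; inl k]
  + (\sum_P tm P I x * \sum_k gcorr k J K * u [:: inr P; inl k]
   + \sum_P tm P I x * \sum_Q tm Q J x * \sum_S tm S K x * u [:: inr P; inr Q; inr S]).
Proof.
rewrite glue gsubst3E sum_gen; congr (_ + _).
  rewrite -sumrB; apply: eq_bigr => k _.
  rewrite Th1 mulr0 add0r !gchange_p2 !odd_gen_inr expr1 mulN1r gchange_p_odd.
  rewrite mul0r addr0 mulNr !gsubst1_odd -/(gcorr k I J) -/(gcorr k I K).
  by congr (_ * _ - _ * _); apply: eq_bigr => L _; rewrite /dleft (gskew_p skewTh).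
rewrite -big_split; apply: eq_bigr => P _; rewrite [RHS]/=.
rewrite Th1 mulr0 add0r !gchange_odd_long mulr0 !mul0r !add0r gchange_odd.
rewrite -mulrDr; congr (_ * _); rewrite /gsubst2 sum_gen; congr (_ + _).
  apply: eq_bigr => k _; rewrite gchange_p2 gchange_p_odd mul0r addr0.
  by rewrite /dleft.
apply: eq_bigr => Q _; rewrite gchange_odd_long mul0r add0r gchange_odd gsubst1_odd.
by [].
Qed.

Lemma tm_contract (v : Efib A x) I :
  \sum_J tm I J x * crd t.2 v (star J) = crd t'.2 v (star I).
Proof. exact: pairing_eps tx.2 tx'.2. Qed.

Lemma rho_change (v : Efib A x) j : rho Th t x (crd t.2 v) j =
  \sum_k pd t'.1 k (fun z => chart t.1 z 0 j) x * rho Th t' x (crd t'.2 v) k.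
Proof.
rewrite {1}/rho; under eq_bigr => J _ do rewrite glue_Ip mulr_suml.
rewrite exchange_big /=.
under [RHS]eq_bigr => k _ do rewrite /rho mulr_sumr.
rewrite [RHS]exchange_big; apply: eq_bigr => I _ /=.
rewrite -tm_contract.
under [RHS]eq_bigr => k _ do rewrite !mulr_sumr.
rewrite [RHS]exchange_big; apply: eq_bigr => J _ /=.
by rewrite mulr_sumr mulr_suml; apply: eq_bigr => k _; ring.
Qed.

Lemma rho_pd_change (v : Efib A x) f : diff_at t.1 f x ->
  \sum_j rho Th t x (crd t.2 v) j * pd t.1 j f x =
  \sum_k rho Th t' x (crd t'.2 v) k * pd t'.1 k f x.
Proof.
move=> df; under eq_bigr => j _ do rewrite rho_change mulr_suml.
rewrite exchange_big; apply: eq_bigr => k _ /=.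
rewrite (pd_change _ tx'.1 tx.1)// mulr_sumr; apply: eq_bigr => j _.
by ring.
Qed.

(* the inhomogeneous part of the change of coordinates of both [dcrd] and [tri];
   the two contributions cancel in [dorf] *)
Definition gamma k (va vb : Efib A x) : R :=
  \sum_I \sum_J gcorr k I J * crd t.2 va (star I) * crd t.2 vb (star J).

Lemma tri_change (va vb vc : Efib A x) :
  tri Th t x (crd t.2 va) (crd t.2 vb) (crd t.2 vc) =
  tri Th t' x (crd t'.2 va) (crd t'.2 vb) (crd t'.2 vc) +
  \sum_k (gamma k va vb * rho Th t' x (crd t'.2 vc) k
         - gamma k va vc * rho Th t' x (crd t'.2 vb) k
         + gamma k vb vc * rho Th t' x (crd t'.2 va) k).
Proof.
have rhoE (v : Efib A x) k : rho Th t' x (crd t'.2 v) k =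
    \sum_J crd t.2 v (star J) * \sum_L tm L J x * u [:: inr L; inl k].
  under [RHS]eq_bigr => J _ do rewrite mulr_sumr.
  rewrite exchange_big; apply: eq_bigr => L _ /=.
  by rewrite -tm_contract mulr_sumr; apply: eq_bigr => J _; ring.
set a := fun I => crd t.2 va (star I); set b := fun I => crd t.2 vb (star I).
set c := fun I => crd t.2 vc (star I).
(* Each of the four parts is brought to a sum over the same I, J, K with the factor
   [a I * b J * c K], so that [glue_IJK] can be applied coefficient by coefficient. *)
have S1 : \sum_k gamma k va vb * rho Th t' x (crd t'.2 vc) k =
   \sum_I \sum_J \sum_K
     (\sum_k gcorr k I J * \sum_L tm L K x * u [:: inr L; inl k]) * a I * b J * c K.
  under eq_bigr => k _ do rewrite /gamma mulr_suml.
  rewrite exchange_big; apply: eq_bigr => I _ /=.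
  under eq_bigr => k _ do rewrite mulr_suml.
  rewrite exchange_big; apply: eq_bigr => J _ /=.
  under eq_bigr => k _ do rewrite rhoE mulr_sumr.
  rewrite exchange_big; apply: eq_bigr => K _ /=.
  by rewrite !mulr_suml; apply: eq_bigr => k _; rewrite /a /b /c; ring.
have S2 : \sum_k gamma k va vc * rho Th t' x (crd t'.2 vb) k =
   \sum_I \sum_J \sum_K
     (\sum_k gcorr k I K * \sum_L tm L J x * u [:: inr L; inl k]) * a I * b J * c K.
  under eq_bigr => k _ do rewrite /gamma mulr_suml.
  rewrite exchange_big; apply: eq_bigr => I _ /=.
  rewrite [RHS]exchange_big /=.
  under eq_bigr => k _ do rewrite mulr_suml.
  rewrite exchange_big; apply: eq_bigr => J _ /=.
  under eq_bigr => k _ do rewrite rhoE mulr_sumr.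
  rewrite exchange_big; apply: eq_bigr => K _ /=.
  by rewrite !mulr_suml; apply: eq_bigr => k _; rewrite /a /b /c; ring.
have S3 : \sum_k gamma k vb vc * rho Th t' x (crd t'.2 va) k =
   \sum_I \sum_J \sum_K
     (\sum_P tm P I x * \sum_k gcorr k J K * u [:: inr P; inl k]) * a I * b J * c K.
  under eq_bigr => k _ do rewrite mulrC rhoE mulr_suml.
  rewrite exchange_big; apply: eq_bigr => I _ /=.
  under eq_bigr => k _ do rewrite /gamma mulr_sumr.
  rewrite exchange_big; apply: eq_bigr => J _ /=.
  under eq_bigr => k _ do rewrite mulr_sumr.
  rewrite exchange_big; apply: eq_bigr => K _ /=.
  under [in RHS]eq_bigr => P _ do rewrite mulr_sumr.
  rewrite exchange_big /= !mulr_suml; apply: eq_bigr => k _.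
  move: (gcorr k J K) => G; rewrite mulrAC -/(a I) mulr_sumr !mulr_suml; apply: eq_bigr => P _.
  by rewrite -/(b J) -/(c K); ring.
have S4 : tri Th t' x (crd t'.2 va) (crd t'.2 vb) (crd t'.2 vc) =
   \sum_I \sum_J \sum_K
     (\sum_P tm P I x * \sum_Q tm Q J x * \sum_S tm S K x *
        u [:: inr P; inr Q; inr S]) * a I * b J * c K.
  transitivity (\sum_I \sum_P tm P I x * a I * \sum_J \sum_Q tm Q J x * b J *
     \sum_K \sum_S tm S K x * c K * u [:: inr P; inr Q; inr S]).
    rewrite exchange_big; apply: eq_bigr => P _ /=.
    rewrite -mulr_suml (tm_contract va) [in RHS]exchange_big mulr_sumr.
    apply: eq_bigr => Q _ /=.
    rewrite -mulr_suml (tm_contract vb) [in RHS]exchange_big mulrA mulr_sumr.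
    apply: eq_bigr => S _ /=.
    by rewrite -mulr_suml (tm_contract vc); ring.
  apply: eq_bigr => I _.
  under eq_bigr => P _ do rewrite mulr_sumr.
  rewrite exchange_big; apply: eq_bigr => J _ /=.
  under eq_bigr => P _ do rewrite mulr_sumr.
  under eq_bigr => P _.
    under eq_bigr => Q _ do rewrite !mulr_sumr.
    rewrite exchange_big /=; over.
  rewrite exchange_big; apply: eq_bigr => K _ /=.
  rewrite !mulr_suml; apply: eq_bigr => P _.
  rewrite mulr_sumr !mulr_suml; apply: eq_bigr => Q _.
  rewrite !mulr_sumr !mulr_suml; apply: eq_bigr => S _; ring.
rewrite big_split sumrB /= S1 S2 S3 S4 -!sumrB -!big_split.
apply: eq_bigr => I _; rewrite -!sumrB -!big_split; apply: eq_bigr => J _.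
rewrite -!sumrB -!big_split; apply: eq_bigr => K _ /=.
rewrite glue_IJK -/(a I) -/(b J) -/(c K); ring.
Qed.

Lemma pairing_dcrd_change k e (v : Efib A x) : diffs t' e x ->
  pairing (fun I => pd t'.1 k (fun y => crd t.2 (e y) I) x) (crd t.2 v) =
  pairing (dcrd t' e x k) (crd t'.2 v) + gamma k (e x) v.
Proof.
move=> de; rewrite /gamma gcorr_contract /pairing.
have pdE I : pd t'.1 k (fun y => crd t.2 (e y) I) x =
    \sum_K (dcrd t' e x k K * tm K I x + crd t'.2 (e x) K * pd t'.1 k (tm K I) x).
  transitivity (pd t'.1 k (fun y => \sum_K crd t'.2 (e y) K * tm K I y) x).
    apply: (@eq_pd _ _ _ _ _ (tdom t'.2)); [exact: tdom_open|exact: tx'.2|exact: tx'.1|].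
    by move=> y y'; exact: crd_change.
  have dt K : diff_at t'.1 (tm K I) x by apply: tm_diff; exact: tx'.1.
  rewrite pd_sum => [|K]; last exact: diff_atM.
  by apply: eq_bigr => K _; rewrite pdM//; exact: tx'.1.
under eq_bigr => I _ do rewrite pdE mulr_suml.
rewrite exchange_big -big_split; apply: eq_bigr => K _ /=.
rewrite -tm_contract !mulr_sumr -big_split; apply: eq_bigr => I _ /=.
by rewrite -/(tm K I x); ring.
Qed.

(** The chart is changed before the frame: the anchor of [w] is a vector field and acts on each
    component independently of the chart; the components are then rewritten in the other frame. *)
Lemma rho_pairing_change (w : Efib A x) e (v : Efib A x) :
    diffs t e x -> diffs t' e x ->
  \sum_j rho Th t x (crd t.2 w) j * pairing (dcrd t e x j) (crd t.2 v) =
  \sum_k rho Th t' x (crd t'.2 w) k *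
    (pairing (dcrd t' e x k) (crd t'.2 v) + gamma k (e x) v).
Proof.
move=> de de'.
transitivity (\sum_I (\sum_j rho Th t x (crd t.2 w) j * dcrd t e x j I)
    * crd t.2 v (star I)).
  under [RHS]eq_bigr => I _ do rewrite mulr_suml.
  rewrite exchange_big; apply: eq_bigr => j _ /=.
  by rewrite mulr_sumr; apply: eq_bigr => I _; rewrite mulrA.
under eq_bigr => I _ do rewrite rho_pd_change// mulr_suml.
rewrite exchange_big; apply: eq_bigr => k _ /=.
rewrite -pairing_dcrd_change// mulr_sumr.
by apply: eq_bigr => I _; rewrite mulrA.
Qed.

Lemma dorf_change e e' (v : Efib A x) : diffs t e x -> diffs t' e x ->
    diffs t e' x -> diffs t' e' x ->
  dorf Th t e e' v = dorf Th t' e e' v.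
Proof.
move=> d1 d1' d2 d2'; rewrite /dorf tri_change opprD addrA addrAC; congr (_ - _).
rewrite [in LHS]big_split [in LHS]sumrB /= !rho_pairing_change//.
rewrite -sumrB -big_split -sumrB /=.
by apply: eq_bigr => k _ /=; ring.
Qed.

End TwoCharts.
End ChangeOfCoordinates.

(** * The two sides A and A^* and the torsion of an endomorphism *)

Section Sides.
Variables (R : realType) (n r : nat) (M : manifold R n) (A : vbundle M r).
Local Notation idx := ('I_r + 'I_r)%type.
Implicit Types (c : tidx A) (t : trivz A) (x : M) (e : Esection A) (q : bool).

(** [true] stands for A and [false] for its dual, so that a sum of sides counts the arguments lying
    in A. *)
Definition of_side q x (v : Efib A x) : Prop := if q then v.2 = 0 else v.1 = 0.

Definition side (I : idx) : bool := if I is inr _ then true else false.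

Lemma side_star I : side (star I) = ~~ side I. Proof. by case: I. Qed.

Lemma crd_side q c x (v : Efib A x) I : of_side q v -> side I != q -> crd c v I = 0.
Proof. by case: q I => [] [] a //= ->; rewrite ?zero_lfunE ?linear0. Qed.

Lemma dcrd_side q t e x k I : (forall y, of_side q (e y)) -> side I != q ->
  dcrd t e x k I = 0.
Proof.
move=> eq Iq; rewrite /dcrd (_ : (fun y => _) = fun=> 0) ?pd_cst//.
by apply/funext => y; exact: crd_side Iq.
Qed.

Lemma of_side_eps c I x : of_side (side I) (eps c I x).
Proof. by case: I. Qed.

Lemma Epair_side q x (u v : Efib A x) : of_side q u -> of_side q v -> Epair u v = 0.
Proof.
by case: q => /= uq vq; rewrite /Epair uq vq ?zero_lfunE ?linear0 addr0.
Qed.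

Lemma pairing_side q (u v : idx -> R) : (forall I, side I != q -> u I = 0) ->
  (forall I, side I != q -> v I = 0) -> pairing u v = 0.
Proof.
move=> uq vq; apply: big1 => I _; have [Iq|/uq->] := eqVneq (side I) q.
  by rewrite vq ?mulr0// side_star Iq; case: (q).
by rewrite mul0r.
Qed.

(** An argument in A is contracted with a letter xi, of second degree 1, an argument in the dual
    with a theta, of second degree 0. In a derivative term the momentum counts 1, and so do the two
    paired arguments, which must lie on opposite sides. *)
Lemma dorf_side0 (k l : nat) (Th : gfamily A) q1 q2 q3 t x e e' (v : Efib A x) :
  (forall w, Th t x w <> 0 -> sumn [seq (bideg g).1 | g <- w] = k /\
                             sumn [seq (bideg g).2 | g <- w] = l) ->
  (forall y, of_side q1 (e y)) -> (forall y, of_side q2 (e' y)) -> of_side q3 v ->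
  (q1 + q2 + q3)%N != l -> dorf Th t e e' v = 0.
Proof.
move=> deg e1 e2 v3 nl.
have deg0 w : sumn [seq (bideg g).2 | g <- w] != l -> Th t x w = 0.
  by move=> wl; apply: contrapT => /deg[_ /eqP]; rewrite (negbTE wl).
have bid (I : idx) : (bideg (inr I : gen n r)).2 = (~~ side I : nat) by case: I.
have rho0 q (u : idx -> R) m : (forall I, side I != q -> u I = 0) ->
    (q + 1)%N != l -> rho Th t x u m = 0.
  move=> uq ql; apply: big1 => J _; have [Jq|Jq] := eqVneq (side J) (~~ q).
    by rewrite deg0 ?mul0r// [sumn _]/= bid Jq negbK.
  rewrite uq ?mulr0// side_star; apply: contra_neq Jq => <-.
  by rewrite negbK.
have pr0 m q q' (u u' : idx -> R) (w : idx -> R) (q'' : bool) :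
    (forall I, side I != q -> u I = 0) -> (forall I, side I != q' -> u' I = 0) ->
    (forall I, side I != q'' -> w I = 0) -> (q'' + q + q')%N != l ->
    rho Th t x w m * pairing u u' = 0.
  move=> uq uq' wq ql; have [qq|qq] := eqVneq q q'.
    by rewrite (@pairing_side q) ?mulr0// qq.
  rewrite (rho0 q'') ?mul0r//; apply: contra_neq ql => <-.
  by clear uq uq' wq; case: q q' q'' qq => [] [] [].
rewrite /dorf big1 => [|m _]; last first.
  rewrite (pr0 m q2 q3 (dcrd t e' x m) _ (crd t.2 (e x)) q1)
    ?(pr0 m q1 q3 _ (crd t.2 v) (crd t.2 (e' x)) q2)
    ?(pr0 m q1 q2 _ (crd t.2 (e' x)) (crd t.2 v) q3);
    try (by move=> I; first [exact: dcrd_side|exact: crd_side]);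
    try (by apply: contra_neq nl => <-; clear; case: q1 q2 q3 => [] [] []).
  by rewrite subrr addr0.
rewrite sub0r /tri big1 ?oppr0// => J _; apply: big1 => K _; apply: big1 => L _.
have [Jq|Jq] := eqVneq (side (star J)) q1; last first.
  by rewrite (crd_side _ (e1 x) Jq) mulr0 !mul0r.
have [Kq|Kq] := eqVneq (side (star K)) q2; last first.
  by rewrite (crd_side _ (e2 x) Kq) mulr0 !mul0r.
have [Lq|Lq] := eqVneq (side (star L)) q3; last by rewrite (crd_side _ v3 Lq) mulr0.
rewrite deg0 ?mul0r// [sumn _]/= !bid -!side_star Jq Kq Lq.
by rewrite addn0 addnA.
Qed.

End Sides.

(** * Skew-symmetry and tensoriality of the torsion on one side *)

Section Torsion.
Variables (R : realType) (n r : nat) (M : manifold R n) (A : vbundle M r).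
Local Notation idx := ('I_r + 'I_r)%type.
Implicit Types (c : tidx A) (t : trivz A) (x : M) (e : Esection A) (q : bool).
Implicit Types (U : set M).

Lemma smooth_secN U e : open U -> smooth_sec U e -> smooth_sec U (fun x => - e x).
Proof.
move=> oU se c I; have oc : open (tdom c `&` U).
  by apply: openI => //; exact: tdom_open.
by apply: (smooth_on_ext oc _ (smooth_onN oc (se c I))) => x _; rewrite crdN.
Qed.

Lemma smooth_sec_sub U V e : V `<=` U -> smooth_sec U e -> smooth_sec V e.
Proof.
by move=> VU se c I; apply: smooth_on_sub (se c I) => x [cx /VU].
Qed.

Lemma lie_derN Th t x (v : Efib A x) (f : M -> R) : diff_at t.1 f x ->
  lie_der Th t v (fun y => - f y) = - lie_der Th t v f.
Proof.
by move=> df; rewrite /lie_der -sumrN; apply: eq_bigr => k _; rewrite pdN// mulrN.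
Qed.

Lemma lie_der0 Th t x (v : Efib A x) (f : M -> R) : (forall y, f y = 0) ->
  lie_der Th t v f = 0.
Proof.
move=> f0; rewrite /lie_der big1// => k _.
by rewrite (_ : f = fun=> 0) ?pd_cst ?mulr0//; apply/funext.
Qed.

Lemma diff_at_Epair t x e e' : tzdom t x -> diffs t e x -> diffs t e' x ->
  diff_at t.1 (fun y => Epair (e y) (e' y)) x.
Proof.
move=> [t1 t2] de de'.
have d : diff_at t.1 (fun y => \sum_I crd t.2 (e y) I * crd t.2 (e' y) (star I)) x.
  by apply: diff_at_sum => I; exact: diff_atM.
apply: near_eq_differentiable d.
apply: (near_unchart (P := fun y => \sum_I crd t.2 (e y) I * crd t.2 (e' y) (star I)
  = Epair (e y) (e' y)) (tdom_open t.2) t2 t1) => y _ ty.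
by rewrite (Epair_crd _ _ ty).
Qed.

Lemma smooth_dorf Th t U e e' (e'' : Esection A) :
  open U -> U `<=` tzdom t ->
  (forall w, smooth_on (tzdom t) (fun x => Th t x w)) ->
  smooth_sec U e -> smooth_sec U e' -> smooth_sec U e'' ->
  smooth_on U (fun x => dorf Th t e e' (e'' x)).
Proof.
move=> oU Ut sTh.
have sc e0 I : smooth_sec U e0 -> smooth_on U (fun x => crd t.2 (e0 x) I).
  by move=> se; apply: smooth_on_sub (se t.2 I) => x Ux; split => //; exact: (Ut _ Ux).2.
have sT w : smooth_on U (fun x => Th t x w) by exact: smooth_on_sub Ut (sTh w).
have srho e0 k : smooth_sec U e0 -> smooth_on U (fun x => rho Th t x (crd t.2 (e0 x)) k).
  by move=> se; apply: smooth_on_sum => // J _; apply: smooth_onM => //; exact: sc.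
have sd e0 k I : smooth_sec U e0 -> smooth_on U (fun x => dcrd t e0 x k I).
  by move=> se; apply: smooth_on_pd => //; [move=> x /Ut[]|exact: sc].
have sp k e1 e2 : smooth_sec U e1 -> smooth_sec U e2 ->
    smooth_on U (fun x => pairing (dcrd t e1 x k) (crd t.2 (e2 x))).
  move=> s1 s2; apply: smooth_on_sum => // I _.
  by apply: smooth_onM => //; [exact: sd|exact: sc].
move=> se se' se''; apply: smooth_onD => //; last first.
  apply: smooth_onN => //; do 3! (apply: smooth_on_sum => // ? _).
  by do 3! (apply: smooth_onM => //; try exact: sc).
apply: smooth_on_sum => // k _; apply: smooth_onD => //; last first.
  by apply: smooth_onM => //; [exact: srho|exact: sp].
apply: smooth_onD => //; last apply: smooth_onN => //;
  by apply: smooth_onM => //; [exact: srho|exact: sp].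
Qed.

Variable S : forall x, Efib A x -> Efib A x.
Hypothesis Slin : forall x (a : R) (u v : Efib A x),
  S (a *: u + v) = a *: S u + S v.
Hypothesis Ssmooth : forall U e, open U -> smooth_sec U e ->
  smooth_sec U (fun x => S (e x)).
Hypothesis Sskew : forall x (u v : Efib A x), Epair (S u) v = - Epair u (S v).
Hypothesis Sside : forall q x (v : Efib A x), of_side q v -> of_side (~~ q) (S v).

(** The first three terms of the torsion, with S moved onto [v] by skew-symmetry. The remaining
    term, the plain bracket, is kept apart since on pure arguments it sees another component of the
    structure. *)
Definition tors (Th : gfamily A) t x e e' (v : Efib A x) : R :=
  dorf Th t (fun y => S (e y)) (fun y => S (e' y)) v
  + dorf Th t (fun y => S (e y)) e' (S v) + dorf Th t e (fun y => S (e' y)) (S v).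

Lemma endo0 x : S (0 : Efib A x) = 0.
Proof.
have := Slin 1 (0 : Efib A x) 0; rewrite !scale1r addr0 => /eqP.
by rewrite -subr_eq0 opprD addrA subrr sub0r oppr_eq0 => /eqP.
Qed.

Lemma tors_sumr Th t x e e' (I : finType) (a : I -> R) (v : I -> Efib A x) :
  tors Th t e e' (\sum_i a i *: v i) = \sum_i a i * tors Th t e e' (v i).
Proof.
have SE : S (\sum_i a i *: v i) = \sum_i a i *: S (v i).
  by elim/big_rec2: _ => [|i u w _ <-]; [exact: endo0|exact: Slin].
rewrite /tors SE !dorf_sumr -!big_split; apply: eq_bigr => i _ /=.
by rewrite !mulrDr.
Qed.

Section Skew.
Variables (Th : gfamily A) (t : trivz A) (x : M) (U : set M).
Hypotheses (skewTh : gskew Th) (oU : open U) (Ux : U x) (tx : tzdom t x).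

Let dU e (se : smooth_sec U e) : diffs t e x := smooth_sec_diffs oU Ux tx se.
Let dSU e (se : smooth_sec U e) : diffs t (fun y => S (e y)) x :=
  smooth_sec_diffs oU Ux tx (Ssmooth oU se).

(** The images under S lie in the other side, which is isotropic, so the first term is skew by
    [dorf_sym12]. The symmetric parts of the mixed terms are the derivatives along Sv of <Se,e'> and
    <e,Se'>, which are opposite because S is skew. *)
Lemma tors_skew12 q e e' (v : Efib A x) : smooth_sec U e -> smooth_sec U e' ->
  (forall y, of_side q (e y)) -> (forall y, of_side q (e' y)) ->
  tors Th t e e' v = - tors Th t e' e v.
Proof.
move=> se se' eq eq'; apply/eqP; rewrite -addr_eq0; apply/eqP.
have E1 := dorf_sym12 skewTh v tx (dSU se) (dSU se').
rewrite (lie_der0 Th t v) in E1; last first.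
  by move=> y; apply: (@Epair_side _ _ _ _ _ (~~ q)); exact: Sside.
have E2 := dorf_sym12 skewTh (S v) tx (dSU se) (dU se').
have E3 := dorf_sym12 skewTh (S v) tx (dU se) (dSU se').
rewrite (_ : (fun y => Epair (S (e y)) (e' y)) = fun y => - Epair (e y) (S (e' y))) in E2.
  rewrite lie_derN in E2; last by apply: diff_at_Epair => //; [exact: dU|exact: dSU].
  rewrite -E3 in E2; rewrite /tors; move: E1 E2; lra.
by apply/funext => y; rewrite Sskew.
Qed.

Lemma tors_skew23 q e e' e'' : smooth_sec U e' -> smooth_sec U e'' ->
  (forall y, of_side q (e' y)) -> (forall y, of_side q (e'' y)) ->
  tors Th t e e' (e'' x) = - tors Th t e e'' (e' x).
Proof.
move=> se se' eq eq'; apply/eqP; rewrite -addr_eq0; apply/eqP.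
have E1 := dorf_sym23 skewTh e tx (dSU se) (dSU se').
rewrite (lie_der0 Th t (e x)) in E1; last first.
  by move=> y; apply: (@Epair_side _ _ _ _ _ (~~ q)); exact: Sside.
have E2 := dorf_sym23 skewTh (fun y => S (e y)) tx (dSU se) (dU se').
have E3 := dorf_sym23 skewTh (fun y => S (e y)) tx (dU se) (dSU se').
rewrite (_ : (fun y => Epair (S (e' y)) (e'' y)) = fun y => - Epair (e' y) (S (e'' y))) in E2.
  rewrite lie_derN in E2; last by apply: diff_at_Epair => //; [exact: dU|exact: dSU].
  rewrite -E3 in E2; rewrite /tors; move: E1 E2; lra.
by apply/funext => y; rewrite Sskew.
Qed.


(** Linearity over functions is immediate in the third slot only; skew-symmetry brings the other two
    arguments there in turn. Each exchange requires arguments on one side, hence the separate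
    treatment of frame vectors of the wrong side. *)
Lemma tors_tensor q c e1 e2 e3 : tdom c x -> (forall I, smooth_sec U (eps c I)) ->
  smooth_sec U e1 -> smooth_sec U e2 -> smooth_sec U e3 ->
  (forall y, of_side q (e1 y)) -> (forall y, of_side q (e2 y)) ->
  (forall y, of_side q (e3 y)) ->
  tors Th t e1 e2 (e3 x) = \sum_I \sum_J \sum_K
    crd c (e1 x) I * crd c (e2 x) J * crd c (e3 x) K
      * tors Th t (eps c I) (eps c J) (eps c K x).
Proof.
move=> cx seps s1 s2 s3 q1 q2 q3.
have qeps I : side I = q -> forall y, of_side q (eps c I y).
  by move=> <- y; exact: of_side_eps.
have expand e e' (v : Efib A x) :
    tors Th t e e' v = \sum_K crd c v K * tors Th t e e' (eps c K x).
  by rewrite {1}(crd_decomp v cx) tors_sumr.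
rewrite (expand _ _ (e3 x)) exchange_big /=.
under [RHS]eq_bigr => J _ do rewrite exchange_big /=.
rewrite exchange_big; apply: eq_bigr => K _ /=.
have [Kq|Kq] := eqVneq (side K) q; last first.
  rewrite (crd_side c (q3 x) Kq) mul0r; symmetry.
  by do 2! (apply: big1 => ? _); rewrite mulr0 mul0r.
have qK := qeps _ Kq.
rewrite (tors_skew23 e1 s2 (seps K) q2 qK) expand mulrN mulr_sumr -sumrN.
apply: eq_bigr => J _; have [Jq|Jq] := eqVneq (side J) q; last first.
  rewrite (crd_side c (q2 x) Jq) mul0r mulr0 oppr0; symmetry.
  by apply: big1 => ? _; rewrite mulr0 !mul0r.
have qJ := qeps _ Jq.
rewrite (tors_skew12 _ s1 (seps K) q1 qK) (tors_skew23 _ s1 (seps J) q1 qJ) opprK.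
rewrite expand !mulr_sumr -sumrN; apply: eq_bigr => I _.
have [Iq|Iq] := eqVneq (side I) q; last first.
  by rewrite (crd_side c (q1 x) Iq) !(mulr0, mul0r) oppr0.
have qI := qeps _ Iq.
rewrite (tors_skew12 _ (seps K) (seps J) qK qJ) (tors_skew23 _ (seps K) (seps I) qK qI).
by rewrite (tors_skew12 _ (seps J) (seps I) qJ qI); ring.
Qed.

End Skew.

Lemma tors_change Th t t' x U e e' (v : Efib A x) : open U -> U x ->
  tzdom t x -> tzdom t' x ->
  (forall w, Th t x w = gsubst (gchange t t' x) (Th t' x) w) ->
  (forall g, Th t' x [:: g] = 0) -> gskew Th ->
  smooth_sec U e -> smooth_sec U e' ->
  tors Th t e e' v = tors Th t' e e' v.
Proof.
move=> oU Ux tx tx' glue Th1 sk se se'; rewrite /tors.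
have d s e0 : tzdom s x -> smooth_sec U e0 -> diffs s e0 x.
  by move=> sx s0; exact: smooth_sec_diffs s0.
have dS s e0 : tzdom s x -> smooth_sec U e0 -> diffs s (fun y => S (e0 y)) x.
  by move=> sx s0; apply: d => //; exact: Ssmooth.
by congr (_ + _ + _); apply: dorf_change => //; first [exact: d|exact: dS].
Qed.

End Torsion.

(** * Trivectors and 3-forms defined by torsions *)

Section OddSupport.
Variables (R : realType) (n r : nat) (M : manifold R n) (A : vbundle M r).
Local Notation idx := ('I_r + 'I_r)%type.
Variables (t t' : trivz A) (x : M).
Hypotheses (tx : tzdom t x) (tx' : tzdom t' x).
Local Notation Y := (gchange t t' x).

Definition odd_letter (g : gen n r) : bool := if g is inr _ then true else false.

(** Odd letters change linearly and only momenta produce inhomogeneous terms, so a polynomial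
    without momenta transforms as a tensor. *)
Lemma gsubst_rec_oddS k (u : gpoly R n r) g w :
  (forall l s, u (inl l :: s) = 0) ->
  gsubst_rec k.+1 Y u (g :: w) =
  \sum_I Y (inr I) [:: g] * gsubst_rec k Y (dleft (inr I) u) w.
Proof.
move=> u0; rewrite gsubst_recS sum_gen big1 ?add0r => [|l _]; last first.
  by apply: gmul0r => s; apply: gsubst_rec0 => s'; exact: u0.
by apply: eq_bigr => I _; rewrite gmul_cst// => h s; exact: gchange_odd_long.
Qed.

Lemma gsubst_rec_odd0 m k (u : gpoly R n r) w :
  (forall s, ~~ ((size s == m) && all odd_letter s) -> u s = 0) ->
  ~~ ((size w == m) && all odd_letter w) -> gsubst_rec k Y u w = 0.
Proof.
elim: k m u w => [|k IH] m u [|g w] u0 wm //; [exact: u0|exact: u0|].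
rewrite gsubst_rec_oddS => [|l s]; last by rewrite u0//= andbF.
apply: big1 => I _; rewrite gchange_odd; case: g wm => [l|J] wm; first by rewrite mul0r.
case: m u0 wm => [|m] u0 wm.
  by rewrite gsubst_rec0 ?mulr0// => s; exact: u0.
by rewrite (IH m) ?mulr0// => s sm; exact: u0.
Qed.

Lemma gsubst_odd3 (u : gpoly R n r) J K L :
  (forall s, ~~ all odd_letter s -> u s = 0) ->
  gsubst Y u [:: inr J; inr K; inr L] =
  \sum_P \sum_Q \sum_T crd t.2 (eps t'.2 P x) J * crd t.2 (eps t'.2 Q x) K *
    crd t.2 (eps t'.2 T x) L * u [:: inr P; inr Q; inr T].
Proof.
move=> u0; rewrite /gsubst gsubst_rec_oddS => [|l s]; last exact: u0.
apply: eq_bigr => P _.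
rewrite gsubst_rec_oddS => [|l s]; last exact: u0.
rewrite mulr_sumr; apply: eq_bigr => Q _.
rewrite gsubst_rec_oddS => [|l s]; last exact: u0.
rewrite !mulr_sumr; apply: eq_bigr => T _.
by rewrite !gchange_odd // !mulrA.
Qed.

End OddSupport.

Section TorsionForm.
Variables (R : realType) (n r : nat) (M : manifold R n) (A : vbundle M r).
Local Notation idx := ('I_r + 'I_r)%type.
Implicit Types (c : tidx A) (t : trivz A) (x : M) (e : Esection A).

(** A single letter has total degree 1 or 2. This removes the terms of the chain rule in which the
    substitution itself is differentiated to the full order. *)
Lemma gfunction_letter k l (Th : gfamily A) t x g : (k + l = 3)%N ->
  gfunction k l Th -> tzdom t x -> Th t x [:: g] = 0.
Proof.
move=> kl [_ _ deg _] tx; apply: contrapT => /(deg _ _ _ tx)[/= dk dl].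
by move: kl; rewrite -dk -dl; case: g {dk dl} => [|[]].
Qed.

Variable S : forall x, Efib A x -> Efib A x.
Hypothesis Slin : forall x (a : R) (u v : Efib A x),
  S (a *: u + v) = a *: S u + S v.
Hypothesis Ssmooth : forall (U : set M) e, open U -> smooth_sec U e ->
  smooth_sec U (fun x => S (e x)).
Hypothesis Sskew : forall x (u v : Efib A x), Epair (S u) v = - Epair u (S v).
Hypothesis Sside : forall q x (v : Efib A x), of_side q v -> of_side (~~ q) (S v).

Variables (k l : nat) (Th : gfamily A) (q : bool).
Hypotheses (kl : (k + l = 3)%N) (gTh : gfunction k l Th).

Let skewTh : gskew Th. Proof. by case: gTh. Qed.

(* The coefficient of a word is the value on the dual frame, whence [star]; the
   letters dual to the side [q] are those of the other side. *)
Definition tors_form : gfamily A := fun t x w =>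
  match w with
  | [:: inr J; inr K; inr L] =>
      if [&& side J != q, side K != q & side L != q] then
        - tors S Th t (eps t.2 (star J)) (eps t.2 (star K)) (eps t.2 (star L) x)
      else 0
  | _ => 0
  end.

Lemma tors_form0 t x w : ~~ ((size w == 3%N) && all (@odd_letter n r) w) ->
  tors_form t x w = 0.
Proof.
by case: w => [|[?|?] [|[?|?] [|[?|?] [|? ?]]]].
Qed.

Lemma eps_side c I : side I != q -> forall y, of_side q (eps c (star I) y).
Proof.
move=> Iq y; have <- : side (star I) = q; last exact: of_side_eps.
by rewrite side_star; case: (side I) (q) Iq => [] [].
Qed.

Lemma smooth_eps_tz t I : smooth_sec (tzdom t) (eps t.2 I).
Proof. by apply: smooth_sec_sub (smooth_eps _ _) => x []. Qed.

Lemma open_tzdom t : open (tzdom t).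
Proof. by apply: openI; [exact: cdom_open|exact: tdom_open]. Qed.

Lemma tors_form_swap t x s g h s' : tzdom t x ->
  tors_form t x (s ++ g :: h :: s') =
  (-1) ^+ (odd_gen g && odd_gen h) * tors_form t x (s ++ h :: g :: s').
Proof.
move=> tx.
have z w : ~~ ((size w == 3%N) && all (@odd_letter n r) w) ->
  tors_form t x w = 0 by exact: tors_form0.
have [sz|sz] := eqVneq (size (s ++ g :: h :: s')) 3%N; last first.
  have sz' : size (s ++ h :: g :: s') != 3%N.
    by apply: contra_neq sz => <-; rewrite !size_cat.
  by rewrite !z ?mulr0// ?(negbTE sz) ?(negbTE sz').
have [od|od] := boolP (all (@odd_letter n r) (s ++ g :: h :: s')); last first.
  have od' : ~~ all (@odd_letter n r) (s ++ h :: g :: s').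
    by move: od; rewrite !all_cat /= (andbCA (odd_letter h)).
  rewrite (z (s ++ g :: h :: s')) ?(z (s ++ h :: g :: s')) ?mulr0//.
    by rewrite (negbTE od') andbF.
  by rewrite (negbTE od) andbF.
have oT := @open_tzdom t.
have sm I := smooth_eps_tz t I.
(* In a word of three letters an adjacent transposition moves the first two or the last two:
   [tors_skew12] and [tors_skew23] respectively. *)
case: s sz od {z} => [|I [|I' s]]; last by rewrite /= size_cat /= !addnS.
  case: g => [?|J] //; case: h => [?|K] //.
  case: s' => [|[?|L] [|? s']] //= _ _.
  rewrite !odd_gen_inr expr1 mulN1r.
  case: ifPn => [/and3P[Jq Kq Lq]|]; last first.
    by case: ifPn => [/and3P[-> -> ->]|] //; rewrite oppr0.
  rewrite Kq Jq Lq /= opprK.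
  by rewrite (tors_skew12 Ssmooth Sskew Sside skewTh oT tx tx (q := q)) ?opprK//;
    exact: eps_side.
case: I => [?|I] //; case: g => [?|J] //; case: h => [?|K] //.
case: s' => [|? ?] //= _ _.
  rewrite !odd_gen_inr expr1 mulN1r.
  case: ifPn => [/and3P[Jq Kq Lq]|]; last first.
    by case: ifPn => [/and3P[-> -> ->]|] //; rewrite oppr0.
  rewrite Kq Jq Lq /= opprK.
  by rewrite (tors_skew23 Ssmooth Sskew Sside skewTh oT tx tx (q := q)) ?opprK//;
    exact: eps_side.
Qed.

(** Gluing combines two facts: the torsion does not depend on the trivialization ([tors_change]),
    and over the overlap it can be expanded in the other frame ([tors_tensor]). *)
Lemma gfunction_tors_form :
  gfunction (if q then 0 else 3) (if q then 3 else 0) tors_form.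
Proof.
have [sTh _ _ glueTh] := gTh.
split.
- move=> t w; have oT := @open_tzdom t.
  have s0 : smooth_on (tzdom t) (fun=> 0 : R) by exact: smooth_on_cst.
  have sm I := smooth_eps_tz t I.
  have sS I : smooth_sec (tzdom t) (fun y => S (eps t.2 I y)) by exact: Ssmooth.
  case: w => [|[?|J] [|[?|K] [|[?|L] [|? ?]]]]; rewrite /tors_form //.
  case: [&& side J != q, side K != q & side L != q] => //; apply: smooth_onN => //.
  apply: smooth_onD => //; last exact: smooth_dorf (sTh t) _ _ _.
  by apply: smooth_onD => //; exact: smooth_dorf (sTh t) _ _ _.
- by move=> t x s g h s'; exact: tors_form_swap.
- move=> t x w _; case: w => [|[?|J] [|[?|K] [|[?|L] [|? ?]]]] //=.
  by case: ifPn => // /and3P[]; case: J; case: K; case: L; case: (q).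
move=> t t' x w tx tx'.
have [w3|w3] := boolP ((size w == 3%N) && all (@odd_letter n r) w); last first.
  rewrite tors_form0// /gsubst (@gsubst_rec_odd0 _ _ _ _ _ t t' x 3)// => s.
  exact: tors_form0.
case: w w3 => [|[?|J] [|[?|K] [|[?|L] [|? ?]]]] // _.
rewrite gsubst_odd3// => [|s sn]; last by rewrite tors_form0// (negbTE sn) andbF.
have tm_side P I : side P != side I -> crd t.2 (eps t'.2 P x) I = 0.
  by move=> PI; apply: crd_side (of_side_eps _ _ _) _; rewrite eq_sym.
pose U := tdom t.2 `&` tdom t'.2.
have oU : open U by apply: openI; exact: tdom_open.
have Ux : U x by split; [exact: tx.2|exact: tx'.2].
have sm I : smooth_sec U (eps t.2 I).
  by apply: smooth_sec_sub (smooth_eps _ _) => y [].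
have sm' I : smooth_sec U (eps t'.2 I).
  by apply: smooth_sec_sub (smooth_eps _ _) => y [].
(* Preservation of the pairing: the inverse transition matrix is the transpose with [star] applied
   to both indices. *)
have coef I P : crd t'.2 (eps t.2 (star I) x) (star P) = crd t.2 (eps t'.2 P x) I.
  rewrite -(pairing_eps (eps t.2 (star I) x) P tx.2 tx'.2) pairingC.
  by rewrite (pairing_eps _ _ tx.2 tx.2) starK.
transitivity (\sum_P \sum_Q \sum_T - (crd t.2 (eps t'.2 P x) J *
    crd t.2 (eps t'.2 Q x) K * crd t.2 (eps t'.2 T x) L *
    (if [&& side J != q, side K != q & side L != q] then
    tors S Th t' (eps t'.2 (star P)) (eps t'.2 (star Q)) (eps t'.2 (star T) x) else 0))).
  rewrite {1}/tors_form; case: ifPn => [/and3P[Jq Kq Lq]|_]; last first.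
    by symmetry; do 3! (apply: big1 => ? _); rewrite mulr0 oppr0.
  rewrite (tors_change Ssmooth _ oU Ux tx tx' _ _ skewTh)//; last first.
  - by move=> g; exact: gfunction_letter gTh tx'.
  - by move=> s; exact: glueTh.
  rewrite (tors_tensor Slin Ssmooth Sskew Sside skewTh oU Ux tx' tx'.2 sm'
    (sm (star J)) (sm (star K)) (sm (star L)) (q := q));
    try exact: eps_side.
  rewrite -sumrN -sum_star; apply: eq_bigr => P _.
  rewrite -sumrN -sum_star; apply: eq_bigr => Q _.
  rewrite -sumrN -sum_star; apply: eq_bigr => T _.
  by rewrite !coef.
do 3! (apply: eq_bigr => ? _).
rewrite -mulrN; set P := (X in crd _ (eps _ X _) J); set Q := (X in crd _ (eps _ X _) K).
set T := (X in crd _ (eps _ X _) L).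
have [PJ|/tm_side->] := eqVneq (side P) (side J); last by rewrite !mul0r.
have [QK|/tm_side->] := eqVneq (side Q) (side K); last by rewrite mulr0 !mul0r.
have [TL|/tm_side->] := eqVneq (side T) (side L); last by rewrite mulr0 !mul0r.
congr (_ * _); rewrite /tors_form PJ QK TL.
by case: ifP; rewrite ?oppr0.
Qed.

(** The minus sign in [tors_form] cancels the one in front of [tri]. There are no momenta, so [rho]
    vanishes, and both sides are determined by their values on the frame. *)
Lemma dorf_tors_form t x (U : set M) e1 e2 e3 : open U -> U x -> tzdom t x ->
  smooth_sec U e1 -> smooth_sec U e2 -> smooth_sec U e3 ->
  (forall y, of_side q (e1 y)) -> (forall y, of_side q (e2 y)) ->
  (forall y, of_side q (e3 y)) ->
  dorf tors_form t e1 e2 (e3 x) = tors S Th t e1 e2 (e3 x).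
Proof.
move=> oU Ux tx s1 s2 s3 q1 q2 q3.
pose V := U `&` tdom t.2.
have oV : open V by apply: openI => //; exact: tdom_open.
have sV e : smooth_sec U e -> smooth_sec V e by apply: smooth_sec_sub => y [].
have sm I : smooth_sec V (eps t.2 I).
  by apply: smooth_sec_sub (smooth_eps _ _) => y [].
rewrite (tors_tensor Slin Ssmooth Sskew Sside skewTh oV (conj Ux tx.2) tx tx.2 sm
  (sV _ s1) (sV _ s2) (sV _ s3) q1 q2 q3).
rewrite /dorf big1 => [|m _]; last first.
  have rho0 (u : idx -> R) : rho tors_form t x u m = 0.
    by apply: big1 => I _; rewrite mul0r.
  by rewrite !rho0 !mul0r subr0 addr0.
rewrite sub0r /tri -sumrN -[RHS]sum_star; apply: eq_bigr => J _.
rewrite -sumrN -[RHS]sum_star; apply: eq_bigr => K _.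
rewrite -sumrN -[RHS]sum_star; apply: eq_bigr => L _.
rewrite [tors_form _ _ _]/=.
have sideE I : (side I != q) = (side (star I) == q).
  by rewrite side_star; case: (side I) (q) => [] [].
rewrite !sideE.
have [Jq|Jq] := eqVneq (side (star J)) q; last first.
  by rewrite (crd_side t.2 (q1 x) Jq) !(mulr0, mul0r) oppr0.
have [Kq|Kq] := eqVneq (side (star K)) q; last first.
  by rewrite (crd_side t.2 (q2 x) Kq) !(mulr0, mul0r) oppr0.
have [Lq|Lq] := eqVneq (side (star L)) q; last first.
  by rewrite (crd_side t.2 (q3 x) Lq) !(mulr0, mul0r) oppr0.
by rewrite /=; ring.
Qed.

End TorsionForm.

(** * The endomorphisms of a 2-form and a bivector *)

Section Endomorphisms.
Variables (R : realType) (n r : nat) (M : manifold R n).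

Section Forms.
Variables (V : vbundle M r) (om : form2 V).

Lemma form_linr x (w : V x) (a : R) (u v : V x) :
  om x w (a *: u + v) = a * om x w u + om x w v.
Proof.
by rewrite form_skew form_linear [om x w u]form_skew [om x w v]form_skew; ring.
Qed.

Lemma form0l x (w : V x) : om x 0 w = 0.
Proof.
have := form_linear om 1 0 0 w.
by rewrite scaler0 addr0 mul1r => /eqP; rewrite -subr_eq0 opprD addNKr oppr_eq0 => /eqP.
Qed.

Lemma form_suml x (I : finType) (a : I -> R) (u : I -> V x) (w : V x) :
  om x (\sum_i a i *: u i) w = \sum_i a i * om x (u i) w.
Proof.
by elim/big_rec2: _ => [|i s v _ <-]; [exact: form0l|exact: form_linear].
Qed.

Lemma flatE x (X Y : V x) : (flat om X : dual_fib V x) Y = om x X Y.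
Proof.
have lin : linear (om x X : V x -> R^o) by move=> a u v; exact: form_linr.
(* [linfun] of a bare function agrees with it only when the function is linear, so the linear
   structure is supplied here. *)
pose F : {linear V x -> R^o} :=
  HB.pack (om x X : V x -> R^o) (GRing.isLinear.Build _ _ _ _ _ lin).
exact: (lfunE F Y).
Qed.

Lemma flat_lin x (a : R) (u v : V x) :
  flat om (a *: u + v) = a *: (flat om u : dual_fib V x) + flat om v.
Proof.
apply/lfunP => Y; rewrite add_lfunE scale_lfunE.
rewrite [LHS]flatE [X in _ = _ *: X + _]flatE [X in _ = _ + X]flatE.
exact: form_linear.
Qed.

End Forms.

Variable A : vbundle M r.

(** The value picked by [xget] has the defining property as soon as some vector has it; contracting
    [pi] with a local frame provides one. *)
Lemma sharpE (pi : form2 (dual A)) x (al be : dual_fib A x) :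
  be (sharp pi (al : dual A x)) = pi x al be.
Proof.
have [c cx] := tdom_cover A x.
suff : exists X : A x, forall be : dual_fib A x, be X = pi x al be.
  move=> ex; rewrite /sharp; case: xgetP => [X _|]; first by apply.
  by case: ex => X HX /(_ X) /= [].
exists (\sum_(a < r) pi x al (tnth (dual_frame c x) a) *: tnth (frame c x) a).
move=> {}be; rewrite linear_sum /= [in RHS](dual_frame_sum be cx).
rewrite [RHS]form_skew form_suml -sumrN; apply: eq_bigr => a _.
by rewrite linearZ /= [X in X *: _ = _]form_skew [LHS]mulrC -mulrN.
Qed.

Lemma dual_sep x (u v : A x) : (forall be : dual_fib A x, be u = be v) -> u = v.
Proof.
move=> uv; have [c cx] := tdom_cover A x.
rewrite (coord_basis (frame_basis cx) (memvf u)).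
rewrite (coord_basis (frame_basis cx) (memvf v)).
by apply: eq_bigr => a _; rewrite -!dual_frameE uv.
Qed.

Lemma sharp_lin (pi : form2 (dual A)) x (a : R) (u v : dual A x) :
  sharp pi (a *: u + v) = a *: sharp pi u + sharp pi v.
Proof.
apply: dual_sep => be; rewrite linearP /= !sharpE.
exact: form_linear.
Qed.

Variables (om : 'Z_3 -> form2 A) (pi : 'Z_3 -> form2 (dual A)).
Local Notation S i := (@Smat R n M r A om pi i _).
Implicit Types (e : Esection A) (U : set M).

Lemma flat0 i x : flat (om i) (0 : A x) = 0.
Proof. by apply/lfunP => Y; rewrite [LHS]flatE form0l zero_lfunE. Qed.

Lemma sharp0 i x : sharp (pi i) (0 : dual A x) = 0.
Proof. by apply: dual_sep => be; rewrite sharpE form0l linear0. Qed.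

Lemma Smat_lin i x (a : R) (u v : Efib A x) : S i (a *: u + v) = a *: S i u + S i v.
Proof.
by rewrite /Smat /= sharp_lin flat_lin opprD -scalerN.
Qed.

Lemma Smat_skew i x (u v : Efib A x) : Epair (S i u) v = - Epair u (S i v).
Proof.
rewrite /Epair /= !linearN /=.
rewrite [X in X + _ = _]flatE [X in _ + - X = _]sharpE.
rewrite [X in _ = - (- X + _)]sharpE [X in _ = - (_ + X)]flatE.
by rewrite [om i x v.1 u.1]form_skew [pi i x v.2 u.2]form_skew; ring.
Qed.

Lemma Smat_side i q x (v : Efib A x) : of_side q v -> of_side (~~ q) (S i v).
Proof. by case: q => /= v0; rewrite v0 ?sharp0 ?oppr0 ?flat0. Qed.

Lemma Smat_smooth i U e : open U -> smooth_sec U e -> smooth_sec U (fun x => S i (e x)).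
Proof.
move=> oU se c [] b; have oc : open (tdom c `&` U);
    try by apply: openI => //; exact: tdom_open.
  apply: (@smooth_on_ext _ _ _ _ (fun x => \sum_(a < r) crd c (e x) (inr a) *
    om i x (tnth (frame c x) a) (tnth (frame c x) b))) => //.
    move=> x [cx _] /=; rewrite flatE.
    rewrite {2}(coord_basis (frame_basis cx) (memvf (e x).1)) form_suml.
    by apply: eq_bigr => a _; rewrite (tnth_nth 0).
  apply: smooth_on_sum => // a _; apply: smooth_onM => //.
  by apply: smooth_on_sub (form_smooth _ _ _ _) => x [].
apply: (@smooth_on_ext _ _ _ _ (fun x => - \sum_(a < r) crd c (e x) (inl a) *
  pi i x (tnth (dual_frame c x) a) (tnth (dual_frame c x) b))) => //.
  move=> x [cx _] /=; rewrite linearN /= -dual_frameE sharpE.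
  by rewrite {2}(dual_frame_sum (e x).2 cx) form_suml.
apply: smooth_onN => //; apply: smooth_on_sum => // a _; apply: smooth_onM => //.
by apply: smooth_on_sub (@form_smooth _ _ _ _ _ (pi i) c a b) => x [].
Qed.

Lemma smooth_EsectionP e : smooth_Esection e <-> smooth_sec setT e.
Proof.
split=> [[s1 s2] c [] a|se]; first 1 last.
- by apply: smooth_on_sub (s1 c a) => x [].
- split=> c a.
    by apply: smooth_on_sub (se c (inr a)) => x; split.
  suff h (c' : tidx A) : smooth_on (tdom c')
      (fun x => coord (dual_frame c' x) a ((e x).2 : dual_fib A x)) by exact: h c.
  apply: (@smooth_on_ext _ _ _ _ (fun x => crd c' (e x) (inl a))).
  + exact: tdom_open.
  + by move=> x cx; rewrite [RHS]dual_coord.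
  + by apply: smooth_on_sub (se c' (inl a)) => x; split.
- apply: (@smooth_on_ext _ _ _ _ (fun x => coord (dual_frame c x) a (e x).2)).
  + by apply: openI; [exact: tdom_open|exact: openT].
  + by move=> x [cx _]; rewrite dual_coord.
  + by apply: smooth_on_sub (s2 c a) => x [].
Qed.

End Endomorphisms.

(** * Vanishing of the Nijenhuis torsion *)

Section AlmostComplex.
Variables (R : realType) (n r : nat) (M : manifold R n) (A : vbundle M r).
Implicit Types (e : Esection A) (t : trivz A) (x : M) (Th : gfamily A) (q : bool).

Lemma Epair_lin x (a : R) (u v w : Efib A x) :
  Epair (a *: u + v) w = a * Epair u w + Epair v w.
Proof.
rewrite /Epair /= linearP /= add_lfunE scale_lfunE.
by rewrite /GRing.scale /=; ring.
Qed.

Lemma EpairC x (u v : Efib A x) : Epair u v = Epair v u.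
Proof. by rewrite /Epair addrC. Qed.

Lemma EpairDl x (u v w : Efib A x) : Epair (u + v) w = Epair u w + Epair v w.
Proof. by rewrite -[u]scale1r Epair_lin mul1r scale1r. Qed.

Lemma Epair0l x (w : Efib A x) : Epair 0 w = 0.
Proof. by rewrite /Epair /= zero_lfunE linear0 addr0. Qed.

Lemma EpairNl x (u w : Efib A x) : Epair (- u) w = - Epair u w.
Proof. by rewrite -scaleN1r -[-1 *: u]addr0 Epair_lin Epair0l addr0 mulN1r. Qed.

Lemma Epair_inj x (u v : Efib A x) : (forall w, Epair u w = Epair v w) -> u = v.
Proof.
move=> uv; have [c cx] := tdom_cover A x.
have crdE (w : Efib A x) I : crd c w I = Epair w (eps c (star I) x).
  by rewrite (Epair_crd _ _ cx) pairingC (pairing_eps _ _ cx cx) starK.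
by apply: (crd_inj cx) => I; rewrite !crdE uv.
Qed.

Lemma dorf_gadd (Th Th' : gfamily A) t x e e' (v : Efib A x) :
  dorf (gadd Th Th') t e e' v = dorf Th t e e' v + dorf Th' t e e' v.
Proof.
have rhoE (u : 'I_r + 'I_r -> R) k :
    rho (gadd Th Th') t x u k = rho Th t x u k + rho Th' t x u k.
  by rewrite /rho -big_split; apply: eq_bigr => J _; rewrite mulrDl.
rewrite /dorf addrACA -opprD -big_split /=; congr (_ - _).
  by apply: eq_bigr => k _; rewrite !rhoE; ring.
rewrite /tri -big_split; apply: eq_bigr => J _ /=.
rewrite -big_split; apply: eq_bigr => K _ /=.
by rewrite -big_split; apply: eq_bigr => L _ /=; rewrite /gadd; ring.
Qed.

Lemma gskew_gadd (Th Th' : gfamily A) : gskew Th -> gskew Th' -> gskew (gadd Th Th').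
Proof. by move=> s s' t x w g h w' tx; rewrite /gadd s// s'// mulrDr. Qed.

Lemma anchor_lie_der Th e f x :
  anchor (courant Th) e f x = lie_der Th (triv_at A x) (e x) f.
Proof. exact: anchor_courant. Qed.

Variable S : forall x, Efib A x -> Efib A x.
Hypothesis Slin : forall x (a : R) (u v : Efib A x),
  S (a *: u + v) = a *: S u + S v.
Hypothesis Ssmooth : forall (U : set M) e, open U -> smooth_sec U e ->
  smooth_sec U (fun x => S (e x)).
Hypothesis Sskew : forall x (u v : Efib A x), Epair (S u) v = - Epair u (S v).

Lemma smooth_diffs t e x : tzdom t x -> smooth_sec setT e -> diffs t e x.
Proof. by move=> tx se; apply: smooth_sec_diffs tx se => //; exact: openT. Qed.

Lemma Ssmooth_diffs t e x : tzdom t x -> smooth_sec setT e ->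
  diffs t (fun y => S (e y)) x.
Proof. by move=> tx se; apply: smooth_diffs => //; apply: Ssmooth => //; exact: openT. Qed.

(* the Lie algebroid differential of the 2-form attached to [S], in terms of the
   Dorfman bracket *)
Definition cyc Th t x (a b c : Esection A) : R :=
  dorf Th t a b (S (c x)) + dorf Th t a (fun y => S (b y)) (c x)
  + dorf Th t (fun y => S (a y)) b (c x).

(** * The differential of a 2-form as a sum of three brackets *)

Section Differential.
Variables (V : vbundle M r) (L : anchored M (section V)) (om : form2 V).
Variables (j : section V -> Esection A) (Th : gfamily A).
Hypothesis skewTh : gskew Th.
Hypothesis jsmooth : forall X, smooth_section X -> smooth_sec setT (j X).
Hypothesis jform : forall X Y y, om y (X y) (Y y) = Epair (S (j X y)) (j Y y).
Hypothesis janchor : forall X f x,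
  anchor L X f x = lie_der Th (triv_at A x) (j X x) f.
Hypothesis jbracket : forall X Y Z x, om x (bracket L X Y x) (Z x) =
  - dorf Th (triv_at A x) (j X) (j Y) (S (j Z x)).

(** In the six-term formula the pre-Courant identities expand the three anchor terms; after
    cancellation there remain the brackets with S in exactly one slot. The embedding [j] is left
    abstract to serve A with S and the dual with -S. *)
Lemma diff2_cyc X Y Z x : smooth_section X -> smooth_section Y -> smooth_section Z ->
  diff2 L om X Y Z x = cyc Th (triv_at A x) x (j X) (j Y) (j Z).
Proof.
move=> /jsmooth sX /jsmooth sY /jsmooth sZ; rewrite /diff2 !jbracket !janchor.
have tx := triv_at_dom A x; set t := triv_at A x in tx *.
have d e : smooth_sec setT e -> diffs t e x by exact: smooth_diffs.
have dS e : smooth_sec setT e -> diffs t (fun y => S (e y)) x by exact: Ssmooth_diffs.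
have formE X' Y' : (fun y => om y (X' y) (Y' y)) = fun y => Epair (S (j X' y)) (j Y' y).
  by apply/funext => y; exact: jform.
rewrite !formE /cyc.
have E1 := dorf_sym23 skewTh (j X) tx (dS _ sY) (d _ sZ).
have E2 := dorf_sym23 skewTh (j Y) tx (dS _ sX) (d _ sZ).
have E3 := dorf_sym12 skewTh (j Z x) tx (dS _ sX) (d _ sY).
by rewrite -E1 -E2 -E3; ring.
Qed.

End Differential.

Hypothesis SS : forall x (v : Efib A x), S (S v) = - v.

Lemma app_SS e : (fun y => S (S (e y))) = fun y => - e y.
Proof. by apply: functional_extensionality_dep => y; exact: SS. Qed.

Lemma endoN x (v : Efib A x) : S (- v) = - S v.
Proof. by rewrite -!SS. Qed.

(** In every term S^2 = -1 occurs in exactly two slots, so the signs cancel. *)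
Lemma tors_cyc Th x t (a b c : Esection A) : tzdom t x ->
  smooth_sec setT a -> smooth_sec setT b -> smooth_sec setT c ->
  tors S Th t (fun y => S (a y)) (fun y => S (b y)) (S (c x)) = cyc Th t x a b c.
Proof.
move=> tx sa sb sc; rewrite /tors /cyc !app_SS !SS.
have d e : smooth_sec setT e -> diffs t e x by exact: smooth_diffs.
have dS e : smooth_sec setT e -> diffs t (fun y => S (e y)) x by exact: Ssmooth_diffs.
have sN e : smooth_sec setT e -> smooth_sec setT (fun y => - e y).
  by apply: smooth_secN; exact: openT.
rewrite !dorfNr !dorfNl ?dorfNm ?opprK//; by [exact: d|exact: dS|apply: d; exact: sN].
Qed.

Lemma endoD x (u v : Efib A x) : S (u + v) = S u + S v.
Proof. by rewrite -[u]scale1r Slin !scale1r. Qed.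

(** Each term of [tors] arises twice. The plain bracket arises three times with the sign of S^2:
    once from either argument and once from the value. *)
Lemma Epair_bracket_deform2 Th e e' x (v : Efib A x) : gskew Th ->
    smooth_sec setT e -> smooth_sec setT e' ->
  Epair (bracket (deform (deform (courant Th) S) S) e e' x) v =
  2 * tors S Th (triv_at A x) e e' v - 3 * dorf Th (triv_at A x) e e' v.
Proof.
move=> sk se se'; have tx := triv_at_dom A x.
rewrite /deform; cbn [bracket]; set B := bracket (courant Th).
have BE a b (w : Efib A x) : Epair (B a b x) w = dorf Th (triv_at A x) a b w.
  exact: Epair_bracket.
rewrite !(EpairDl, EpairNl, Sskew, BE, SS, app_SS, endoN).
rewrite !(dorfNl, dorfNm, dorfNr); try exact: smooth_diffs.
rewrite /tors; ring.
Qed.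

Lemma oppositeP Th : gskew Th ->
  opposite (deform (deform (courant Th) S) S) (courant Th) <->
  forall e e', smooth_sec setT e -> smooth_sec setT e' -> forall x (v : Efib A x),
    tors S Th (triv_at A x) e e' v = dorf Th (triv_at A x) e e' v.
Proof.
move=> sk; split=> [[_ op] e e' se se' x v|H].
  have := op e e' ((smooth_EsectionP e).2 se) ((smooth_EsectionP e').2 se') x.
  move=> /(congr1 (fun u => Epair u v)).
  rewrite Epair_bracket_deform2// EpairNl Epair_bracket//; lra.
split=> [e f _ _ x|e e' /smooth_EsectionP se /smooth_EsectionP se' x].
  rewrite [anchor (deform _ _) _ _ _]/= -[LHS]/(anchor (courant Th) _ f x).
  rewrite !anchor_lie_der SS /lie_der -sumrN; apply: eq_bigr => k _.
  by rewrite crdNE rhoN mulNr.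
apply: Epair_inj => v; rewrite Epair_bracket_deform2// EpairNl Epair_bracket// H//.
by ring.
Qed.

(** * From one-sided arguments to arbitrary ones *)

Section Vanishing.
Variables (Th : gfamily A).

Definition nijenhuis x e e' (v : Efib A x) : R :=
  tors S Th (triv_at A x) e e' v - dorf Th (triv_at A x) e e' v.

Lemma nijenhuisS1 x e e' (v : Efib A x) : smooth_sec setT e -> smooth_sec setT e' ->
  nijenhuis (fun y => S (e y)) e' v = nijenhuis e e' (S v).
Proof.
move=> se se'; have tx := triv_at_dom A x.
rewrite /nijenhuis /tors !(SS, app_SS) !(dorfNl, dorfNr);
  try exact: smooth_diffs.
ring.
Qed.

Lemma nijenhuisS2 x e e' (v : Efib A x) : smooth_sec setT e -> smooth_sec setT e' ->
  nijenhuis e (fun y => S (e' y)) v = nijenhuis e e' (S v).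
Proof.
move=> se se'; have tx := triv_at_dom A x.
rewrite /nijenhuis /tors !(SS, app_SS) !(dorfNm, dorfNr);
  try exact: smooth_diffs.
ring.
Qed.

Lemma nijenhuisNr x e e' (v : Efib A x) : nijenhuis e e' (- v) = - nijenhuis e e' v.
Proof. by rewrite /nijenhuis /tors endoN !dorfNr; ring. Qed.

Lemma nijenhuisDr x e e' (u v : Efib A x) :
  nijenhuis e e' (u + v) = nijenhuis e e' u + nijenhuis e e' v.
Proof.
have D a b (u' v' : Efib A x) : dorf Th (triv_at A x) a b (u' + v') =
    dorf Th (triv_at A x) a b u' + dorf Th (triv_at A x) a b v'.
  by rewrite -[u']scale1r dorf_lin mul1r scale1r.
by rewrite /nijenhuis /tors endoD !D; ring.
Qed.

Lemma app_add e e' : (fun y => S (e y + e' y)) = fun y => S (e y) + S (e' y).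
Proof. by apply: functional_extensionality_dep => y; exact: endoD. Qed.

Lemma nijenhuisDl x e1 e2 e' (v : Efib A x) :
    smooth_sec setT e1 -> smooth_sec setT e2 ->
  nijenhuis (fun y => e1 y + e2 y) e' v = nijenhuis e1 e' v + nijenhuis e2 e' v.
Proof.
move=> s1 s2; have tx := triv_at_dom A x.
rewrite /nijenhuis /tors !app_add !dorfDl; try exact: smooth_diffs;
  try exact: Ssmooth_diffs.
ring.
Qed.

Lemma nijenhuisDm x e e1 e2 (v : Efib A x) :
    smooth_sec setT e1 -> smooth_sec setT e2 ->
  nijenhuis e (fun y => e1 y + e2 y) v = nijenhuis e e1 v + nijenhuis e e2 v.
Proof.
move=> s1 s2; have tx := triv_at_dom A x.
rewrite /nijenhuis /tors !app_add !dorfDr; try exact: smooth_diffs;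
  try exact: Ssmooth_diffs.
ring.
Qed.

Definition part q e : Esection A :=
  fun y => if q then ((e y).1, 0) else (0, (e y).2).

Lemma of_side_part q e y : of_side q (part q e y).
Proof. by case: q. Qed.

Lemma part_sum e : e = fun y => part true e y + part false e y.
Proof.
apply: functional_extensionality_dep => y; rewrite /part.
by case: (e y) => u w; congr (_, _); rewrite /= ?addr0 ?add0r.
Qed.

Lemma smooth_part q e : smooth_sec setT e -> smooth_sec setT (part q e).
Proof.
move=> se c I; have oc : open (tdom c `&` setT : set M).
  by apply: openI; [exact: tdom_open|exact: openT].
have [Iq|Iq] := eqVneq (side I) q.
  apply: (smooth_on_ext oc _ (se c I)) => x _.
  by rewrite /part -Iq; case: (I).
apply: (smooth_on_ext oc _ (smooth_on_cst 0 oc)) => x _.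
by rewrite (crd_side c (of_side_part q e x) Iq).
Qed.

Lemma smooth_section_of_side q x (v : Efib A x) : of_side q v ->
  exists e, [/\ smooth_sec setT e, forall y, of_side q (e y) & e x = v].
Proof.
have [s1 [ss1 s1v]] := smooth_section_through v.1.
have [s2 [ss2 s2v]] := @smooth_section_through _ _ _ _ (dual A) x v.2.
pose e : Esection A := fun y => (s1 y, s2 y).
have se : smooth_sec setT e by apply/smooth_EsectionP; split.
move=> vq; exists (part q e); split; [exact: smooth_part|exact: of_side_part|].
rewrite /part /e s1v s2v; move: vq.
by case: q; case: (v) => v1 v2 /= ->.
Qed.

Hypothesis Sside : forall q x (v : Efib A x), of_side q v -> of_side (~~ q) (S v).
Hypothesis vanish : forall q a b c x, smooth_sec setT a -> smooth_sec setT b ->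
  smooth_sec setT c -> (forall y, of_side q (a y)) -> (forall y, of_side q (b y)) ->
  (forall y, of_side q (c y)) -> nijenhuis a b (c x) = 0.

(* Applying [S] exchanges the two sides and moves freely between the three slots,
   up to sign, so the pure components determine the mixed ones. *)
Lemma nijenhuis0 x e e' (v : Efib A x) : smooth_sec setT e -> smooth_sec setT e' ->
  nijenhuis e e' v = 0.
Proof.
have oT := @openT M.
have vanishv q a b (w : Efib A x) : smooth_sec setT a -> smooth_sec setT b ->
    (forall y, of_side q (a y)) -> (forall y, of_side q (b y)) -> of_side q w ->
    nijenhuis a b w = 0.
  move=> sa sb qa qb /smooth_section_of_side[c [sc qc <-]].
  exact: (vanish (q := q)).
have splitv (w : Efib A x) : w = (w.1, 0) + (0, w.2) :> Efib A x.
  by case: w => w1 w2; congr (_, _); rewrite /= ?addr0 ?add0r.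
have same q a b w : smooth_sec setT a -> smooth_sec setT b ->
    (forall y, of_side q (a y)) -> (forall y, of_side q (b y)) ->
    nijenhuis a b (w : Efib A x) = 0.
  move=> sa sb qa qb.
  (* Applying S to [a] and [b] and moving both copies onto [w'] costs S^2 = -1, and leaves three
     arguments on the side of [w']. *)
  have other (w' : Efib A x) : of_side (~~ q) w' -> nijenhuis a b w' = 0.
    move=> qw; have := nijenhuisS1 w' sa (Ssmooth oT sb).
    rewrite (nijenhuisS2 (S w') sa sb) SS nijenhuisNr => E.
    apply/eqP; rewrite -oppr_eq0 -E; apply/eqP; apply: (vanishv (~~ q)) => //;
      by [exact: Ssmooth|move=> y; exact: Sside].
  rewrite (splitv w) nijenhuisDr.
  have own (w' : Efib A x) : of_side q w' -> nijenhuis a b w' = 0 by exact: vanishv.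
  case: q qa qb other own => qa qb other own.
    by rewrite [X in X + _]own// add0r; exact: other.
  by rewrite [X in X + _]other// add0r; exact: own.
have mixed q a b w : smooth_sec setT a -> smooth_sec setT b ->
    (forall y, of_side q (a y)) -> (forall y, of_side (~~ q) (b y)) ->
    nijenhuis a b (w : Efib A x) = 0.
  (* [b'] is the preimage of [b] under S; it lies on the side of [a], which reduces to the case
     [same]. *)
  move=> sa sb qa qb; pose b' : Esection A := fun y => S (- b y).
  have sNb : smooth_sec setT (fun y => - b y) by exact: smooth_secN.
  have -> : b = fun y => S (b' y).
    by apply: functional_extensionality_dep => y; rewrite /b' SS opprK.
  rewrite nijenhuisS2//; last exact: Ssmooth.
  apply: (same q) => //; first exact: Ssmooth.
  move=> y; rewrite -[q]negbK; apply: Sside.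
  by move: (qb y); case: (q) => /= ->; rewrite oppr0.
move=> se se'.
have sp q a : smooth_sec setT a -> smooth_sec setT (part q a) by exact: smooth_part.
rewrite (part_sum e) (part_sum e') nijenhuisDl; try exact: sp.
rewrite !nijenhuisDm; try exact: sp.
have ps := of_side_part.
rewrite (same true _ _ _ (sp true _ se) (sp true _ se') (ps true _) (ps true _)).
rewrite (same false _ _ _ (sp false _ se) (sp false _ se') (ps false _) (ps false _)).
rewrite (mixed true _ _ _ (sp true _ se) (sp false _ se') (ps true _) (ps false _)).
rewrite (mixed false _ _ _ (sp false _ se) (sp true _ se') (ps false _) (ps true _)).
by rewrite !addr0.
Qed.

End Vanishing.
End AlmostComplex.

(** * Hypersymplectic structures *)

Section Hypersymplectic.
Variables (R : realType) (n r : nat) (M : manifold R n) (A : vbundle M r).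
Variables (om : 'Z_3 -> form2 A) (pi : 'Z_3 -> form2 (dual A)).
Implicit Types (a b c d e : Esection A) (t : trivz A) (x : M) (Th : gfamily A) (q : bool).

(* [Smat] with the base point implicit *)
Definition smat i x (v : Efib A x) : Efib A x := Smat om pi i v.

Lemma smat_lin i x (a : R) (u v : Efib A x) : smat i (a *: u + v) = a *: smat i u + smat i v.
Proof. exact: Smat_lin. Qed.

Lemma smat_smooth i (U : set M) e : open U -> smooth_sec U e ->
  smooth_sec U (fun x => smat i (e x)).
Proof. exact: Smat_smooth. Qed.

Lemma smat_skew i x (u v : Efib A x) : Epair (smat i u) v = - Epair u (smat i v).
Proof. exact: Smat_skew. Qed.

Lemma smat_side i q x (v : Efib A x) : of_side q v -> of_side (~~ q) (smat i v).
Proof. exact: Smat_side. Qed.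

Lemma smat_neg i x (v : Efib A x) : smat i (- v) = - smat i v.
Proof.
have S00 : smat i (0 : Efib A x) = 0 by rewrite /smat /Smat /= sharp0 flat0 oppr0.
by rewrite -scaleN1r -[-1 *: v]addr0 smat_lin S00 addr0 scaleN1r.
Qed.

Lemma smooth_inA X : smooth_section X -> smooth_sec setT (inA X : Esection A).
Proof.
move=> sX; apply/smooth_EsectionP; split=> // c a.
have z : smooth_on (tdom c) (fun=> 0 : R) by apply: smooth_on_cst; exact: tdom_open.
apply: (smooth_on_ext (tdom_open c) _ z) => x _ /=.
by symmetry; apply: linear0.
Qed.

Lemma smooth_inA' al : smooth_section al -> smooth_sec setT (inA' al : Esection A).
Proof.
move=> sX; apply/smooth_EsectionP; split=> // c a.
have z : smooth_on (tdom c) (fun=> 0 : R) by apply: smooth_on_cst; exact: tdom_open.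
apply: (smooth_on_ext (tdom_open c) _ z) => x _ /=.
by symmetry; apply: linear0.
Qed.

Lemma Epair_smat_inA i x (X : A x) (v : Efib A x) :
  Epair (smat i (X, 0)) v = om i x X v.1.
Proof.
rewrite /Epair /smat /Smat /= sharp0 oppr0 linear0 addr0.
exact: flatE.
Qed.

Lemma Epair_smat_inA' i x (al : dual A x) (v : Efib A x) :
  Epair (- smat i (0, al)) v = pi i x al v.2.
Proof.
rewrite /Epair /smat /Smat /= opprK flat0 oppr0 zero_lfunE add0r.
exact: sharpE.
Qed.

Lemma diff2_liealgd i Th X Y Z x : gskew Th ->
  smooth_section X -> smooth_section Y -> smooth_section Z ->
  diff2 (liealgd Th) (om i) X Y Z x =
  cyc (smat i) Th (triv_at A x) x (inA X) (inA Y) (inA Z).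
Proof.
move=> sk; apply: diff2_cyc => //.
- exact: smat_smooth.
- exact: smooth_inA.
- by move=> X' Y' y; rewrite Epair_smat_inA.
- by move=> X' f y; exact: anchor_lie_der.
- move=> X' Y' Z' y; rewrite -Epair_bracket// EpairC Epair_smat_inA.
  by rewrite form_skew.
Qed.

Lemma cycN i Th x a b c : smooth_sec setT a -> smooth_sec setT b -> smooth_sec setT c ->
  cyc (fun x (v : Efib A x) => - smat i v) Th (triv_at A x) x a b c =
  - cyc (smat i) Th (triv_at A x) x a b c.
Proof.
move=> sa sb sc; have tx := triv_at_dom A x.
rewrite /cyc dorfNr dorfNm ?dorfNl; try by apply: Ssmooth_diffs => //; exact: smat_smooth.
by ring.
Qed.

(** The bivector enters [Smat] with a minus sign, so on the dual side the form is attached to -S;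
    [cyc] changes sign with S. *)
Lemma diff2_liealgd' i Th X Y Z x : gskew Th ->
  smooth_section X -> smooth_section Y -> smooth_section Z ->
  diff2 (liealgd' Th) (pi i) X Y Z x =
  - cyc (smat i) Th (triv_at A x) x (inA' X) (inA' Y) (inA' Z).
Proof.
move=> sk sX sY sZ; rewrite -cycN; try exact: smooth_inA'.
apply: diff2_cyc => //.
- by move=> U e oU se; apply: smooth_secN => //; exact: smat_smooth.
- exact: smooth_inA'.
- by move=> X' Y' y; rewrite Epair_smat_inA'.
- by move=> X' f y; exact: anchor_lie_der.
- move=> X' Y' Z' y; rewrite -Epair_bracket// EpairC Epair_smat_inA'.
  by rewrite form_skew.
Qed.

(** One endomorphism of the sum bundle that restricts to N_i on A and to the transition morphism of
    the bivectors on the dual. *)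
Definition transition i x (v : Efib A x) : Efib A x := - smat (i - 1) (smat (i + 1) v).

Lemma transition_inA i x (X : A x) : transition i ((X, 0) : Efib A x) =
  (sharp (pi (i - 1)) (flat (om (i + 1)) X), 0).
Proof.
rewrite /transition /smat /Smat /= sharp0 !oppr0 flat0.
by congr (_, _); rewrite /= ?opprK ?oppr0.
Qed.

Lemma transition_inA' i x (al : dual A x) : transition i ((0, al) : Efib A x) =
  (0, flat (om (i - 1)) (sharp (pi (i + 1)) al)).
Proof.
apply/eqP; rewrite -subr_eq0 /transition -opprD oppr_eq0; apply/eqP.
rewrite /smat /Smat /= flat0 sharp0 oppr0.
have := flat_lin (om (i - 1)) (-1) (sharp (pi (i + 1)) al) 0.
rewrite addr0 !scaleN1r flat0 addr0 => ->.
by congr (_, _); rewrite /= ?addr0 ?addNr.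
Qed.

Lemma transition_side i q x (v : Efib A x) : of_side q v -> of_side q (transition i v).
Proof.
move=> qv; have := smat_side (i - 1) (smat_side (i + 1) qv); rewrite negbK.
by rewrite /transition; case: q {qv} => /= ->; rewrite oppr0.
Qed.

Lemma smooth_transition i e : smooth_sec setT e ->
  smooth_sec setT (fun x => transition i (e x)).
Proof.
move=> se; have oT := @openT M.
by apply: smooth_secN => //; do 2! (apply: smat_smooth => //).
Qed.

(** The equality of the N_i d omega_i, in a form that treats A and its dual alike; the sign of
    [diff2_liealgd'] affects both members equally. *)
Definition equal_torsions q Th := forall i j a b c x,
  smooth_sec setT a -> smooth_sec setT b -> smooth_sec setT c ->
  (forall y, of_side q (a y)) -> (forall y, of_side q (b y)) ->
  (forall y, of_side q (c y)) ->
  cyc (smat i) Th (triv_at A x) x (fun y => transition i (a y))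
    (fun y => transition i (b y)) (fun y => transition i (c y)) =
  cyc (smat j) Th (triv_at A x) x (fun y => transition j (a y))
    (fun y => transition j (b y)) (fun y => transition j (c y)).

Lemma side_inA a : (forall y, of_side true (a y)) ->
  a = inA (fun y => (a y).1 : A y) :> Esection A.
Proof.
move=> qa; apply: functional_extensionality_dep => y.
by move: (qa y); rewrite /inA; case: (a y) => u w /= ->.
Qed.

Lemma side_inA' a : (forall y, of_side false (a y)) ->
  a = inA' (fun y => (a y).2 : dual A y) :> Esection A.
Proof.
move=> qa; apply: functional_extensionality_dep => y.
by move: (qa y); rewrite /inA'; case: (a y) => u w /= ->.
Qed.

Lemma equal_torsions_inA Th : gskew Th ->
  (forall i j (X Y Z : section A),
    smooth_section X -> smooth_section Y -> smooth_section Z -> forall x,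
    let N i x (X : A x) : A x := sharp (pi (i - 1)) (flat (om (i + 1)) X) in
    diff2 (liealgd Th) (om i) (fun y => N i y (X y)) (fun y => N i y (Y y))
                              (fun y => N i y (Z y)) x =
    diff2 (liealgd Th) (om j) (fun y => N j y (X y)) (fun y => N j y (Y y))
                              (fun y => N j y (Z y)) x) <->
  equal_torsions true Th.
Proof.
move=> sk; pose N i x (X : A x) : A x := sharp (pi (i - 1)) (flat (om (i + 1)) X).
have NE i X : inA (fun y => N i y (X y)) = fun y => transition i (inA X y).
  by apply: functional_extensionality_dep => y; rewrite /inA transition_inA.
have key i X Y Z x : smooth_section X -> smooth_section Y -> smooth_section Z ->
    diff2 (liealgd Th) (om i) (fun y => N i y (X y)) (fun y => N i y (Y y))
      (fun y => N i y (Z y)) x =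
    cyc (smat i) Th (triv_at A x) x (fun y => transition i (inA X y))
      (fun y => transition i (inA Y y)) (fun y => transition i (inA Z y)).
  move=> sX sY sZ.
  have sN W : smooth_section W -> smooth_section (fun y => N i y (W y)).
    move=> /smooth_inA/(smooth_transition i); rewrite -NE.
    by move=> /smooth_EsectionP[].
  by rewrite diff2_liealgd//; try exact: sN; rewrite !NE.
split=> [H i j a b c x sa sb sc qa qb qc|H i j X Y Z sX sY sZ x N'].
  have s1 d : smooth_sec setT d -> smooth_section (fun y => (d y).1 : A y).
    by move=> /smooth_EsectionP[].
  rewrite (side_inA qa) (side_inA qb) (side_inA qc).
  rewrite -!key; try exact: s1.
  by apply: H; exact: s1.
rewrite !key//; apply: H => //; exact: smooth_inA.
Qed.
Lemma equal_torsions_inA' Th : gskew Th ->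
  (forall i j (X Y Z : section (dual A)),
    smooth_section X -> smooth_section Y -> smooth_section Z -> forall x,
    let N i x (X : dual A x) : dual A x := flat (om (i - 1)) (sharp (pi (i + 1)) X) in
    diff2 (liealgd' Th) (pi i) (fun y => N i y (X y)) (fun y => N i y (Y y))
                              (fun y => N i y (Z y)) x =
    diff2 (liealgd' Th) (pi j) (fun y => N j y (X y)) (fun y => N j y (Y y))
                              (fun y => N j y (Z y)) x) <->
  equal_torsions false Th.
Proof.
move=> sk; pose N i x (X : dual A x) : dual A x := flat (om (i - 1)) (sharp (pi (i + 1)) X).
have NE i X : inA' (fun y => N i y (X y)) = fun y => transition i (inA' X y).
  by apply: functional_extensionality_dep => y; rewrite /inA' transition_inA'.
have key i X Y Z x : smooth_section X -> smooth_section Y -> smooth_section Z ->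
    diff2 (liealgd' Th) (pi i) (fun y => N i y (X y)) (fun y => N i y (Y y))
      (fun y => N i y (Z y)) x =
    - cyc (smat i) Th (triv_at A x) x (fun y => transition i (inA' X y))
      (fun y => transition i (inA' Y y)) (fun y => transition i (inA' Z y)).
  move=> sX sY sZ.
  have sN W : smooth_section W -> smooth_section (fun y => N i y (W y)).
    move=> /smooth_inA'/(smooth_transition i); rewrite -NE.
    by move=> /smooth_EsectionP[_].
  by rewrite diff2_liealgd'//; try exact: sN; rewrite !NE.
split=> [H i j a b c x sa sb sc qa qb qc|H i j X Y Z sX sY sZ x N'].
  have s1 d : smooth_sec setT d -> smooth_section (fun y => (d y).2 : dual A y).
    by move=> /smooth_EsectionP[_].
  rewrite (side_inA' qa) (side_inA' qb) (side_inA' qc).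
  apply: oppr_inj; rewrite -!key; try exact: s1.
  by apply: H; exact: s1.
rewrite !key//; congr (- _); apply: H => //; exact: smooth_inA'.
Qed.

(** * Separation of the total structure by bidegree *)

Section TotalStructure.
Variables (mu ga psi phi : gfamily A).
Hypotheses (gmu : gfunction 1 2 mu) (gga : gfunction 2 1 ga).
Hypotheses (gpsi : gfunction 3 0 psi) (gphi : gfunction 0 3 phi).
Let Theta := gadd (gadd (gadd mu ga) psi) phi.

Lemma gfunction_skew k l (Th : gfamily A) : gfunction k l Th -> gskew Th.
Proof. by case. Qed.

Lemma gskew_Theta : gskew Theta.
Proof.
apply: gskew_gadd; last exact: gfunction_skew gphi.
apply: gskew_gadd; last exact: gfunction_skew gpsi.
apply: gskew_gadd; first exact: gfunction_skew gmu.
exact: gfunction_skew gga.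
Qed.

(** The position in the list is the second degree: 0 for [psi], 1 for [ga], 2 for [mu], 3 for
    [phi]. *)
Lemma dorf_Theta q1 q2 q3 t x e e' (v : Efib A x) : tzdom t x ->
  (forall y, of_side q1 (e y)) -> (forall y, of_side q2 (e' y)) -> of_side q3 v ->
  dorf Theta t e e' v =
    dorf (nth psi [:: psi; ga; mu; phi] (q1 + q2 + q3)) t e e' v.
Proof.
move=> tx e1 e2 v3; rewrite !dorf_gadd.
have z k l (Th : gfamily A) : gfunction k l Th ->
    dorf Th t e e' v = if (q1 + q2 + q3 == l)%N then dorf Th t e e' v else 0.
  move=> [_ _ deg _]; case: ifPn => // nl.
  by apply: dorf_side0 e1 e2 v3 nl => w; exact: deg.
rewrite (z _ _ _ gmu) (z _ _ _ gga) (z _ _ _ gpsi) (z _ _ _ gphi).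
clear z e1 e2 v3.
by case: q1 q2 q3 => [] [] [] /=; rewrite ?addr0 ?add0r.
Qed.

(** With S in exactly one slot, two arguments stay on side [q] and one leaves it. *)
Lemma cyc_Theta i q t x a b c : tzdom t x -> (forall y, of_side q (a y)) ->
  (forall y, of_side q (b y)) -> (forall y, of_side q (c y)) ->
  cyc (smat i) Theta t x a b c = cyc (smat i) (if q then mu else ga) t x a b c.
Proof.
move=> tx qa qb qc; rewrite /cyc.
rewrite (dorf_Theta tx qa qb (smat_side i (qc x))).
rewrite (dorf_Theta tx qa (fun y => smat_side i (qb y)) (qc x)).
rewrite (dorf_Theta tx (fun y => smat_side i (qa y)) qb (qc x)).
by case: (q).
Qed.

Lemma dorf_Theta_smat i q t x a b c : tzdom t x -> (forall y, of_side q (a y)) ->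
  (forall y, of_side q (b y)) -> (forall y, of_side q (c y)) ->
  dorf Theta t (fun y => smat i (a y)) (fun y => smat i (b y)) (smat i (c x)) =
  dorf (if q then psi else phi) t
    (fun y => smat i (a y)) (fun y => smat i (b y)) (smat i (c x)).
Proof.
move=> tx qa qb qc.
rewrite (dorf_Theta tx (fun y => smat_side i (qa y)) (fun y => smat_side i (qb y))
  (smat_side i (qc x))).
by case: (q).
Qed.

End TotalStructure.

(** * Quaternionic relations between the S_i and the N_i *)

Section Quaternions.
Hypothesis SS : forall i x (v : Efib A x), smat i (smat i v) = - v.

(** Since both factors square to -1, their product squares to -1 exactly when they anticommute; this
    ties N_i to the pair of indices other than i. *)
Lemma anticommute_transition :
  (forall i j, i != j -> forall x (v : Efib A x), smat i (smat j v) = - smat j (smat i v)) <->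
  (forall i x (v : Efib A x), transition i (transition i v) = - v).
Proof.
split=> [anti i x v|tt].
  rewrite /transition smat_neg smat_neg opprK.
  have ij : i + 1 != i - 1 by case: i => [[|[|[|?]]] ?].
  by rewrite (anti (i + 1) (i - 1))// smat_neg SS opprK SS.
have cc i x (v : Efib A x) : smat (i - 1) (smat (i + 1) v) = - smat (i + 1) (smat (i - 1) v).
  have := tt i x v; rewrite /transition !smat_neg opprK => /(congr1 (@smat (i - 1) x)).
  rewrite SS smat_neg => /oppr_inj/(congr1 (@smat (i + 1) x)).
  by rewrite SS => <-; rewrite opprK.
move=> i j ij x v.
(* Distinct indices of Z/3 are consecutive, hence of the form [k + 1] and [k - 1] in some order,
   with k the third index. *)
have [ji|ji] : j = i + 1 \/ i = j + 1.
  by case: i j ij => [[|[|[|?]]] ?] [[|[|[|?]]] ?] // _;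
    try (by left; apply: val_inj); by right; apply: val_inj.
- have [k [-> ->]] : exists k, i = k + 1 /\ j = k - 1.
    exists (i - 1); rewrite subrK ji; split=> //.
    by case: (i) => [[|[|[|?]]] ?] //; apply: val_inj.
  by rewrite cc opprK.
have [k [-> ->]] : exists k, i = k - 1 /\ j = k + 1.
  exists (j - 1); rewrite subrK ji; split=> //.
  by case: (j) => [[|[|[|?]]] ?] //; apply: val_inj.
exact: cc.
Qed.

Hypothesis anti : forall i j, i != j ->
  forall x (v : Efib A x), smat i (smat j v) = - smat j (smat i v).

(** Raising the index permutes the three factors of S_i S_{i-1} S_{i+1} cyclically, which takes two
    anticommutations and so no sign. *)
Lemma smat_transition i j x (v : Efib A x) :
  smat i (transition i v) = smat j (transition j v).
Proof.
have step k : smat (k + 1) (transition (k + 1) v) = smat k (transition k v).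
  have k2 : k + 1 + 1 = k - 1 by case: k => [[|[|[|?]]] ?] //; apply: val_inj.
  have k1 : k + 1 != k by case: k {k2} => [[|[|[|?]]] ?].
  have km : k + 1 != k - 1 by case: k {k1 k2} => [[|[|[|?]]] ?].
  rewrite /transition addrK k2 !smat_neg; congr (- _).
  by rewrite (anti k1) (anti km) smat_neg opprK.
have all0 k : smat k (transition k v) = smat 0 (transition 0 v).
  have s0 := step 0; have s1 := step (0 + 1).
  case: k => [[|[|[|?]]] k3] //.
  - by congr (smat _ (transition _ v)); apply: val_inj.
  - by rewrite -s0; congr (smat _ (transition _ v)); apply: val_inj.
  - by rewrite -s0 -s1; congr (smat _ (transition _ v)); apply: val_inj.
by rewrite all0 [RHS]all0.
Qed.

End Quaternions.

(** On the images under S of arguments of one side, torsion and bracket see different components. S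
    is invertible, with inverse -S, so these images exhaust the one-sided arguments, and
    [nijenhuis0] passes to all others. *)
Lemma torsion_forms mu ga psi phi :
    gfunction 1 2 mu -> gfunction 2 1 ga -> gfunction 3 0 psi -> gfunction 0 3 phi ->
    (forall i x (v : Efib A x), smat i (smat i v) = - v) ->
  (forall i, opposite
     (deform (deform (courant (gadd (gadd (gadd mu ga) psi) phi)) (@smat i)) (@smat i))
     (courant (gadd (gadd (gadd mu ga) psi) phi))) <->
  (forall i q a b c x, smooth_sec setT a -> smooth_sec setT b -> smooth_sec setT c ->
     (forall y, of_side q (a y)) -> (forall y, of_side q (b y)) ->
     (forall y, of_side q (c y)) ->
   cyc (@smat i) (if q then mu else ga) (triv_at A x) x a b c =
   dorf (if q then psi else phi) (triv_at A x)
     (fun y => smat i (a y)) (fun y => smat i (b y)) (smat i (c x))).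
Proof.
move=> gmu gga gpsi gphi SS; have oT := @openT M.
have sk := gskew_Theta gmu gga gpsi gphi.
set Th := gadd _ _ in sk *.
have key i q a b c x : smooth_sec setT a -> smooth_sec setT b -> smooth_sec setT c ->
    (forall y, of_side q (a y)) -> (forall y, of_side q (b y)) ->
    (forall y, of_side q (c y)) ->
    nijenhuis (@smat i) Th (fun y => smat i (a y)) (fun y => smat i (b y)) (smat i (c x)) =
    cyc (@smat i) (if q then mu else ga) (triv_at A x) x a b c -
    dorf (if q then psi else phi) (triv_at A x)
     (fun y => smat i (a y)) (fun y => smat i (b y)) (smat i (c x)).
  move=> sa sb sc qa qb qc; have tx := triv_at_dom A x.
  rewrite /nijenhuis (tors_cyc (@smat_smooth i) (SS i))//.
  rewrite (cyc_Theta gmu gga gpsi gphi i tx qa qb qc).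
  by rewrite (dorf_Theta_smat gmu gga gpsi gphi i tx qa qb qc).
split=> [op i q a b c x sa sb sc qa qb qc|H i].
  apply/eqP; rewrite -subr_eq0 -key// subr_eq0; apply/eqP.
  move/(oppositeP (@smat_skew i) (SS i) sk) : (op i).
  by apply; exact: smat_smooth.
apply/(oppositeP (@smat_skew i) (SS i) sk) => e e' se se' x v.
apply/eqP; rewrite -subr_eq0; apply/eqP.
apply: (nijenhuis0 (@smat_lin i) (@smat_smooth i) (SS i) (@smat_side i)) => // q a b c z.
move=> sa sb sc qa qb qc.
pose inv (d : Esection A) : Esection A := fun y => - smat i (d y).
have SK d : d = fun y => smat i (inv d y).
  by apply: functional_extensionality_dep => y; rewrite smat_neg SS opprK.
have sinv d : smooth_sec setT d -> smooth_sec setT (inv d).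
  by move=> sd; apply: smooth_secN => //; exact: smat_smooth.
have qinv d : (forall y, of_side q (d y)) -> forall y, of_side (~~ q) (inv d y).
  move=> qd y; move: (smat_side i (qd y)); rewrite /inv.
  by case: (q) => /= ->; rewrite oppr0.
rewrite (SK a) (SK b) [c z](_ : _ = smat i (inv c z)); last by rewrite {1}(SK c).
rewrite (key _ (~~ q)) ?H ?subrr//; by [exact: sinv|exact: qinv].
Qed.

Lemma hypersymplecticP mu ga psi phi :
    gfunction 1 2 mu -> gfunction 2 1 ga -> gfunction 3 0 psi -> gfunction 0 3 phi ->
    (forall i x (v : Efib A x), smat i (smat i v) = - v) ->
    (forall i j, i != j -> forall x (v : Efib A x), smat i (smat j v) = - smat j (smat i v)) ->
  (forall i, opposite
     (deform (deform (courant (gadd (gadd (gadd mu ga) psi) phi)) (@smat i)) (@smat i))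
     (courant (gadd (gadd (gadd mu ga) psi) phi))) ->
  equal_torsions true mu /\ equal_torsions false ga.
Proof.
move=> gmu gga gpsi gphi SS anti.
move=> /(torsion_forms gmu gga gpsi gphi SS) H.
have eqt q : equal_torsions q (if q then mu else ga).
  move=> i j a b c x sa sb sc qa qb qc.
  have st k d := @smooth_transition k d.
  have qt k d (qd : forall y, of_side q (d y)) y := transition_side k (qd y).
  rewrite !(H _ q)//; try exact: st; try exact: qt.
  have E d : (fun y => smat i (transition i (d y))) = fun y => smat j (transition j (d y)).
    by apply: functional_extensionality_dep => y; exact: smat_transition.
  by cbv beta; rewrite (E a) (E b) (smat_transition anti i j).
by split; [exact: (eqt true)|exact: (eqt false)].
Qed.

Lemma exists_torsion_forms mu ga : gfunction 1 2 mu -> gfunction 2 1 ga ->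
    (forall i x (v : Efib A x), smat i (smat i v) = - v) ->
    (forall i j, i != j -> forall x (v : Efib A x), smat i (smat j v) = - smat j (smat i v)) ->
    equal_torsions true mu -> equal_torsions false ga ->
  exists psi phi : gfamily A, [/\ gfunction 3 0 psi, gfunction 0 3 phi &
    forall i, opposite
     (deform (deform (courant (gadd (gadd (gadd mu ga) psi) phi)) (@smat i)) (@smat i))
     (courant (gadd (gadd (gadd mu ga) psi) phi))].
Proof.
move=> gmu gga SS anti tmu tga; have oT := @openT M.
have tt := (anticommute_transition SS).1 anti.
(* The torsion is evaluated on images under S of side [q], which lie on the other side; so [mu]
   gives a trivector and [ga] a 3-form. *)
pose form q (Th : gfamily A) := tors_form (@smat 0) Th (~~ q).
have form_spec k l q (Th : gfamily A) : gfunction k l Th -> equal_torsions q Th ->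
    forall i a b c x, smooth_sec setT a -> smooth_sec setT b -> smooth_sec setT c ->
     (forall y, of_side q (a y)) -> (forall y, of_side q (b y)) ->
     (forall y, of_side q (c y)) ->
   cyc (@smat i) Th (triv_at A x) x a b c = dorf (form q Th) (triv_at A x)
     (fun y => smat i (a y)) (fun y => smat i (b y)) (smat i (c x)).
  move=> gTh tTh i a b c x sa sb sc qa qb qc; have tx := triv_at_dom A x.
  rewrite (dorf_tors_form (@smat_lin 0) (@smat_smooth 0) (@smat_skew 0) (@smat_side 0) gTh
    (U := setT) (e3 := fun y => smat i (c y)) oT)//;
    try (by apply: smat_smooth); try (by move=> y; apply: smat_side).
  (* The inverse of N_i is -N_i. Writing d = N_i d' turns S_i d into S_0 N_0 d', which passes from
     the index i to the index 0 used in [form]. *)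
  pose pre (d : Esection A) : Esection A := fun y => transition i (- d y).
  have preK d : d = fun y => transition i (pre d y).
    by apply: functional_extensionality_dep => y; rewrite tt opprK.
  have spre d : smooth_sec setT d -> smooth_sec setT (pre d).
    by move=> sd; apply: smooth_transition; exact: smooth_secN.
  have qpre d : (forall y, of_side q (d y)) -> forall y, of_side q (pre d y).
    move=> qd y; apply: transition_side; move: (qd y).
    by case: (q) => /= ->; rewrite oppr0.
  have SE d : (fun y => smat i (d y)) = fun y => smat 0 (transition 0 (pre d y)).
    apply: functional_extensionality_dep => y.
    by rewrite (smat_transition anti 0 i) /pre tt opprK.
  rewrite (SE a) (SE b) -[smat i (c x)]/((fun y => smat i (c y)) x) (SE c).
  have sT d : smooth_sec setT d -> smooth_sec setT (fun y => transition 0 (pre d y)).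
    by move=> sd; apply: smooth_transition; exact: spre.
  have -> := tors_cyc (@smat_smooth 0) (SS 0) Th tx (sT _ sa) (sT _ sb) (sT _ sc).
  rewrite {1}(preK a) {1}(preK b) {1}(preK c).
  by apply: tTh; by [exact: spre|exact: qpre].
exists (form true mu), (form false ga).
have gpsi : gfunction 3 0 (form true mu).
  exact: (@gfunction_tors_form _ _ _ _ _ _ (@smat_lin 0) (@smat_smooth 0) (@smat_skew 0)
    (@smat_side 0) 1 2 mu false).
have gphi : gfunction 0 3 (form false ga).
  exact: (@gfunction_tors_form _ _ _ _ _ _ (@smat_lin 0) (@smat_smooth 0) (@smat_skew 0)
    (@smat_side 0) 2 1 ga true).
split=> //; apply/(torsion_forms gmu gga gpsi gphi SS) => i q.
by case: q; [exact: form_spec gmu tmu i|exact: form_spec gga tga i].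
Qed.

End Hypersymplectic.

Theorem proposition9p5 (R : realType) (n r : nat) (M : manifold R n)
    (A : vbundle M r) (mu ga : gfamily A) (om : 'Z_3 -> form2 A)
    (pi : 'Z_3 -> form2 (dual A)) :
  lie_bialgebroid mu ga ->
  (hypersymplectic_torsion (liealgd mu) om
     (fun i x X => flat (om i) X)
     (fun i x al => sharp (pi i) al)
   /\
   hypersymplectic_torsion (liealgd' ga) pi
     (fun i x al => sharp (pi i) al)
     (fun i x X => flat (om i) X))
  <->
  (exists psi phi : gfamily A,
     [/\ gfunction 3 0 psi, gfunction 0 3 phi &
         hypersymplectic
           (courant (gadd (gadd (gadd mu ga) psi) phi)) (Smat om pi)]).
Proof.
move=> [[gmu _] [gga _] _].
have skmu := gfunction_skew gmu; have skga := gfunction_skew gga.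
have sumE x (v : Efib A x) : v = (v.1, 0) + (0, v.2) :> Efib A x.
  by case: v => v1 v2; congr (_, _); rewrite /= ?addr0 ?add0r.
have flatN i x (X : A x) : flat (om i) (- X) = - (flat (om i) X : dual_fib A x).
  by have := flat_lin (om i) (-1) X 0; rewrite addr0 !scaleN1r flat0 addr0.
split=> [[[_ KA NA tA] [_ KA' NA' tA']]|[psi [phi [gpsi gphi [_ SS anti op]]]]].
  have SS i x (v : Efib A x) : smat om pi i (smat om pi i v) = - v.
    case: v => X al; rewrite /smat /Smat /=; congr (_, _); first by rewrite /= KA.
    by rewrite flatN KA'.
  (* The hypotheses on A and on its dual give N_i^2 = -1 on each summand; on the whole sum it
     amounts to anticommutation of the S_i. *)
  have tt i x (v : Efib A x) :
      transition om pi i (transition om pi i v) = - v.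
    have tD (u w : Efib A x) : transition om pi i (u + w) =
        transition om pi i u + transition om pi i w.
      by rewrite /transition !(endoD (@smat_lin _ _ _ _ _ om pi _)) opprD.
    rewrite {1}(sumE _ v) !tD !transition_inA !transition_inA' NA NA'.
    by rewrite [in RHS](sumE _ v) opprD; congr (_ + _); congr (_, _); rewrite /= oppr0.
  have anti := (anticommute_transition SS).2 tt.
  have [psi [phi [gpsi gphi op]]] := exists_torsion_forms gmu gga SS anti
    ((equal_torsions_inA om pi skmu).1 tA) ((equal_torsions_inA' om pi skga).1 tA').
  exists psi, phi; split=> //; split=> // i; split; last exact: Smat_skew.
  split=> [x a e e'|e /smooth_EsectionP se]; first exact: Smat_lin.
  by apply/smooth_EsectionP; apply: Smat_smooth => //; exact: openT.
have [tA tA'] := hypersymplecticP gmu gga gpsi gphi SS anti op.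
(* S_i^2 = -1 read on (X, 0) and, below, on (0, al) says that the two maps are mutually inverse;
   nondegeneracy of both forms follows. *)
have KA i x (X : A x) : sharp (pi i) (flat (om i) X) = X.
  by have /(congr1 fst)/oppr_inj := SS i x (X, 0).
have KA' i x (al : dual A x) : flat (om i) (sharp (pi i) al) = al.
  by have := congr1 snd (SS i x (0, al)); rewrite /= flatN => /oppr_inj.
have tt := (anticommute_transition SS).1 anti.
split; split.
- move=> i x X X0; rewrite -(KA i x X) -[RHS](sharp0 pi i x); congr (sharp _ _).
  by apply/lfunP => Y; rewrite zero_lfunE [LHS]flatE X0.
- exact: KA.
- by move=> i x X; have := tt i x (X, 0); rewrite !transition_inA => -[].
- exact: ((equal_torsions_inA om pi skmu).2 tA).
- move=> i x al al0; rewrite -(KA' i x al) -[RHS](flat0 om i x); congr (flat _ _).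
  by apply: dual_sep => be; rewrite linear0 sharpE al0.
- exact: KA'.
- by move=> i x al; have := tt i x (0, al); rewrite !transition_inA' => -[].
- exact: ((equal_torsions_inA' om pi skga).2 tA').
Qed.
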